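(* (Efficiency.) Consider the distributed Stokes control problem and its Crouzeix–Raviart/$\mathbb P_0$ discretization described in the context. For $e\in\mathcal E_h^i$ let $\mathcal T_e$ be the set of the two triangles sharing the edge $e$. Then there is a constant $C>0$ independent of the mesh-size such that for all $T\in\mathcal T_h$ and all $e\in\mathcal E_h^i$: $$h_T\|\mathbf f+\mathbf y_h\|_{0,T}\le C\big(\|\nabla(\mathbf u-\mathbf u_h)\|_{0,T}+\|p-p_h\|_{0,T}+osc(\mathbf f,T)+\|\mathbf y-\mathbf y_h\|_{0,T}\big),$$ $$h_T\|\mathbf u_h-\mathbf u_d\|_{0,T}\le C\big(\|\mathbf u-\mathbf u_h\|_{0,T}+\|\nabla(\boldsymbol\phi-\boldsymbol\phi_h)\|_{0,T}+\|r-r_h\|_{0,T}+osc(\mathbf u_d,T)\big),$$ $$\|h_e^{1/2}[\![p_hI-\nabla\mathbf u_h]\!]\|_{0,e}\le C\sum_{T\in\mathcal T_e}\big(\|\nabla(\mathbf u-\mathbf u_h)\|_{0,T}+\|p-p_h\|_{0,T}+osc(\mathbf f,T)+\|\mathbf y-\mathbf y_h\|_{0,T}\big),$$ $$\|h_e^{1/2}[\![r_hI+\nabla\boldsymbol\phi_h]\!]\|_{0,e}\le C\sum_{T\in\mathcal T_e}\big(\|\mathbf u-\mathbf u_h\|_{0,T}+\|\nabla(\boldsymbol\phi-\boldsymbol\phi_h)\|_{0,T}+\|r-r_h\|_{0,T}+osc(\mathbf u_d,T)\big),$$ $$\|\boldsymbol\phi_h-\Pi_h\boldsymbol\phi_h\|_{0,T}\le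 C\big(\|\boldsymbol\phi_h-\boldsymbol\phi\|_{0,T}+\|\boldsymbol\phi-\Pi_h\boldsymbol\phi_h\|_{0,T}\big).$$
   Context: $\Omega\subset\mathbb R^2$ is a bounded polygonal domain, $\|\cdot\|_{k,D}$ is the $H^k(D)$ norm, $L^2_0(\Omega)$ the zero-mean functions in $L^2(\Omega)$. $\mathbf f,\mathbf u_d\in[L^2(\Omega)]^2$, $\lambda>0$, $\mathbf y_a<\mathbf y_b$ in $[\mathbb R\cup\{\pm\infty\}]^2$ (componentwise). Continuous problem. $X=[H_0^1(\Omega)]^2$, $M=L_0^2(\Omega)$, $Q=[L^2(\Omega)]^2$, $Q_{ad}=\{\mathbf x\in Q:\mathbf y_a\le\mathbf x\le\mathbf y_b\}$ (a.e., componentwise), $a(\mathbf v,\mathbf z)=\int_\Omega\nabla\mathbf v:\nabla\mathbf z\,dx$, $b(\mathbf z,p)=-\int_\Omega p\,\nabla\cdot\mathbf z\,dx$. The continuous solution $((\mathbf u,p),(\boldsymbol\phi,r),\mathbf y)\in(X\times M)^2\times Q_{ad}$ satisfies, with $\langle\cdot,\cdot\rangle$ the $[L^2(\Omega)]^2$ inner product, for all $\mathbf z\in X,w\in M,\mathbf x\in Q_{ad}$: $a(\mathbf u,\mathbf z)+b(\mathbf z,p)=\langle\mathbf y+\mathbf f,\mathbf z\rangle$, $b(\mathbf u,w)=0$, $a(\mathbf z,\boldsymbol\phi)-b(\mathbf z,r)=\langle\mathbf u-\mathbf u_d,\mathbf z\rangle$, $b(\boldsymbol\phi,w)=0$, $\langle\boldsymbol\phi+\lambda\mathbf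 y,\mathbf x-\mathbf y\rangle\ge0$. Discrete problem. $\mathcal T_h$ is a (shape-)regular triangulation of $\Omega$ into triangles, $h_T=\operatorname{diam}T$; $\mathcal E_h^i$ are the interior edges, $h_e$ the length of $e$; $\mathbb P_0(\mathcal T_h)$ are the piecewise constants. $X_h$ is the set of $\mathbf v_h\in[L^2(\Omega)]^2$ with $\mathbf v_h|_T\in[\mathbb P_1(T)]^2$ for all $T$, continuous at midpoints of interior edges and zero at midpoints of boundary edges (Crouzeix–Raviart). $M_h=\mathbb P_0(\mathcal T_h)\cap L_0^2(\Omega)$, $Q_h=[\mathbb P_0(\mathcal T_h)]^2$, $Q_{ad}^h=\{\mathbf x_h\in Q_h:\mathbf y_a\le\mathbf x_h\le\mathbf y_b\}$, $\Pi_h$ is the $L^2$-orthogonal projection onto $Q_h$. $a_h(\mathbf v_h,\mathbf z_h)=\sum_T\int_T\nabla\mathbf v_h:\nabla\mathbf z_h\,dx$, $b_h(\mathbf z_h,p_h)=-\sum_T\int_Tp_h\nabla\cdot\mathbf z_h\,dx$. The discrete solution $((\mathbf u_h,p_h),(\boldsymbol\phi_h,r_h),\mathbf y_h)\in(X_h\times M_h)^2\times Q_{ad}^h$ satisfies for all $\mathbf z_h\in X_h,w_h\in M_h,\mathbf x_h\in Q_{ad}^h$: $a_h(\mathbf u_h,\mathbf z_h)+b_h(\mathbf z_h,p_h)=\langle\mathbf y_h+\mathbf f,\mathbf z_h\rangle$, $b_h(\mathbf u_h,w_h)=0$, $a_h(\mathbf z_h,\boldsymbol\phi_h)-b_h(\mathbf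 z_h,r_h)=\langle\mathbf u_h-\mathbf u_d,\mathbf z_h\rangle$, $b_h(\boldsymbol\phi_h,w_h)=0$, $\langle\boldsymbol\phi_h+\lambda\mathbf y_h,\mathbf x_h-\mathbf y_h\rangle\ge0$. Jumps and oscillation. For an interior edge $e=\partial T_+\cap\partial T_-$ with unit normals $\mathbf n_-=-\mathbf n_+$, $[\![\tau]\!]=\tau_+\mathbf n_++\tau_-\mathbf n_-$ for $2\times2$ tensors $\tau$. $I$ is the $2\times2$ identity; $\nabla\mathbf u_h,\nabla\boldsymbol\phi_h$ are elementwise, $(\nabla\mathbf v)_{ij}=\partial_jv_i$. $osc(\mathbf g,T)=h_T\min_{\mathbf g_h\in[\mathbb P_0(T)]^2}\|\mathbf g-\mathbf g_h\|_{0,T}$. ''Independent of the mesh-size'': depending only on $\Omega$, $\lambda$ and the shape regularity of $\mathcal T_h$. *)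

(* Defs.v *)
From HB Require Import structures.
From mathcomp Require Import all_boot all_order all_algebra.
From mathcomp Require Import all_classical all_reals all_analysis.
Set Implicit Arguments.
Unset Strict Implicit.
Unset Printing Implicit Defensive.
Import Order.TTheory GRing.Theory Num.Theory.
Import numFieldNormedType.Exports.
Local Open Scope classical_set_scope.
Local Open Scope ring_scope.

Definition leb2 (R : realType) :
    {measure set (measurableTypeR R * measurableTypeR R)%type -> \bar R} :=
  (@lebesgue_measure R \x @lebesgue_measure R)%E.

Section PlaneGeometry.
Context {R : realType}.
Implicit Types (a b x y : R * R).

(* The library's norm on R * R is the max norm; lengths are Euclidean. *)
Definition enorm x : R := Num.sqrt (x.1 ^+ 2 + x.2 ^+ 2).
Definition cross a b : R := a.1 * b.2 - a.2 * b.1.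
Definition vec2 x : 'cV[R]_2 := \col_(i < 2) (if i == 0 then x.1 else x.2).
Definition basis2 (i : 'I_2) : R * R := ((i == 0)%:R, (i != 0)%:R).

Definition segment a b : set (R * R) :=
  [set (1 - t) *: a + t *: b | t in `[0, 1]].
Definition midpoint a b : R * R := 2^-1 *: (a + b).

Definition diam (A : set (R * R)) : R :=
  sup [set d | exists x y, [/\ A x, A y & d = enorm (x - y)]].
(* The supremum of the diameters of the balls contained in A. *)
Definition inball_diam (A : set (R * R)) : R :=
  sup [set d | exists x (r : R), [/\ 0 <= r,
    [set y | enorm (y - x) <= r] `<=` A & d = 2 * r]].

(* The condition Omega = interior (closure Omega) excludes slits, i.e. boundary
   segments with Omega on both sides. *)
Definition polygonal_domain (Omega : set (R * R)) : Prop :=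
  [/\ open Omega, connected Omega, Omega !=set0, bounded_set Omega &
      Omega = (closure Omega)° /\
      exists s : seq ((R * R) * (R * R)),
        closure Omega `\` Omega = \bigcup_(e in [set` s]) segment e.1 e.2].

End PlaneGeometry.

Section LebesgueSpaces.
Context {R : realType}.
Implicit Types (D Omega : set (R * R)).

Definition mdot k l (A B : 'M[R]_(k, l)) : R := \sum_i \sum_j A i j * B i j.
Definition frob k l (A : 'M[R]_(k, l)) : R := Num.sqrt (mdot A A).

Definition L2 D (g : R * R -> R) : Prop :=
  (g \_ D : measurableTypeR R * measurableTypeR R -> R) \in Lfun (leb2 R) 2%:E.
Definition L2v D (g : R * R -> 'cV[R]_2) : Prop :=
  forall i, L2 D (fun x => g x i 0).
Definition L20 Omega (g : R * R -> R) : Prop :=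
  L2 Omega g /\ \int[leb2 R]_(x in Omega) g x = 0.

Definition norm0 D (g : R * R -> R) : R :=
  fine 'N[leb2 R]_2%:E[EFin \o g \_ D]%E.
Definition norm0m D k l (g : R * R -> 'M[R]_(k, l)) : R :=
  norm0 D (fun x => frob (g x)).

Definition ip Omega k l (g h : R * R -> 'M[R]_(k, l)) : R :=
  \int[leb2 R]_(x in Omega) mdot (g x) (h x).

End LebesgueSpaces.

Section Sobolev.
Context {R : realType}.
Implicit Types (Omega : set (R * R)).

Fixpoint Cn (n : nat) (g : R * R -> R) : Prop :=
  if n is m.+1 then
    continuous g /\ forall i : 'I_2,
      (forall x, derivable g x (basis2 i)) /\ Cn m ('D_(basis2 i) g)
  else continuous g.

Definition test_fun Omega (g : R * R -> R) : Prop :=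
  [/\ forall n, Cn n g,
      compact (closure [set x | g x != 0]) &
      closure [set x | g x != 0] `<=` Omega].

Definition weak_partial Omega (i : 'I_2) (g dg : R * R -> R) : Prop :=
  forall phi, test_fun Omega phi ->
    \int[leb2 R]_(x in Omega) (g x * 'D_(basis2 i) phi x) =
    - \int[leb2 R]_(x in Omega) (dg x * phi x).

(* g belongs to the closure of the test functions in H^1(Omega), and dg is its
   weak gradient. *)
Definition H10 Omega (g : R * R -> R) (dg : 'I_2 -> R * R -> R) : Prop :=
  [/\ L2 Omega g,
      forall i, L2 Omega (dg i),
      forall i, weak_partial Omega i g (dg i) &
      exists phi : nat -> R * R -> R,
        [/\ forall n, test_fun Omega (phi n),
            norm0 Omega (fun x => g x - phi n x) @[n --> \oo] --> (0 : R) &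
            forall i, norm0 Omega (fun x => dg i x - 'D_(basis2 i) (phi n) x)
                        @[n --> \oo] --> (0 : R)]].

(* A vector field paired with a matrix field which [spaceX] constrains to be a
   version of its weak gradient, (wgrad v)_ij = \partial_j v_i. *)
Record wfield := WField {
  wval :> R * R -> 'cV[R]_2 ;
  wgrad : R * R -> 'M[R]_2 }.

Definition spaceX Omega (v : wfield) : Prop :=
  forall i, H10 Omega (fun x => v x i 0) (fun j x => wgrad v x i j).

End Sobolev.
Arguments wfield : clear implicits.

Section ContinuousProblem.
Context {R : realType}.
Implicit Types (Omega : set (R * R)) (u v z phi : wfield R) (p w r : R * R -> R).
Implicit Types (f ud y x : R * R -> 'cV[R]_2) (ya yb : 'I_2 -> \bar R).

Definition Qad Omega ya yb y : Prop :=
  L2v Omega y /\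
  {ae leb2 R, forall s, Omega s ->
    forall i, (ya i <= (y s i 0)%:E)%E /\ ((y s i 0)%:E <= yb i)%E}.

Definition form_a Omega v z : R := ip Omega (wgrad v) (wgrad z).
Definition form_b Omega z p : R :=
  - \int[leb2 R]_(s in Omega) (p s * \tr (wgrad z s)).

Definition continuous_solution Omega (lambda : R) f ud ya yb
    u p phi r y : Prop :=
  [/\ spaceX Omega u, L20 Omega p, spaceX Omega phi, L20 Omega r &
      Qad Omega ya yb y] /\
  [/\ forall z, spaceX Omega z ->
        form_a Omega u z + form_b Omega z p = ip Omega (y \+ f) z,
      forall w, L20 Omega w -> form_b Omega u w = 0,
      forall z, spaceX Omega z ->
        form_a Omega z phi - form_b Omega z r = ip Omega (u \- ud) z,
      forall w, L20 Omega w -> form_b Omega phi w = 0 &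
      forall x, Qad Omega ya yb x ->
        0 <= ip Omega (fun s => phi s + lambda *: y s) (x \- y)].

End ContinuousProblem.

Section Triangulation.
Context {R : realType}.

Definition triangle (K : 'I_3 -> R * R) : set (R * R) :=
  [set x | exists l : 'I_3 -> R,
    [/\ forall i, 0 <= l i, \sum_i l i = 1 & x = \sum_i l i *: K i]].

(* The edge opposite to the vertex of index i has endpoints K (i + 1) and
   K (i + 2), where indices are taken modulo 3. *)
Definition edge (K : 'I_3 -> R * R) (i : 'I_3) : set (R * R) :=
  segment (K (i + 1)) (K (i + 2)).
Definition edge_mid (K : 'I_3 -> R * R) (i : 'I_3) : R * R :=
  midpoint (K (i + 1)) (K (i + 2)).
Definition edge_len (K : 'I_3 -> R * R) (i : 'I_3) : R :=
  enorm (K (i + 2) - K (i + 1)).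

(* The edge vector rotated by a quarter turn and normalized; the sign of the
   cross product makes it point away from the opposite vertex K i. *)
Definition outer_normal (K : 'I_3 -> R * R) (i : 'I_3) : 'cV[R]_2 :=
  let d := K (i + 2) - K (i + 1) in
  (Num.sg (cross d (K i - K (i + 1))) / enorm d) *: vec2 (d.2, - d.1).

Record mesh := Mesh {
  ntri : nat ;
  vertex : 'I_ntri -> 'I_3 -> R * R }.

Definition tri (m : mesh) (T : 'I_(ntri m)) : set (R * R) :=
  triangle (vertex T).

(* Norms and integrals over an element are taken over its interior: the data
   are functions on Omega, so their values on the boundary of Omega, which may
   meet the closed triangles, are meaningless. *)
Definition elt (m : mesh) (T : 'I_(ntri m)) : set (R * R) := (tri T)°.

Definition triangulation (Omega : set (R * R)) (m : mesh) : Prop :=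
  [/\ forall T : 'I_(ntri m),
        cross (vertex T 1 - vertex T 0) (vertex T 2 - vertex T 0) != 0,
      closure Omega = \bigcup_(T in [set: 'I_(ntri m)]) tri T &
      forall T T' : 'I_(ntri m), T != T' ->
        [\/ tri T `&` tri T' = set0,
            exists i j, vertex T i = vertex T' j /\
                        tri T `&` tri T' = [set vertex T i] |
            exists i j, edge (vertex T) i = edge (vertex T') j /\
                        tri T `&` tri T' = edge (vertex T) i]].

Definition shape_regular (sigma : R) (m : mesh) : Prop :=
  forall T : 'I_(ntri m), diam (tri T) <= sigma * inball_diam (tri T).

Definition interior_edge (m : mesh) (T : 'I_(ntri m)) (i : 'I_3)
    (T' : 'I_(ntri m)) (j : 'I_3) : Prop :=
  T != T' /\ edge (vertex T) i = edge (vertex T') j.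

Definition boundary_edge (m : mesh) (T : 'I_(ntri m)) (i : 'I_3) : Prop :=
  forall T' j, ~ interior_edge T i T' j.

End Triangulation.
Arguments mesh : clear implicits.

Section DiscreteProblem.
Context {R : realType}.
Implicit Types (Omega : set (R * R)) (m : mesh R).

(* The pair (A, c) stands for the affine field x |-> A x + c, whose gradient
   is the constant matrix A. *)
Definition affine : Type := ('M[R]_2 * 'cV[R]_2)%type.
Definition aval (v : affine) (x : R * R) : 'cV[R]_2 := v.1 *m vec2 x + v.2.
Definition agrad (v : affine) : 'M[R]_2 := v.1.

(* Elementwise polynomial functions are given by their restrictions to the
   elements; pw is the function on Omega which they define, up to the null set
   formed by the edges. *)
Definition pw m (V : nmodType) (g : 'I_(ntri m) -> R * R -> V)
    (x : R * R) : V :=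
  \sum_(T | x \in elt T) g T x.

Definition pw0 m (V : nmodType) (c : 'I_(ntri m) -> V) : R * R -> V :=
  pw (fun T _ => c T).
Definition pw1 m (v : 'I_(ntri m) -> affine) : R * R -> 'cV[R]_2 :=
  pw (fun T => aval (v T)).
Definition gradh m (v : 'I_(ntri m) -> affine) : R * R -> 'M[R]_2 :=
  pw (fun T _ => agrad (v T)).

Definition spaceXh m (v : 'I_(ntri m) -> affine) : Prop :=
  (forall T i T' j, interior_edge T i T' j ->
     aval (v T) (edge_mid (vertex T) i) = aval (v T') (edge_mid (vertex T) i)) /\
  (forall T i, boundary_edge T i -> aval (v T) (edge_mid (vertex T) i) = 0).

Definition spaceMh Omega m (p : 'I_(ntri m) -> R) : Prop := L20 Omega (pw0 p).

Definition Qadh Omega ya yb m (y : 'I_(ntri m) -> 'cV[R]_2) : Prop :=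
  Qad Omega ya yb (pw0 y).

Definition form_ah m (v z : 'I_(ntri m) -> affine) : R :=
  \sum_T ip (elt T) (fun=> agrad (v T)) (fun=> agrad (z T)).
Definition form_bh m (z : 'I_(ntri m) -> affine) (p : 'I_(ntri m) -> R) : R :=
  - \sum_T \int[leb2 R]_(s in elt T) (p T * \tr (agrad (z T))).

Definition discrete_solution Omega (lambda : R) (f ud : R * R -> 'cV[R]_2)
    (ya yb : 'I_2 -> \bar R) m
    (uh : 'I_(ntri m) -> affine) (ph : 'I_(ntri m) -> R)
    (phih : 'I_(ntri m) -> affine) (rh : 'I_(ntri m) -> R)
    (yh : 'I_(ntri m) -> 'cV[R]_2) : Prop :=
  [/\ spaceXh uh, spaceMh Omega ph, spaceXh phih, spaceMh Omega rh &
      Qadh Omega ya yb yh] /\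
  [/\ forall z : 'I_(ntri m) -> affine, spaceXh z ->
        form_ah uh z + form_bh z ph = ip Omega (pw0 yh \+ f) (pw1 z),
      forall w : 'I_(ntri m) -> R, spaceMh Omega w -> form_bh uh w = 0,
      forall z : 'I_(ntri m) -> affine, spaceXh z ->
        form_ah z phih - form_bh z rh = ip Omega (pw1 uh \- ud) (pw1 z),
      forall w : 'I_(ntri m) -> R, spaceMh Omega w -> form_bh phih w = 0 &
      forall x : 'I_(ntri m) -> 'cV[R]_2, Qadh Omega ya yb x ->
        0 <= ip Omega (fun s => pw1 phih s + lambda *: pw0 yh s)
                      (pw0 x \- pw0 yh)].

Definition L2_projection Omega m (g : R * R -> 'cV[R]_2)
    (Pg : 'I_(ntri m) -> 'cV[R]_2) : Prop :=
  forall q : 'I_(ntri m) -> 'cV[R]_2, ip Omega (g \- pw0 Pg) (pw0 q) = 0.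

Definition osc m (g : R * R -> 'cV[R]_2) (T : 'I_(ntri m)) : R :=
  diam (tri T) *
  inf [set norm0m (elt T) (fun x => g x - c) | c in [set: 'cV[R]_2]].

(* [tau] is given elementwise, so that its two traces on the common edge are
   tau T and tau T'. *)
Definition jump m (T : 'I_(ntri m)) (i : 'I_3) (T' : 'I_(ntri m)) (j : 'I_3)
    (tau : 'I_(ntri m) -> R * R -> 'M[R]_2) (x : R * R) : 'cV[R]_2 :=
  tau T x *m outer_normal (vertex T) i + tau T' x *m outer_normal (vertex T') j.

Definition edge_norm0 (K : 'I_3 -> R * R) (i : 'I_3)
    (g : R * R -> 'cV[R]_2) : R :=
  Num.sqrt (\int[@lebesgue_measure R]_(t in `[0, 1])
    (frob (g ((1 - t) *: K (i + 1) + t *: K (i + 2))) ^+ 2 * edge_len K i)).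

End DiscreteProblem.
Arguments affine : clear implicits.

(* Main.v *)
Require Import Defs.
From mathcomp Require Import all_boot all_order all_algebra.
From mathcomp Require Import all_classical all_reals all_analysis measurable_realfun.
From mathcomp Require Import ring lra.
Set Implicit Arguments.
Unset Strict Implicit.
Unset Printing Implicit Defensive.
Import Order.TTheory GRing.Theory Num.Theory.
Import numFieldNormedType.Exports.
Local Open Scope classical_set_scope.
Local Open Scope ring_scope.

(** The residuals are estimated by testing the weak equations with smooth bubble
functions. On a triangle [T], a bubble supported in a small square around [M]
integrates an affine function [w] to [w(M)] times its mass, and its gradient has
mean zero; so, component by component, the weak equation bounds [w(M)] by the
errors in [T], where [w] is the discrete residual with the data replaced by a
constant. Three such points control [w] on all of [T], by shape regularity. On an
interior edge, the bubble is a product in coordinates sheared along the edge;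
integrating its gradient over the two half planes gives opposite multiples of
the normal, hence the jump of the discrete stress. Bubbles are products of
functions [x^-k exp(-1/x)], so they are test functions by themselves and no
density argument is needed; they live in squares because inscribed balls and
barycentric coordinates bound how fast one leaves a triangle. The last estimate
is the triangle inequality. *)

(** The powers of the mesh-size come from scaling alone: a bubble of size [s] has mass of order
    [s^2], its L2 norm is of order [s] and that of its gradient of order 1, so [s] only has to be
    comparable to the diameter or to the edge length. Inside an element the discrete gradient and
    pressure are constants, which a gradient of mean zero does not see; the adjoint residual,
    however, contains the discrete velocity and is affine, so the first moments of the bubble must
    be known exactly. This replaces the usual equivalence of norms on polynomials weighted by a
    bubble. On an edge the gradient has to see the jump, while its tangential part must contribute
    nothing. Hence the factor transversal to the edge is itself the derivative of a cutoff function
    and does not vanish on the edge, which rules out an even primitive. Oscillations are infima, so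
    all bounds are proved with an arbitrary constant in place of the data and the infimum is taken
    last. The domain enters the constant only through a bound on its diameter, which absorbs the
    factor [h_T] in front of [y - y_h] and [u - u_h]. *)

Lemma is_derive_ext (R : numFieldType) (V W : normedModType R) (f g : V -> W)
    (x v : V) (df dg : W) :
  is_derive x v f df -> f =1 g -> df = dg -> is_derive x v g dg.
Proof. by move=> h /funext <- <-. Qed.

(** * Smooth cutoff functions *)

Section FlatExponential.
Context {R : realType}.
Implicit Types (k : nat) (x v : R).

(** The powers of [x^-1] make the family closed under differentiation, so that smoothness follows by
    induction without any formula for higher derivatives. *)
Definition flat k x : R := if 0 < x then (x^-1) ^+ k * expR (- x^-1) else 0.

Lemma flat_le0 k x : x <= 0 -> flat k x = 0.
Proof. by move=> x0; rewrite /flat ltNge x0. Qed.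

Lemma flat_ge0 k x : 0 <= flat k x.
Proof.
rewrite /flat; case: ifP => // x0.
by rewrite mulr_ge0 ?expR_ge0// exprn_ge0// invr_ge0 ltW.
Qed.

Lemma flatS k x : x * flat k.+1 x = flat k x.
Proof.
rewrite /flat; case: ifP => [x0|]; last by rewrite mulr0.
by rewrite exprS !mulrA mulfV ?gt_eqF// mul1r.
Qed.

Lemma flat_le k x : flat k x <= k.+1`!%:R.
Proof.
case: (ltP 0 x) => [x0|x0]; last by rewrite flat_le0.
suff flatS_le j : flat j.+1 x <= j.+1`!%:R.
  case: k => [|k]; last first.
    by apply: le_trans (flatS_le k) _; rewrite ler_nat leq_fact.
  rewrite /flat x0 expr0 mul1r.
  by rewrite expR_le1 oppr_le0 invr_ge0 ltW.
rewrite /flat x0 expRN ler_pdivrMr ?expR_gt0//.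
have := @expR_ge1Dxn _ x^-1 j; rewrite invr_ge0 ltW// => /(_ isT).
have f0 : 0 < j.+1`!%:R :> R by rewrite ltr0n fact_gt0.
move=> h; rewrite mulrC -ler_pdivrMr//; apply: le_trans h.
by rewrite lerDr.
Qed.

Lemma flat_norm_le k x : `|flat k x| <= k.+2`!%:R * `|x|.
Proof.
by rewrite -flatS normrM mulrC ler_wpM2r// ger0_norm ?flat_ge0// flat_le.
Qed.

(** Quadratic decay makes the difference quotient at 0 of order [h], which settles the derivative at
    the gluing point. *)
Lemma flat_norm_le2 k x : `|flat k x| <= k.+3`!%:R * `|x| ^+ 2.
Proof.
rewrite -flatS normrM mulrC expr2 mulrA ler_wpM2r//.
exact: flat_norm_le.
Qed.

Lemma is_derive_flat k x :
  is_derive x 1 (flat k) (- k%:R * flat k.+1 x + flat k.+2 x).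
Proof.
case: (ltgtP x 0) => [x0|x0|->].
- rewrite !flat_le0 ?(ltW x0)// mulr0 addr0.
  apply: (@near_eq_is_derive _ _ _ (cst 0)).
  near=> y; rewrite /= flat_le0//; apply/ltW; near: y.
  exact: lt_nbhsl.
- have eq_near : \near x, (fun y : R => (y^-1) ^+ k * expR (- y^-1)) x = flat k x.
    by near=> y; rewrite /flat ifT//; near: y; exact: lt_nbhsr.
  apply: (near_eq_is_derive eq_near).
  have x00 : x != 0 by rewrite gt_eqF.
  have dV : is_derive x 1 (fun y : R => y^-1) (- x ^- 2).
    have := @is_deriveV R id x 1 1 x00 (is_derive_id _ _).
    by rewrite /GRing.scale/= mulr1.
  have dE : is_derive x 1 (fun y : R => expR (- y^-1)) (expR (- x^-1) * x ^- 2).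
    have dN := @is_deriveN _ _ _ (fun y : R => y^-1) x 1 _ dV.
    have := @is_derive1_comp _ expR (- (fun y : R => y^-1)) x _ _
      (is_derive_expR _) dN.
    by rewrite opprK.
  rewrite (_ : (fun y => _) = (fun y : R => y^-1) ^+ k * (fun y : R => expR (- y^-1))).
    2: by apply/funext => y; rewrite mulrfctE exprfctE.
  apply: is_derive_eq (is_deriveM (is_deriveX k dV) dE) _; rewrite exprfctE /flat x0 /= /GRing.scale/=.
  case: k {eq_near} => [|k].
    rewrite !expr0 mulr0n !mul0r mulr0 addr0 mul1r.
    by rewrite mulNr mul0r oppr0 add0r exprVn mulrC.
  rewrite -mulr_natl /= -exprVn !exprS; ring.
- rewrite !flat_le0// mulr0 addr0.
  have h0 : (fun h : R => h^-1 *: ((flat k \o shift 0) (h *: 1) - flat k 0)) @ 0^'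
       --> (0 : R).
    apply/cvgrPdist_le => e e0.
    have C0 : 0 < k.+3`!%:R :> R by rewrite ltr0n fact_gt0.
    near=> h.
    have hn0 : h != 0 by near: h; exact: nbhs_dnbhs_neq.
    rewrite sub0r normrN /= addr0 {2}/GRing.scale/= mulr1 [flat k 0]flat_le0//.
    rewrite subr0 /GRing.scale/= normrM normfV ler_pdivrMl ?normr_gt0//.
    apply: le_trans (flat_norm_le2 _ _) _.
    rewrite expr2 mulrCA ler_wpM2l// -ler_pdivlMl//.
    near: h; apply: dnbhs0_le; by rewrite mulr_gt0// invr_gt0.
  apply: DeriveDef; first by apply/cvg_ex; exists 0.
  exact: cvg_lim h0.
Unshelve. all: by end_near. Qed.


Definition bumpP j k v : R := flat j (1 + v) * flat k (1 - v).

Definition dbumpP j k v : R :=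
  - j%:R * bumpP j.+1 k v + bumpP j.+2 k v + k%:R * bumpP j k.+1 v
  - bumpP j k.+2 v.

Lemma is_derive_bumpP j k v : is_derive v 1 (bumpP j k) (dbumpP j k v).
Proof.
have d1 : is_derive v 1 (fun y : R => 1 + y) 1.
  have := is_deriveD (is_derive_cst (1 : R) v (1 : R)) (is_derive_id v (1 : R)).
  by move/is_derive_ext; apply; rewrite // add0r.
have d2 : is_derive v 1 (fun y : R => 1 - y) (- 1).
  have := is_deriveD (is_derive_cst (1 : R) v (1 : R)) (is_deriveNid v (1 : R)).
  by move/is_derive_ext; apply; rewrite // add0r.
have e1 := @is_derive1_comp _ (flat j) _ v _ _ (is_derive_flat j _) d1.
have e2 := @is_derive1_comp _ (flat k) _ v _ _ (is_derive_flat k _) d2.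
have := is_deriveM e1 e2.
move/is_derive_ext; apply=> //; rewrite /dbumpP /bumpP /GRing.scale/=; ring.
Qed.

Lemma bumpP_ge0 j k v : 0 <= bumpP j k v.
Proof. by rewrite mulr_ge0 ?flat_ge0. Qed.

Lemma bumpP_out j k v : 1 <= `|v| -> bumpP j k v = 0.
Proof.
rewrite ler_normr => /orP[v1|v1]; rewrite /bumpP.
  by rewrite (@flat_le0 k) ?mulr0// subr_le0.
by rewrite flat_le0 ?mul0r//; lra.
Qed.

Lemma bumpP_bounded j k : exists B, forall v, `|bumpP j k v| <= B.
Proof.
exists (j.+1`!%:R * k.+1`!%:R) => v.
by rewrite ger0_norm ?bumpP_ge0// ler_pM ?flat_ge0 ?flat_le.
Qed.

(* Hence [v * bumpP 2 2 v] is an exact derivative, and the first moments of the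
   bubbles built from [bumpP 2 2] vanish. *)
Lemma derive_bumpP00 v : dbumpP 0 0 v = - 4 * v * bumpP 2 2 v.
Proof.
rewrite /dbumpP /bumpP -!(flatS 0) -!(flatS 1); ring.
Qed.

(** Both [1 + v] and [1 - v] stay in [[1/2, 3/2]], where [x^-2 >= 4/9] and
    [exp(- x^-1) >= exp(-2)]. *)
Lemma bumpP22_ge v : `|v| <= 2^-1 -> (4 / 9 * expR (- 2)) ^+ 2 <= bumpP 2 2 v.
Proof.
have flat2_ge (x : R) : 2^-1 <= x <= 3 / 2 -> 4 / 9 * expR (- 2) <= flat 2 x.
  move=> /andP[x1 x2]; have x0 : 0 < x by apply: lt_le_trans x1.
  have xV : 2 / 3 <= x^-1 by rewrite -[leRHS]div1r ler_pdivlMr//; lra.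
  have xV2 : x^-1 <= 2 by rewrite invf_ple ?posrE.
  rewrite /flat x0 ler_pM ?expR_ge0//; last by rewrite ler_expR lerN2.
  have -> : 4 / 9 = (2 / 3) ^+ 2 :> R by field.
  by rewrite lerXn2r ?nnegrE ?invr_ge0// ?ltW//; lra.
rewrite ler_norml => /andP[v1 v2]; rewrite expr2 /bumpP.
by rewrite ler_pM ?mulr_ge0 ?expR_ge0// ?flat2_ge//; (try (apply/andP; split)); lra.
Qed.

(** The derivative of an even bump would vanish at 0; the unequal exponents prevent it. This value
    multiplies the jump in the edge estimate. *)
Lemma dbumpP01_0 : dbumpP 0 1 0 = expR (- 1) ^+ 2.
Proof.
rewrite /dbumpP /bumpP /flat !addr0 !subr0 ltr01 invr1 !expr1n; ring.
Qed.

End FlatExponential.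

(** * Smooth functions of the plane *)

Section PlaneSmooth.
Context {R : realType}.
Implicit Types (x : R * R) (f g : R * R -> R) (i : 'I_2).

(** Brings the one-variable chain rule and the fundamental theorem of calculus to directional
    derivatives. *)
Lemma is_derive_lineP (V : normedModType R) (f : V -> R) (x v : V) (df : R) :
  is_derive (0 : R) 1 (fun h => f (h *: v + x)) df <-> is_derive x v f df.
Proof.
have E : (fun h : R => h^-1 *: (((fun h => f (h *: v + x)) \o shift 0) (h *: 1)
     - (fun h => f (h *: v + x)) 0)) =
   (fun h => h^-1 *: ((f \o shift x) (h *: v) - f x)).
  apply/funext => h /=; rewrite scale0r add0r addr0.
  by rewrite (_ : h *: 1 = h)//; exact: mulr1.
split=> -[d1 d2]; apply: DeriveDef.
- by move: d1; rewrite /derivable E.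
- by move: d2; rewrite /derive E.
- by rewrite /derivable E.
- by rewrite /derive E.
Qed.

Definition affn c p q x : R := c + (p * x.1 + q * x.2).

Lemma is_derive_comp_affn (a : R -> R) a' c p q x (v : R * R) :
  is_derive (affn c p q x) 1 a a' ->
  is_derive x v (a \o affn c p q) ((p * v.1 + q * v.2) * a').
Proof.
move=> da; apply/is_derive_lineP.
pose l := p * v.1 + q * v.2.
have dl : is_derive (0 : R) 1 (fun h : R => l * h + affn c p q x) l.
  have := is_deriveD (is_deriveZ l (is_derive_id (0 : R) (1 : R)))
    (is_derive_cst (affn c p q x) (0 : R) (1 : R)).
  move/is_derive_ext; apply=> //; by rewrite addr0 /GRing.scale/= mulr1.
rewrite (_ : (fun h => _) = a \o (fun h : R => l * h + affn c p q x)).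
  rewrite mulrC; apply: is_derive1_comp.
  by rewrite /= mulr0 add0r.
apply/funext => h /=; congr a; rewrite /affn/= /l /GRing.scale/=; ring.
Qed.

Lemma CnS n g (dg : 'I_2 -> R * R -> R) : continuous g ->
  (forall i x, is_derive x (basis2 i) g (dg i x)) -> (forall i, Cn n (dg i)) ->
  Cn n.+1 g.
Proof.
move=> cg dgE cdg; split=> // i; split=> [x|]; first by case: (dgE i x).
rewrite (_ : 'D_(basis2 i) g = dg i)//.
by apply/funext => x; exact: derive_val.
Qed.

Lemma Cn_continuous n g : Cn n g -> continuous g.
Proof. by case: n => // n []. Qed.

Lemma Cn_is_derive n g i x : Cn n.+1 g ->
  is_derive x (basis2 i) g ('D_(basis2 i) g x).
Proof. by move=> [_ /(_ i)[/(_ x) + _]] => /derivableP. Qed.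

Lemma Cn_derive n g i : Cn n.+1 g -> Cn n ('D_(basis2 i) g).
Proof. by move=> [_ /(_ i)[]]. Qed.

Lemma Cn_pred n g : Cn n.+1 g -> Cn n g.
Proof.
elim: n g => [|n ih] g; first by move=> /Cn_continuous.
move=> cg; split; first exact: Cn_continuous cg.
move=> i; split=> [x|]; first by case: (Cn_is_derive i x cg).
by apply: ih; exact: Cn_derive cg.
Qed.

Lemma Cn_cst n (c : R) : Cn n (fun _ : R * R => c).
Proof.
elim: n c => [|n ih] c; first by move=> ?; exact: cvg_cst.
apply: (@CnS _ _ (fun _ _ => 0)) => //; by move=> ?; exact: cvg_cst.
Qed.

Lemma CnD n f g : Cn n f -> Cn n g -> Cn n (fun x => f x + g x).
Proof.
elim: n f g => [|n ih] f g cf cg.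
  by move=> x; apply: cvgD; [exact: cf|exact: cg].
apply: (@CnS _ _ (fun i x => 'D_(basis2 i) f x + 'D_(basis2 i) g x)).
- move=> x; apply: cvgD; first exact: (Cn_continuous cf).
  exact: (Cn_continuous cg).
- by move=> i x; apply: is_deriveD; apply: Cn_is_derive; eassumption.
- by move=> i; apply: ih; apply: Cn_derive.
Qed.

Lemma CnM n f g : Cn n f -> Cn n g -> Cn n (fun x => f x * g x).
Proof.
elim: n f g => [|n ih] f g cf cg.
  by move=> x; apply: cvgM; [exact: cf|exact: cg].
apply: (@CnS _ _ (fun i x => f x * 'D_(basis2 i) g x + g x * 'D_(basis2 i) f x)).
- move=> x; apply: cvgM; first exact: (Cn_continuous cf).
  exact: (Cn_continuous cg).
- by move=> i x; apply: is_deriveM; apply: Cn_is_derive; eassumption.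
- by move=> i; apply: CnD; apply: ih; (try exact: Cn_derive); exact: Cn_pred.
Qed.

Lemma continuous_affn c p q : continuous (affn c p q).
Proof.
move=> x; apply: cvgD; first exact: cvg_cst.
apply: cvgD; apply: cvgM; (try exact: cvg_cst).
  exact: cvg_fst.
exact: cvg_snd.
Qed.

(** The induction on [n] is for all [k] at once, since differentiating raises [k]. *)
Lemma Cn_flat n k c p q : Cn n (flat k \o affn c p q).
Proof.
have fc j : continuous (flat j \o affn c p q).
  move=> x; apply: continuous_comp; first exact: continuous_affn.
  apply/differentiable_continuous/derivable1_diffP.
  by case: (is_derive_flat j (affn c p q x)).
elim: n k => [|n ih] k; first exact: fc.
apply: (@CnS _ _ (fun i x => (p * (basis2 i).1 + q * (basis2 i).2) *
   (- k%:R * flat k.+1 (affn c p q x) + flat k.+2 (affn c p q x)))).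
- exact: fc.
- by move=> i x; apply: is_derive_comp_affn; exact: is_derive_flat.
- move=> i; apply: (CnM (Cn_cst _ _)); apply: CnD; last exact: ih.
  by apply: (CnM (Cn_cst _ _)); exact: ih.
Qed.

Lemma Cn_bumpP n j k c p q : Cn n (bumpP j k \o affn c p q).
Proof.
have := CnM (Cn_flat n j (1 + c) p q) (Cn_flat n k (1 - c) (- p) (- q)).
congr Cn; apply/funext => x; rewrite /bumpP /affn/=; congr (flat _ _ * flat _ _); ring.
Qed.

(* Smoothness is only recorded for the compositions with affine functions of
   the plane: these are the factors of the bubbles below. *)
Definition cutoff (a a' : R -> R) :=
  [/\ forall v : R, is_derive v 1 a (a' v), continuous a',
      forall v : R, 1 <= `|v| -> a v = 0 /\ a' v = 0,
      exists B, forall v : R, `|a v| <= B /\ `|a' v| <= B &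
      forall n c p q, Cn n (a \o affn c p q)].

Lemma cutoffD a a' b b' : cutoff a a' -> cutoff b b' ->
  cutoff (fun v => a v + b v) (fun v => a' v + b' v).
Proof.
move=> [da ca sa [Ba ha] na] [db cb sb [Bb hb] nb]; split.
- move=> v; have := is_deriveD (da v) (db v).
  by move/is_derive_ext; apply.
- by move=> v; apply: cvgD; [exact: ca|exact: cb].
- by move=> v v1; have [-> ->] := sa v v1; have [-> ->] := sb v v1; rewrite addr0.
- exists (Ba + Bb) => v; have [a1 a2] := ha v; have [b1 b2] := hb v.
  by split; (apply: le_trans (ler_normD _ _) _); exact: lerD.
- by move=> n c p q; exact: CnD (na n c p q) (nb n c p q).
Qed.

Lemma cutoffZ r a a' : cutoff a a' -> cutoff (fun v => r * a v) (fun v => r * a' v).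
Proof.
move=> [da ca sa [Ba ha] na]; split.
- move=> v; have := is_deriveZ r (da v).
  by move/is_derive_ext; apply.
- by move=> v; apply: cvgM; [exact: cvg_cst|exact: ca].
- by move=> v v1; have [-> ->] := sa v v1; rewrite mulr0.
- exists (`|r| * Ba) => v; have [a1 a2] := ha v.
  by rewrite !normrM; split; exact: ler_wpM2l.
- by move=> n c p q; exact: CnM (Cn_cst n r) (na n c p q).
Qed.

Lemma cutoff_bumpP j k : cutoff (bumpP j k) (dbumpP j k).
Proof.
have cP j' k' : continuous (bumpP j' k' : R -> R).
  move=> v; apply/differentiable_continuous/derivable1_diffP.
  by case: (is_derive_bumpP j' k' v).
split.
- exact: is_derive_bumpP.
- move=> v; apply: cvgB; last exact: cP.
  apply: cvgD; last by apply: cvgM; [exact: cvg_cst|exact: cP].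
  apply: cvgD; last exact: cP.
  by apply: cvgM; [exact: cvg_cst|exact: cP].
- by move=> v v1; rewrite /dbumpP !bumpP_out// !mulr0 !addr0 subr0.
- have [B0 h0] := @bumpP_bounded R j k.
  have [B1 h1] := @bumpP_bounded R j.+1 k.
  have [B2 h2] := @bumpP_bounded R j.+2 k.
  have [B3 h3] := @bumpP_bounded R j k.+1.
  have [B4 h4] := @bumpP_bounded R j k.+2.
  exists (B0 + (j%:R * B1 + B2 + k%:R * B3 + B4)) => v.
  have p0 : 0 <= B0 by apply: le_trans (h0 0).
  have p1 : 0 <= B1 by apply: le_trans (h1 0).
  have p2 : 0 <= B2 by apply: le_trans (h2 0).
  have p3 : 0 <= B3 by apply: le_trans (h3 0).
  have p4 : 0 <= B4 by apply: le_trans (h4 0).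
  split; first by rewrite (le_trans (h0 v))// lerDl !addr_ge0// mulr_ge0.
  rewrite -[leLHS]add0r lerD//; rewrite /dbumpP.
  apply: le_trans (ler_normD _ _) _; rewrite normrN lerD//.
  apply: le_trans (ler_normD _ _) _; rewrite lerD//; last first.
    by rewrite normrM normr_nat ler_wpM2l.
  apply: le_trans (ler_normD _ _) _; rewrite lerD//.
  by rewrite normrM normrN normr_nat ler_wpM2l.
- by move=> n c p q; exact: Cn_bumpP.
Qed.

End PlaneSmooth.

(** * Integrals on the line and in the plane *)

Section LineIntegrals.
Context {R : realType}.
Notation mu := (@lebesgue_measure R).
Implicit Types (F f : R -> R) (a b c N : R).

Lemma int_derive_itv F f a b : a < b ->
  (forall x : R, is_derive x 1 F (f x)) -> continuous f ->
  (\int[mu]_(x in `[a, b]) (f x)%:E = (F b - F a)%R%:E)%E.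
Proof.
move=> ab dF cf; rewrite EFinB; apply: continuous_FTC2 => //.
- exact: continuous_subspaceT.
- have cF : continuous F.
    move=> x; apply/differentiable_continuous/derivable1_diffP.
    by case: (dF x).
  split; first by move=> x _; case: (dF x).
    exact: cvg_at_right_filter (cF a).
  exact: cvg_at_left_filter (cF b).
- by move=> x _; rewrite derive1E; case: (dF x).
Qed.

(** The half line appears as a boolean factor: the integral stays on the whole line, so Fubini
    applies to half planes cut by an oblique line. *)
Lemma int_derive_half F f a c : a < c ->
  (forall x : R, is_derive x 1 F (f x)) -> continuous f ->
  (forall x, x <= a -> F x = 0 /\ f x = 0) ->
  (\int[mu]_x (f x * ((x : R) < c)%R%:R)%R%:E = (F c)%:E)%E.
Proof.
move=> ac dF cf sf; have [Fa fa] := sf a (lexx _).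
transitivity (\int[mu]_(x in `[a, c[) (f x)%:E)%E.
  rewrite [RHS]integral_mkcond; apply: eq_integral => x _.
  rewrite patchE; case: ifPn.
    by rewrite inE/= in_itv/= => /andP[_ ->]; rewrite mulr1.
  move=> /negP; rewrite inE/= in_itv/= => /negP; rewrite negb_and -ltNge.
  move=> /orP[/ltW/sf[_ ->]|/negbTE ->]; first by rewrite mul0r.
  by rewrite mulr0.
rewrite integral_itv_bndo_bndc//; last first.
  by apply/measurable_EFinP/measurable_funTS; exact: continuous_measurable_fun.
by rewrite (int_derive_itv ac dF cf) Fa subr0.
Qed.

Lemma int_derive0 F f a b : a < b ->
  (forall x : R, is_derive x 1 F (f x)) -> continuous f ->
  (forall x, x <= a -> F x = 0 /\ f x = 0) ->
  (forall x, b <= x -> F x = 0 /\ f x = 0) ->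
  (\int[mu]_x (f x)%:E = 0)%E.
Proof.
move=> ab dF cf sa sb; have [Fb fb] := sb b (lexx _).
have <- : (F b)%:E = 0%E by rewrite Fb.
rewrite -(int_derive_half ab dF cf sa).
apply: eq_integral => x _.
by case: ltP => [_|/sb[_ ->]]; rewrite ?mulr1 ?mul0r.
Qed.

End LineIntegrals.

Section PlaneIntegrals.
Context {R : realType}.
Notation mu := (@lebesgue_measure R).
Notation P := (measurableTypeR R * measurableTypeR R)%type.
Implicit Types (x : R * R) (g : R * R -> R) (i : 'I_2).

(** Measurability is that of the product, so an open set is rebuilt as the union of the countably
    many rational boxes that it contains. *)
Lemma open_measurable_plane (U : set (R * R)) : open U -> measurable (U : set P).
Proof.
move=> oU.
pose box (q : rat * rat * rat) : set P :=
  `]ratr q.1.1 - ratr q.2, ratr q.1.1 + ratr q.2[%classic `*`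
  `]ratr q.1.2 - ratr q.2, ratr q.1.2 + ratr q.2[%classic.
rewrite (_ : U = \bigcup_(q in [set: rat * rat * rat])
    [set x | box q x /\ box q `<=` U]).
  apply: countable_bigcupT_measurable; first exact: countableP.
  move=> q; have [qU|nqU] := pselect (box q `<=` U).
    rewrite (_ : [set x | _] = box q).
      by apply: measurableX; exact: measurable_itv.
    by apply/seteqP; split=> [x []|x].
  by rewrite (_ : [set x | _] = set0)// -subset0 => x [].
apply/seteqP; split=> [x Ux|x [q _ [qx qU]]]; last exact: qU.
have /nbhs_ballP[e /= e0 eU] : nbhs x U by exact: open_nbhs_nbhs.
(* The center of the box is within [r] of [x], so its points are within [2 r < e] of [x]; the lower
   bound keeps [r] positive. *)
have e42 : e / 4 < e / 2 by lra.
have [r] := rat_in_itvoo e42.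
rewrite in_itv/= => /andP[r1 r2].
have rat_near (t : R) : exists q : rat, t - ratr r < ratr q < t + ratr r.
  have [|q] := @rat_in_itvoo R (t - ratr r) (t + ratr r); first lra.
  by rewrite in_itv/=; exists q.
have [a /andP[a1 a2]] := rat_near x.1.
have [b /andP[b1 b2]] := rat_near x.2.
exists (a, b, r) => //; split.
  by split; rewrite /= in_itv/=; apply/andP; split; lra.
move=> y [] /=; rewrite !in_itv/= => /andP[y1 y2] /andP[y3 y4].
apply: eU; split; rewrite /ball/= ltr_norml; apply/andP; split; lra.
Qed.

Lemma continuous_measurable_plane g : continuous g ->
  measurable_fun setT (g : P -> R).
Proof.
move=> cg; apply: (measurability _ (RGenOpens.measurableE R)) => //.
move=> _ [_ [a [b ->] <-]]; rewrite setTI; apply: open_measurable_plane.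
apply: open_comp => //; exact: interval_open.
Qed.

(** With the first argument in coordinate [i], Fubini in either order is one statement. *)
Definition pt i (s t : R) : R * R := if i == 0 then (s, t) else (t, s).

Definition cbox (N : R) : set P := `[- N, N]%classic `*` `[- N, N]%classic.

Lemma measurable_cbox N : measurable (cbox N).
Proof. by apply: measurableX; exact: measurable_itv. Qed.

Lemma leb2_itvX (a b c d : R) : a <= b -> c <= d ->
  leb2 R (`[a, b]%classic `*` `[c, d]%classic) = ((b - a) * (d - c))%:E.
Proof.
move=> ab cd.
rewrite [LHS](product_measure1E mu mu (measurable_itv `[a, b]) (measurable_itv `[c, d])).
have E (u v : R) : u <= v -> mu `[u, v]%classic = (v - u)%:E.
  rewrite lebesgue_measure_itv /= lte_fin.
  by case: ltgtP => // -> _; rewrite subrr.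
by rewrite EFinM; congr (_ * _)%E; exact: E.
Qed.

Lemma leb2_cbox_fin N : (leb2 R (cbox N) < +oo)%E.
Proof.
have [N0|N0] := leP 0 N; first by rewrite leb2_itvX ?ltry//; lra.
rewrite (_ : cbox N = set0) ?measure0// -subset0 => x [].
by rewrite /= in_itv/= => /andP[a b]; lra.
Qed.

Lemma bounded_integrable (S : set P) (B : R) (g : P -> R) :
  measurable S -> (leb2 R S < +oo)%E -> measurable_fun setT g ->
  (forall x, `|g x| <= B) -> (forall x, ~ S x -> g x = 0) ->
  (leb2 R).-integrable setT (EFin \o g).
Proof.
move=> mS fS mg gB g0.
rewrite (_ : EFin \o g = (EFin \o g) \_ S); last first.
  apply/funext => x; rewrite patchE; case: ifPn => // /negP.
  by rewrite inE => nSx; rewrite /= g0.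
rewrite -(integrable_mkcond _ mS).
apply: measurable_bounded_integrable => //; first exact: measurable_funTS.
by exists B; split; [exact: num_real|move=> r Br x _; apply: le_trans (gB x) (ltW Br)].
Qed.

Lemma int_plane i (g I : _ -> R) :
  (leb2 R).-integrable setT (EFin \o g) ->
  (forall y : R, \int[mu]_x (g (pt i x y))%:E = (I y)%:E)%E ->
  (\int[leb2 R]_x (g x)%:E = \int[mu]_y (I y)%:E)%E.
Proof.
move=> ig gI; rewrite /leb2; have [i0|i1] := eqVneq i 0.
  rewrite -(integral21_prod_meas1 ig); apply: eq_integral => y _.
  by rewrite -gI /pt i0 eqxx.
rewrite -(integral12_prod_meas1 ig); apply: eq_integral => y _.
by rewrite -gI /pt (negbTE i1).
Qed.

End PlaneIntegrals.

(** * Test functions and integration by parts *)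

Section TestFunctions.
Context {R : realType}.
Notation mu := (@lebesgue_measure R).
Notation P := (measurableTypeR R * measurableTypeR R)%type.
Implicit Types (x : R * R) (g dg f : R * R -> R) (i : 'I_2).

Lemma compact_cbox N : compact (cbox N : set (R * R)).
Proof. by apply: compact_setX; exact: segment_compact. Qed.

Lemma continuous_cbox_bounded g N : continuous g ->
  (forall x, ~ (cbox N : set (R * R)) x -> g x = 0) ->
  exists2 B, 0 <= B & forall x, `|g x| <= B.
Proof.
move=> cg g0.
have : bounded_set (g @` (cbox N : set (R * R))).
  apply: compact_bounded; apply: continuous_compact; last exact: compact_cbox.
  exact: continuous_subspaceT.
move=> [M [_ HM]]; exists (`|M| + 1) => [|x]; first by rewrite addr_ge0.
have [xN|/g0 ->] := pselect ((cbox N : set (R * R)) x); last first.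
  by rewrite normr0 addr_ge0.
by apply: (HM (`|M| + 1)); [rewrite (le_lt_trans (ler_norm M))// ltrDl|exists x].
Qed.

Lemma continuous_cbox_integrable g N : continuous g ->
  (forall x, ~ (cbox N : set (R * R)) x -> g x = 0) ->
  (leb2 R).-integrable setT (EFin \o (g : P -> R)).
Proof.
move=> cg g0; have [B _ gB] := continuous_cbox_bounded cg g0.
apply: (@bounded_integrable _ (cbox N) B) => //.
- exact: measurable_cbox.
- exact: leb2_cbox_fin.
- exact: continuous_measurable_plane.
Qed.

Lemma continuous_pt i y : continuous (fun s : R => pt i s y).
Proof.
move=> s; rewrite /pt; case: (i == 0).
  exact: (@cvg_pair _ _ _ (nbhs s) (nbhs s) (nbhs y) _ _ _ id (cst y) cvg_id (cvg_cst y)).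
exact: (@cvg_pair _ _ _ (nbhs s) (nbhs y) (nbhs s) _ _ _ (cst y) id (cvg_cst y) cvg_id).
Qed.

Lemma is_derive_pt g i (s y df : R) : is_derive (pt i s y) (basis2 i) g df ->
  is_derive s 1 (fun s : R => g (pt i s y)) df.
Proof.
move=> /is_derive_lineP dg; apply/is_derive_lineP.
refine (is_derive_ext dg _ _) => // h; congr g.
have hE : h *: 1 = h :> R by exact: mulr1.
rewrite /pt /basis2 hE; case: eqVneq => _ /=; rewrite [LHS]surjective_pairing;
  by congr pair; rewrite /= ?hE ?scaler0 ?add0r.
Qed.

Lemma cbox_pt_out i (s y N : R) : N < `|s| -> ~ (cbox N : set (R * R)) (pt i s y).
Proof.
move=> sN; rewrite /pt; case: ifP => _ [] /=; rewrite !in_itv/= -!ler_norml.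
  by rewrite leNgt sN.
by move=> _; rewrite leNgt sN.
Qed.

Lemma int_pderive0 g dg i N : continuous g -> continuous dg ->
  (forall x, is_derive x (basis2 i) g (dg x)) ->
  (forall x, ~ (cbox N : set (R * R)) x -> g x = 0 /\ dg x = 0) ->
  \int[leb2 R]_x dg x = 0.
Proof.
move=> cg cdg dgE g0; rewrite /Rintegral (@int_plane _ i _ (fun=> 0)).
- by rewrite integral0.
- by apply: (@continuous_cbox_integrable _ N) => // x /g0[].
(* The box is closed and the functions are only known to vanish off it, so the cut is made strictly
   beyond [N]. *)
move=> y; pose M := `|N| + 1.
have NM : N < M by rewrite (le_lt_trans (ler_norm N))// ltrDl.
have M0 : 0 < M by rewrite ltr_wpDl.
apply: (@int_derive0 _ (fun s => g (pt i s y)) _ (- M) M).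
- lra.
- by move=> s; apply: is_derive_pt.
- move=> s; apply: continuous_comp; [exact: continuous_pt|exact: cdg].
- move=> s sM; apply/g0/cbox_pt_out/(lt_le_trans NM).
  by rewrite ler0_norm; lra.
- move=> s sM; apply/g0/cbox_pt_out/(lt_le_trans NM).
  by rewrite ger0_norm; lra.
Qed.

Lemma test_fun_cbox Omega g : test_fun Omega g ->
  exists N, forall x, closure [set x | g x != 0] x -> (cbox N : set (R * R)) x.
Proof.
move=> [_ /compact_bounded[M [_ HM]] _]; exists (`|M| + 1) => x xg.
have : `|x| <= `|M| + 1 by apply: HM => //; rewrite (le_lt_trans (ler_norm M))// ltrDl.
rewrite prod_normE/= num_ge_max => /andP[x1 x2].
by split; rewrite /= in_itv/= -ler_norml.
Qed.

Lemma notin_closure_derive g x (v : R * R) : ~ closure [set x | g x != 0] x ->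
  'D_v g x = 0.
Proof.
move=> xg; have [U] : exists2 U, nbhs x U & ~ ([set x | g x != 0] `&` U !=set0).
  apply: contrapT => h; apply: xg => U xU; apply: contrapT => UU; apply: h.
  by exists U.
move=> xU gU; have gx : \forall y \near x, cst 0 y = g y.
  near=> y; apply/eqP; rewrite eq_sym; apply: contrapT => /negP gy; apply: gU; exists y.
  by split => //; near: y.
have := near_eq_is_derive gx (is_derive_cst (0 : R) x v).
by move=> [].
Unshelve. all: by end_near. Qed.

Lemma test_fun_continuous Omega g : test_fun Omega g -> continuous g.
Proof. by move=> [/(_ 0%N)]. Qed.

Lemma test_fun_derive_continuous Omega g i : test_fun Omega g ->
  continuous ('D_(basis2 i) g).
Proof. by move=> [/(_ 1%N) h _ _]; exact: (Cn_derive i h). Qed.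

Lemma test_fun_is_derive Omega g i x : test_fun Omega g ->
  is_derive x (basis2 i) g ('D_(basis2 i) g x).
Proof. by move=> [/(_ 1%N) h _ _]; exact: (Cn_is_derive i x h). Qed.

Lemma test_fun_out Omega g x : test_fun Omega g -> ~ Omega x ->
  g x = 0 /\ forall v, 'D_v g x = 0.
Proof.
move=> [_ _ gO] nO; split; last by move=> v; apply: notin_closure_derive => /gO.
apply/eqP; apply: contrapT => /negP gx; apply/nO/gO; exact: subset_closure.
Qed.

Lemma test_fun_cbox_out Omega g : test_fun Omega g -> exists N, forall x,
  ~ (cbox N : set (R * R)) x -> g x = 0 /\ forall v, 'D_v g x = 0.
Proof.
move=> tg; have [N hN] := test_fun_cbox tg; exists N => x nx; split.
  apply/eqP; apply: contrapT => /negP gx; apply/nx/hN; exact: subset_closure.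
by move=> v; apply: notin_closure_derive => /hN.
Qed.

Lemma Rintegral_supp (D : set P) (g : P -> R) : (forall x, ~ D x -> g x = 0) ->
  \int[leb2 R]_(x in D) g x = \int[leb2 R]_x g x.
Proof.
move=> g0; rewrite Rintegral_mkcond; congr (Rintegral _ _ _).
apply/funext => x; rewrite patchE; case: ifPn => // /negP.
by rewrite inE => /g0 ->.
Qed.

(** The product of two test functions has compact support, so its partial derivatives integrate to
    zero. This is what [H10] asks of a bubble. *)
Lemma test_fun_weak_partial Omega g i : test_fun Omega g ->
  weak_partial Omega i g ('D_(basis2 i) g).
Proof.
move=> tg psi tpsi.
have [N gN] := test_fun_cbox_out tg.
have cg := test_fun_continuous tg; have cp := test_fun_continuous tpsi.
have cdg := test_fun_derive_continuous (i:=i) tg.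
have cdp := test_fun_derive_continuous (i:=i) tpsi.
rewrite !(@Rintegral_supp Omega); last 2 first.
- by move=> x /(test_fun_out tg)[_ ->]; rewrite mul0r.
- by move=> x /(test_fun_out tg)[-> _]; rewrite mul0r.
have := @int_pderive0 (fun x => g x * psi x)
  (fun x => g x * 'D_(basis2 i) psi x + 'D_(basis2 i) g x * psi x) i N.
rewrite RintegralD//=; last 2 first.
- apply: (@continuous_cbox_integrable (fun x => g x * 'D_(basis2 i) psi x) N).
    by move=> x; apply: cvgM; [exact: cg|exact: cdp].
  by move=> x /gN[-> _]; rewrite mul0r.
- apply: (@continuous_cbox_integrable (fun x => 'D_(basis2 i) g x * psi x) N).
    by move=> x; apply: cvgM; [exact: cdg|exact: cp].
  by move=> x /gN[_ ->]; rewrite mul0r.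
move=> h; apply/eqP; rewrite -addr_eq0; apply/eqP/h.
- by move=> x; apply: cvgM; [exact: cg|exact: cp].
- move=> x; apply: cvgD; apply: cvgM; [exact: cg|exact: cdp|exact: cdg|exact: cp].
- move=> x; have := is_deriveM (test_fun_is_derive i x tg) (test_fun_is_derive i x tpsi).
  move/is_derive_ext; apply=> //; by rewrite [_ *: _ in X in _ + X]mulrC.
- by move=> x /gN[-> ->]; rewrite !mul0r addr0.
Qed.

End TestFunctions.

(** * Square integrable functions *)

Section LebesgueNorms.
Context {R : realType}.
Notation P := (measurableTypeR R * measurableTypeR R)%type.
Notation "'N2' f" := ('N[leb2 R]_2%:E[EFin \o f])%E (at level 10).
Implicit Types (D S : set P) (f g h : P -> R) (B m : R).

Lemma Lnorm2E f : N2 f = ((\int[leb2 R]_x (f x ^+ 2)%:E) `^ 2^-1)%E.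
Proof.
rewrite unlock; congr (_ `^ _)%E; apply: eq_integral => x _ /=.
by rewrite powR_mulrn// real_normK ?num_real.
Qed.

Lemma Lnorm2_le f g : measurable_fun setT f -> measurable_fun setT g ->
  (forall x, `|f x| <= `|g x|) -> (N2 f <= N2 g)%E.
Proof.
move=> mf mg fg; rewrite !Lnorm2E gt0_ler_poweR//.
- by rewrite in_itv/= leey integral_ge0// => x _; rewrite lee_fin sqr_ge0.
- by rewrite in_itv/= leey integral_ge0// => x _; rewrite lee_fin sqr_ge0.
- apply: ge0_le_integral => //.
  + by move=> x _; rewrite lee_fin sqr_ge0.
  + by apply/measurable_EFinP; exact: measurable_funX.
  + by apply/measurable_EFinP; exact: measurable_funX.
  + by move=> x _; rewrite lee_fin -[leLHS]real_normK ?num_real//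
      -[leRHS]real_normK ?num_real// lerXn2r ?nnegrE.
Qed.

Lemma Lnorm2_indic S B m : measurable S -> 0 <= B -> 0 <= m ->
  (leb2 R S <= (m ^+ 2)%:E)%E ->
  (N2 (fun x => (B * \1_S x)%R) <= (B * m)%:E)%E.
Proof.
move=> mS B0 m0 Sm; rewrite Lnorm2E.
rewrite -[leRHS](_ : ((B ^+ 2 * m ^+ 2)%:E `^ 2^-1)%E = _); last first.
  rewrite poweR_EFin -exprMn -powR_mulrn ?mulr_ge0// -powRrM mulfV//.
  by rewrite powRr1 ?mulr_ge0.
rewrite gt0_ler_poweR//.
- by rewrite in_itv/= leey integral_ge0// => x _; rewrite lee_fin sqr_ge0.
- by rewrite in_itv/= leey lee_fin mulr_ge0// sqr_ge0.
rewrite [leLHS](_ : _ = (\int[leb2 R]_x ((B ^+ 2)%:E * (\1_S x)%:E))%E); last first.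
  apply: eq_integral => x _ /=; rewrite -EFinM indicE.
  by case: (_ \in _); rewrite ?mulr1 ?mulr0 ?expr0n.
rewrite ge0_integralZl// ?lee_fin ?sqr_ge0//.
  rewrite integral_indic// setIT [leRHS]EFinM.
  by apply: lee_wpmul2l; rewrite ?lee_fin ?sqr_ge0.
by apply/measurable_EFinP; exact: measurable_indic.
Qed.

Lemma Lfun2_le f g : measurable_fun setT f -> g \in Lfun (leb2 R) 2%:E ->
  (forall x, `|f x| <= `|g x|) -> f \in Lfun (leb2 R) 2%:E.
Proof.
move=> mf /andP[]; rewrite !inE/= => mg lg fg.
apply/andP; split; rewrite !inE//=.
exact: le_lt_trans (Lnorm2_le mf mg fg) lg.
Qed.

Lemma Lfun2_bounded S B m h : measurable S -> 0 <= m ->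
  (leb2 R S <= (m ^+ 2)%:E)%E -> measurable_fun setT h ->
  (forall x, `|h x| <= B) -> (forall x, ~ S x -> h x = 0) ->
  h \in Lfun (leb2 R) 2%:E /\ (N2 h <= (B * m)%:E)%E.
Proof.
move=> mS m0 Sm mh hB h0.
have B0 : 0 <= B by apply: le_trans (hB (0, 0)).
have hi x : `|h x| <= `|B * \1_S x|.
  rewrite indicE; case: (boolP (x \in S)) => [_|/negP].
    by rewrite mulr1 (ger0_norm B0).
  by rewrite inE => /h0 ->; rewrite normr0.
have mi : measurable_fun setT (fun x : P => B * \1_S x).
  by apply: measurable_funM => //; exact: measurable_indic.
have hl := le_trans (Lnorm2_le mh mi hi) (Lnorm2_indic mS B0 m0 Sm).
split=> //; apply/andP; split; rewrite !inE//=.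
by rewrite /finite_norm/= (le_lt_trans hl)// ltry.
Qed.

Lemma fin_Lnorm2 f : f \in Lfun (leb2 R) 2%:E -> N2 f \is a fin_num.
Proof.
move=> /andP[_]; rewrite inE/= => lf.
by rewrite ge0_fin_numE ?Lnorm_ge0.
Qed.

Lemma norm0_ge0 D g : 0 <= norm0 D g.
Proof. by rewrite fine_ge0// Lnorm_ge0. Qed.

Lemma L2_measurable D g : L2 D g -> measurable_fun setT (g \_ D).
Proof. by move=> /andP[]; rewrite inE. Qed.

Lemma eq_norm0 D f g : (forall x, D x -> f x = g x) -> norm0 D f = norm0 D g.
Proof.
move=> fg; rewrite /norm0; congr (fine ('N[_]__[EFin \o _])%E).
by apply/funext => x; rewrite !patchE; case: ifPn => // /set_mem /fg.
Qed.

Lemma eq_L2 D f g : (forall x, D x -> f x = g x) -> L2 D f -> L2 D g.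
Proof.
move=> fg; rewrite /L2 (_ : f \_ D = g \_ D)//.
by apply/funext => x; rewrite !patchE; case: ifPn => // /set_mem /fg.
Qed.

Lemma L2D D f g : L2 D f -> L2 D g -> L2 D (fun x => f x + g x).
Proof.
rewrite /L2 => lf lg.
rewrite (_ : _ \_ _ = (f \_ D : P -> R) + (g \_ D : P -> R)).
  have [_ h] := Lfun_addr_closed (leb2 R) (lee1n 2 : (1 <= 2%:E)%E).
  exact: h _ _ lf lg.
by apply/funext => x; rewrite [in RHS]/GRing.add/= !patchE; case: ifP; rewrite ?addr0.
Qed.

Lemma L2Z D r g : L2 D g -> L2 D (fun x => r * g x).
Proof.
rewrite /L2 => lg; rewrite (_ : _ \_ _ = r \o* (g \_ D : P -> R)).
  by apply: Lfun_scale => //; rewrite ler1n.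
by apply/funext => x /=; rewrite !patchE; case: ifP; rewrite ?mul0r// mulrC.
Qed.

Lemma L2N D g : L2 D g -> L2 D (fun x => - g x).
Proof. by move=> /(L2Z (- 1)); apply: eq_L2 => x _; rewrite mulN1r. Qed.

Lemma L2B D f g : L2 D f -> L2 D g -> L2 D (fun x => f x - g x).
Proof. by move=> lf /L2N; exact: L2D. Qed.

Lemma measurable_restrict_sub D D' g : measurable D -> D `<=` D' ->
  measurable_fun setT (g \_ D') -> measurable_fun setT (g \_ D).
Proof.
move=> mD DD' mg; rewrite (_ : g \_ D = (g \_ D') \_ D).
  by apply/(measurable_restrictT _ mD); apply: measurable_funTS.
apply/funext => x; rewrite !patchE; case: ifPn => // /set_mem /DD' D'x.
by rewrite mem_set.
Qed.

Lemma L2S D D' g : measurable D -> D `<=` D' -> L2 D' g -> L2 D g.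
Proof.
move=> mD DD' lg; apply: (Lfun2_le _ lg) => [|x].
  exact: (measurable_restrict_sub mD DD' (L2_measurable lg)).
rewrite !patchE; case: ifPn => [/set_mem/DD' D'x|_].
  by rewrite mem_set.
by rewrite normr0.
Qed.

Lemma L2_le D f g : measurable_fun setT (f \_ D) -> L2 D g ->
  (forall x, D x -> `|f x| <= `|g x|) -> L2 D f.
Proof.
move=> mf lg fg; apply: (Lfun2_le mf lg) => x.
by rewrite !patchE; case: ifPn => // /set_mem; exact: fg.
Qed.

Lemma norm0_le D f g : measurable_fun setT (f \_ D) -> L2 D g ->
  (forall x, D x -> `|f x| <= `|g x|) -> norm0 D f <= norm0 D g.
Proof.
move=> mf lg fg; rewrite /norm0 fine_le ?fin_Lnorm2//.
  exact: L2_le lg fg.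
apply: Lnorm2_le => // [|x]; first exact: L2_measurable.
by rewrite !patchE; case: ifPn => // /set_mem; exact: fg.
Qed.

Lemma norm0D D f g : L2 D f -> L2 D g ->
  norm0 D (fun x => f x + g x) <= norm0 D f + norm0 D g.
Proof.
move=> lf lg; rewrite /norm0 -fineD ?fin_Lnorm2// fine_le ?fin_numD ?fin_Lnorm2//.
  exact: L2D.
have := minkowski_EFin (leb2 R) (L2_measurable lf) (L2_measurable lg) (ler1n _ 2 : 1 <= 2).
apply: le_trans; rewrite le_eqVlt; apply/orP; left; apply/eqP.
congr ('N[_]__[EFin \o _])%E.
by apply/funext => x /=; rewrite !patchE; case: ifP; rewrite ?addr0.
Qed.

Lemma norm0_bounded D B m g : measurable D -> 0 <= B -> 0 <= m ->
  (leb2 R D <= (m ^+ 2)%:E)%E -> measurable_fun setT (g \_ D) ->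
  (forall x, D x -> `|g x| <= B) -> L2 D g /\ norm0 D g <= B * m.
Proof.
move=> mD B0 m0 Dm mg gB.
have [] := @Lfun2_bounded D B m (g \_ D) mD m0 Dm mg.
- by move=> x; rewrite patchE; case: ifPn => [/set_mem/gB//|_]; rewrite normr0.
- by move=> x nDx; rewrite patchE; case: ifPn => // /set_mem.
move=> lg hl; split=> //.
by rewrite -lee_fin /norm0 fineK// fin_Lnorm2.
Qed.

Lemma L2_mul_integrable D g h : L2 D g -> h \in Lfun (leb2 R) 2%:E ->
  (leb2 R).-integrable setT (EFin \o (fun x => (g \_ D) x * h x)).
Proof.
by move=> lg lh; have := Lfun2_mul_Lfun1 lg lh; move/Lfun1_integrable.
Qed.

(** Hölder's inequality with exponents 2: [m] stands for the square root of a bound on the measure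
    of the support, so that [B * m] bounds the L2 norm of [h]. *)
Lemma norm0_int_le D S B m g h : measurable S -> 0 <= m ->
  (leb2 R S <= (m ^+ 2)%:E)%E -> measurable_fun setT h ->
  (forall x, `|h x| <= B) -> (forall x, ~ S x -> h x = 0) -> L2 D g ->
  `|\int[leb2 R]_x ((g \_ D) x * h x)| <= norm0 D g * (B * m).
Proof.
move=> mS m0 Sm mh hB h0 lg.
have [lh hl] := Lfun2_bounded mS m0 Sm mh hB h0.
have ig := L2_mul_integrable lg lh.
apply: le_trans (le_normr_Rintegral measurableT ig) _.
rewrite -lee_fin [leRHS]EFinM /norm0 /Rintegral !fineK ?fin_Lnorm2//; last first.
  have /integrableP[mi ifin] := ig.
  by rewrite ge0_fin_numE// integral_ge0.
have -> : (\int[leb2 R]_x (`|(g \_ D) x * h x|%R)%:E)%E =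
    'N[leb2 R]_1[EFin \o ((g \_ D) \* h)%R]%E by rewrite Lnorm1.
apply: le_trans.
  apply: (@hoelder _ _ _ (leb2 R) _ _ 2 2) => //.
  - exact: L2_measurable.
  - by rewrite [RHS]splitr !div1r.
by apply: lee_wpmul2l; rewrite ?Lnorm_ge0.
Qed.

End LebesgueNorms.

(** * Bubble functions *)

Section Bubbles.
Context {R : realType}.
Notation mu := (@lebesgue_measure R).
Notation P := (measurableTypeR R * measurableTypeR R)%type.
Implicit Types (x M : R * R) (i j : 'I_2) (k s : R).

Definition co i x : R := if i == 0 then x.1 else x.2.
Definition co' i x : R := if i == 0 then x.2 else x.1.

Lemma co_pt i (t y : R) : co i (pt i t y) = t.
Proof. by rewrite /co /pt; case: (i == 0). Qed.

Lemma co'_pt i (t y : R) : co' i (pt i t y) = y.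
Proof. by rewrite /co' /pt; case: (i == 0). Qed.

Definition square M (r : R) : set P :=
  `[M.1 - r, M.1 + r]%classic `*` `[M.2 - r, M.2 + r]%classic.

Lemma measurable_square M r : measurable (square M r).
Proof. by apply: measurableX; exact: measurable_itv. Qed.

Lemma leb2_square M r : 0 <= r -> leb2 R (square M r) = ((2 * r) ^+ 2)%:E.
Proof.
by move=> r0; rewrite leb2_itvX; [congr (_%:E); ring|lra|lra].
Qed.

Lemma squareP M r x : square M r x <-> (`|x.1 - M.1| <= r /\ `|x.2 - M.2| <= r).
Proof.
rewrite /square/= !in_itv/= !ler_norml.
by split=> -[/andP[? ?] /andP[? ?]]; split; apply/andP; split; lra.
Qed.

(* Coordinates adapted to the line [co i x - co i M = k * (co' i x - co' i M)]:
   the bubbles are products in these sheared coordinates, so that their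
   integrals over half planes are computed by Fubini and the fundamental
   theorem of calculus, without any change of variables in the plane. *)
Definition shear i k M s x : R := (co i x - co i M - k * (co' i x - co' i M)) / s.
Definition across i M s x : R := (co' i x - co' i M) / s.
(** This is [s] times the gradient of [shear i k M s], hence a normal to the oblique line. *)
Definition nu i k j : R := if j == i then 1 else - k.

Lemma shearE i k M s : shear i k M s =
  affn (- (co i M - k * co' i M) / s) (if i == 0 then s^-1 else - k / s)
       (if i == 0 then - k / s else s^-1).
Proof.
apply/funext => x; rewrite /shear /affn /co /co'; case: (i == 0); ring.
Qed.

Lemma acrossE i M s : across i M s =
  affn (- co' i M / s) (if i == 0 then 0 else s^-1) (if i == 0 then s^-1 else 0).
Proof.
apply/funext => x; rewrite /across /affn /co'; case: (i == 0); ring.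
Qed.

Variables (a a' b b' : R -> R).

Definition bub i k M s x : R := a (shear i k M s x) * b (across i M s x).
Definition dbub i k M s j x : R :=
  nu i k j / s * a' (shear i k M s x) * b (across i M s x) +
  (j != i)%:R / s * a (shear i k M s x) * b' (across i M s x).

Hypotheses (ba : cutoff a a') (bb : cutoff b b').

Lemma cutoff_continuous (c c' : R -> R) : cutoff c c' -> continuous c.
Proof.
move=> [dc _ _ _ _] v; apply/differentiable_continuous/derivable1_diffP.
by case: (dc v).
Qed.

Lemma Cn_bub n i k M s : Cn n (bub i k M s).
Proof.
have [_ _ _ _ na] := ba; have [_ _ _ _ nb] := bb.
rewrite (_ : bub i k M s = fun x => (a \o shear i k M s) x * (b \o across i M s) x)//.
by rewrite shearE acrossE; exact: CnM (na n _ _ _) (nb n _ _ _).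
Qed.

Lemma ord2_neq i j : i != j -> (i == 0) = (j != 0).
Proof. by case: i j => [[|[|//]] ?] [[|[|//]] ?]. Qed.

Lemma is_derive_bub i k M s j x :
  is_derive x (basis2 j) (bub i k M s) (dbub i k M s j x).
Proof.
have [da _ _ _ _] := ba; have [db _ _ _ _] := bb.
have ji : (j == 0) = (if j == i then i == 0 else i != 0).
  by case: (eqVneq j i) => [->//|/ord2_neq].
have d1 : is_derive x (basis2 j) (a \o shear i k M s) (nu i k j / s * a' (shear i k M s x)).
  rewrite shearE; have := is_derive_comp_affn (basis2 j) (da (affn
    (- (co i M - k * co' i M) / s) (if i == 0 then s^-1 else - k / s)
       (if i == 0 then - k / s else s^-1) x)).
  move/is_derive_ext; apply=> //; congr (_ * _).
  rewrite /nu /basis2 /= ji; case: (j == i); case: (i == 0) => /=; ring.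
have d2 : is_derive x (basis2 j) (b \o across i M s) ((j != i)%:R / s * b' (across i M s x)).
  rewrite acrossE; have := is_derive_comp_affn (basis2 j) (db (affn
    (- co' i M / s) (if i == 0 then 0 else s^-1) (if i == 0 then s^-1 else 0) x)).
  move/is_derive_ext; apply=> //; congr (_ * _).
  rewrite /basis2 /= ji; case: (j == i); case: (i == 0) => /=; ring.
have := is_deriveM d1 d2; move/is_derive_ext; apply => //.
rewrite /dbub /GRing.scale/=; ring.
Qed.

(** Where neither factor vanishes, the second coordinate deviates from that of [M] by at most [s]
    and, the slope being at most one, the first by at most [2 s]. *)
Lemma bub_out i k M s x : 0 < s -> `|k| <= 1 -> ~ square M (2 * s) x ->
  bub i k M s x = 0 /\ forall j, dbub i k M s j x = 0.
Proof.
move=> s0 k1 nx; have [_ _ sa _ _] := ba; have [_ _ sb _ _] := bb.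
have [m1|m1] := leP 1 `|across i M s x|.
  have [b0 b'0] := sb _ m1.
  by split=> [|j]; rewrite /bub /dbub b0 ?b'0 !mulr0 ?addr0.
have [l1|l1] := leP 1 `|shear i k M s x|.
  have [a0 a'0] := sa _ l1.
  by split=> [|j]; rewrite /bub /dbub a0 ?a'0 ?mulr0 !mul0r ?addr0.
exfalso; apply: nx; apply/squareP.
have m2 : `|co' i x - co' i M| <= s.
  by move: m1; rewrite /across normrM normfV (gtr0_norm s0) ltr_pdivrMr// mul1r => /ltW.
have l2 : `|co i x - co i M| <= 2 * s.
  move: l1; rewrite /shear normrM normfV (gtr0_norm s0) ltr_pdivrMr// mul1r => l1.
  rewrite -[X in `|X|](subrK (k * (co' i x - co' i M))).
  apply: le_trans (ler_normD _ _) _.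
  have : `|k * (co' i x - co' i M)| <= 1 * s by rewrite normrM ler_pM.
  lra.
move: m2 l2; rewrite /co /co'; case: (i == 0) => h1 h2; split=> //; lra.
Qed.

Lemma closure_bub i k M s : 0 < s -> `|k| <= 1 ->
  closure [set x | bub i k M s x != 0] `<=` (square M (2 * s) : set (R * R)).
Proof.
move=> s0 k1; rewrite [X in _ `<=` X](_ : _ = closure (square M (2 * s))).
  apply: closureS => x /= /negP bx; apply: contrapT => nx; apply: bx.
  by have [-> _] := bub_out i s0 k1 nx.
apply/closure_id; apply: (compact_closed (@norm_hausdorff R (R * R)%type)).
by apply: compact_setX; exact: segment_compact.
Qed.

Lemma test_fun_bub Omega i k M s : 0 < s -> `|k| <= 1 ->
  square M (2 * s) `<=` Omega -> test_fun Omega (bub i k M s).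
Proof.
move=> s0 k1 sO; split.
- by move=> n; exact: Cn_bub.
- apply: subclosed_compact (closure_bub (i:=i) s0 k1); first exact: closed_closure.
  by apply: compact_setX; exact: segment_compact.
- exact: subset_trans (closure_bub (i:=i) s0 k1) sO.
Qed.

Lemma bub_bounded : exists2 B, 0 < B & forall i k M s x, 0 < s -> `|k| <= 1 ->
  `|bub i k M s x| <= B /\ forall j, `|dbub i k M s j x| <= B / s.
Proof.
have [_ _ _ [Ba hA] _] := ba; have [_ _ _ [Bb hb] _] := bb.
have Ba0 : 0 <= Ba by apply: le_trans (hA 0).1.
have Bb0 : 0 <= Bb by apply: le_trans (hb 0).1.
(* The derivative has two terms, each at most [Ba * Bb / s]; the summand 1 makes the bound
   positive. *)
exists (1 + 2 * (Ba * Bb)) => [|i k M s x s0 k1].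
  by rewrite ltr_pwDl// mulr_ge0// mulr_ge0.
have [a1 a2] := hA (shear i k M s x); have [b1 b2] := hb (across i M s x).
have p0 : 0 <= Ba * Bb by exact: mulr_ge0.
split=> [|j].
  have : `|bub i k M s x| <= Ba * Bb by rewrite normrM ler_pM.
  lra.
have nu1 : `|nu i k j| <= 1 by rewrite /nu; case: ifP; rewrite ?normr1 ?normrN.
have c1 : `|(j != i)%:R : R| <= 1 by case: (j != i); rewrite ?normr1 ?normr0.
rewrite (_ : dbub _ _ _ _ _ _ = (nu i k j * (a' (shear i k M s x) * b (across i M s x)) +
  (j != i)%:R * (a (shear i k M s x) * b' (across i M s x))) / s); last first.
  rewrite /dbub; ring.
rewrite normrM normfV (gtr0_norm s0).
apply: ler_wpM2r; first by rewrite invr_ge0 ltW.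
apply: le_trans (ler_normD _ _) _.
have h1 : `|nu i k j * (a' (shear i k M s x) * b (across i M s x))| <= 1 * (Ba * Bb).
  by rewrite normrM ler_pM// normrM ler_pM.
have h2 : `|(j != i)%:R * (a (shear i k M s x) * b' (across i M s x))| <= 1 * (Ba * Bb).
  by rewrite normrM ler_pM// normrM ler_pM.
lra.
Qed.

Lemma continuous_dbub i k M s j : continuous (dbub i k M s j).
Proof.
have := @Cn_derive _ 0 _ j (Cn_bub 1 i k M s).
rewrite (_ : 'D_(basis2 j) _ = dbub i k M s j)//.
by apply/funext => x; case: (is_derive_bub i k M s j x).
Qed.

Lemma square_cbox M r : exists N, square M r `<=` cbox N.
Proof.
exists (`|M.1| + `|M.2| + `|r|) => x /squareP[h1 h2].
have := ler_norm M.1; have := ler_norm (- M.1); have := ler_norm M.2.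
have := ler_norm (- M.2); have := ler_norm r; have := normr_ge0 M.1; have := normr_ge0 M.2.
have := normr_ge0 r; rewrite !normrN.
move: h1 h2; rewrite !ler_norml => /andP[? ?] /andP[? ?] *.
by split; rewrite /= in_itv/=; apply/andP; split; lra.
Qed.

Lemma int_dbub i k M s j : 0 < s -> `|k| <= 1 ->
  \int[leb2 R]_x dbub i k M s j x = 0.
Proof.
move=> s0 k1; have [N sN] := square_cbox M (2 * s).
apply: (@int_pderive0 _ (bub i k M s) _ j N).
- exact: (Cn_continuous (Cn_bub 0 i k M s)).
- exact: continuous_dbub.
- by move=> x; exact: is_derive_bub.
- move=> x nx; have nsx : ~ square M (2 * s) x by move=> /sN.
  by have [-> h] := bub_out i s0 k1 nsx; rewrite h.
Qed.

End Bubbles.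

(** * Integrals of bubbles over the plane and over half planes *)

Section BubbleIntegrals.
Context {R : realType}.
Notation mu := (@lebesgue_measure R).
Notation P := (measurableTypeR R * measurableTypeR R)%type.
Implicit Types (x M : R * R) (i j : 'I_2) (k s q : R).

Lemma is_derive_cutoff_scale (c c' : R -> R) s q (t : R) : cutoff c c' ->
  is_derive t 1 (fun t : R => c ((t - q) / s)) (c' ((t - q) / s) / s).
Proof.
move=> [dc _ _ _ _].
have d1 : is_derive t 1 (fun t : R => (t - q) / s) s^-1.
  have := is_deriveZ s^-1 (is_deriveD (is_derive_id t (1 : R)) (is_derive_cst (- q) t (1 : R))).
  move/is_derive_ext; apply; first by move=> u; rewrite mulrC.
  by rewrite addr0 /GRing.scale/= mulr1.
exact: is_derive1_comp (dc _) d1.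
Qed.

Lemma continuous_scale (c : R -> R) s q : continuous c ->
  continuous (fun t : R => c ((t - q) / s)).
Proof.
move=> cc t; apply: (@continuous_comp _ _ _ (fun t : R => (t - q) / s) c); last exact: cc.
by apply: cvgM; [apply: cvgB; [exact: cvg_id|exact: cvg_cst]|exact: cvg_cst].
Qed.

Lemma cutoff_scale_out (c c' : R -> R) s q t : cutoff c c' -> 0 < s ->
  s <= `|t - q| -> c ((t - q) / s) = 0 /\ c' ((t - q) / s) = 0.
Proof.
move=> [_ _ sc _ _] s0 st; apply: sc.
by rewrite normrM normfV (gtr0_norm s0) ler_pdivlMr// mul1r.
Qed.

Lemma continuous_line_integrable (f : R -> R) a b : continuous f ->
  (forall t, t <= a -> f t = 0) -> (forall t, b <= t -> f t = 0) ->
  mu.-integrable setT (EFin \o f).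
Proof.
move=> cf fa fb; rewrite (_ : EFin \o f = (EFin \o f) \_ `[a, b]); last first.
  apply/funext => t; rewrite patchE; case: ifPn => // /negP.
  rewrite inE/= in_itv/= => /negP; rewrite negb_and -!ltNge.
  by move=> /orP[/ltW/fa ->|/ltW/fb ->].
have [h _] := @integrable_mkcond _ _ R mu `[a, b]%classic (EFin \o f) (measurable_itv _).
apply: h.
apply: continuous_compact_integrable; first exact: segment_compact.
exact: continuous_subspaceT.
Qed.

Lemma cutoff_scale_integrable (c c' : R -> R) s q : cutoff c c' -> 0 < s ->
  mu.-integrable setT (EFin \o (fun t : R => c ((t - q) / s))).
Proof.
move=> bc s0; apply: (@continuous_line_integrable _ (q - s) (q + s)).
- exact/continuous_scale/cutoff_continuous/bc.
- by move=> t tq; have [] := cutoff_scale_out (q:=q) (t:=t) bc s0; rewrite // ler0_norm; lra.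
- by move=> t tq; have [] := cutoff_scale_out (q:=q) (t:=t) bc s0; rewrite // ger0_norm; lra.
Qed.

Definition mass (c : R -> R) s q : R := \int[mu]_t c ((t - q) / s).

Lemma massE (c c' : R -> R) s q : cutoff c c' -> 0 < s ->
  (\int[mu]_t (c ((t - q) / s))%:E = (mass c s q)%:E)%E.
Proof.
move=> bc s0; rewrite /mass /Rintegral fineK//.
by apply: integrable_fin_num => //; exact: cutoff_scale_integrable bc s0.
Qed.

(** Only the interval of length [s] centered at [q], where the integrand is at least [kappa], is
    kept. *)
Lemma mass_ge (c c' : R -> R) s q kappa : cutoff c c' -> 0 < s ->
  (forall v, 0 <= c v) -> 0 <= kappa -> (forall v, `|v| <= 2^-1 -> kappa <= c v) ->
  kappa * s <= mass c s q.
Proof.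
move=> bc s0 c0 kp0 ck; rewrite -lee_fin -(massE q bc s0).
have mc : measurable_fun setT (fun t : R => c ((t - q) / s)).
  apply: continuous_measurable_fun; apply: (continuous_scale (c:=c)).
  exact: cutoff_continuous bc.
apply: (@le_trans _ _ (\int[mu]_(t in `[(q - s / 2)%R, (q + s / 2)%R]) (c ((t - q) / s))%:E)%E);
    last first.
  apply: ge0_subset_integral => //; first exact/measurable_EFinP.
  by move=> t _; rewrite lee_fin.
apply: (@le_trans _ _ (\int[mu]_(t in `[(q - s / 2)%R, (q + s / 2)%R]) (cst kappa%:E t))%E).
  have E : mu `[q - s / 2, q + s / 2]%classic = s%:E.
    rewrite lebesgue_measure_itv /= lte_fin ifT; last by lra.
    by rewrite -EFinD; congr (_%:E); lra.
  rewrite integral_cst//= EFinM; apply: lee_wpmul2l; rewrite ?lee_fin//.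
  by have := lexx s%:E; rewrite -{2}E.
apply: ge0_le_integral => //.
- by apply/measurable_EFinP; exact: measurable_funTS.
- move=> t /=; rewrite in_itv/= => /andP[t1 t2]; rewrite lee_fin ck//.
  by rewrite normrM normfV (gtr0_norm s0) ler_pdivrMr// ler_norml; lra.
Qed.

Lemma int_cutoff_deriv (c c' : R -> R) s q (r : R) : cutoff c c' -> 0 < s ->
  (\int[mu]_t (r * c' ((t - q) / s))%R%:E = 0)%E.
Proof.
move=> bc s0; apply: (@int_derive0 _ (fun t => r * s * c ((t - q) / s)) _ (q - s) (q + s)).
- lra.
- move=> t; have := is_deriveZ (r * s) (is_derive_cutoff_scale s q t bc).
  move/is_derive_ext; apply => //.
  by rewrite /GRing.scale/= -mulrA [s * _]mulrC divfK// gt_eqF.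
- move=> t; apply: cvgM; first exact: cvg_cst.
  by apply: (continuous_scale (c:=c')); case: bc.
- move=> t tq; have [] := cutoff_scale_out (q:=q) (t:=t) bc s0; last by move=> -> ->; rewrite !mulr0.
  by rewrite ler0_norm; lra.
- move=> t tq; have [] := cutoff_scale_out (q:=q) (t:=t) bc s0; last by move=> -> ->; rewrite !mulr0.
  by rewrite ger0_norm; lra.
Qed.

Lemma shear_pt i k M s (t y : R) :
  shear i k M s (pt i t y) = (t - (co i M + k * (y - co' i M))) / s.
Proof. by rewrite /shear co_pt co'_pt opprD addrA. Qed.

Lemma across_pt i M s (t y : R) : across i M s (pt i t y) = (y - co' i M) / s.
Proof. by rewrite /across co'_pt. Qed.

Lemma measurable_shear i k M s : measurable_fun setT (shear i k M s : P -> R).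
Proof. by apply: continuous_measurable_plane; rewrite shearE; exact: continuous_affn. Qed.

Lemma measurable_shear_lt i k M s :
  measurable_fun setT (fun x : P => (shear i k M s x < 0)%R%:R : R).
Proof.
rewrite (_ : (fun x => _) = \1_(shear i k M s @^-1` `]-oo, 0[%classic)); last first.
  apply/funext => x; rewrite indicE; congr ((nat_of_bool _)%:R).
  by apply/idP/idP => [x0|/set_mem]; [apply/mem_set|]; rewrite /= in_itv.
apply: measurable_indic; rewrite -[X in measurable X]setTI.
exact: measurable_shear.
Qed.

Lemma measurable_shear_eq i k M s :
  measurable_fun setT (fun x : P => (shear i k M s x == 0)%R%:R : R).
Proof.
rewrite (_ : (fun x => _) = \1_(shear i k M s @^-1` [set 0])); last first.
  apply/funext => x; rewrite indicE; congr ((nat_of_bool _)%:R).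
  by apply/idP/idP => [/eqP x0|/set_mem/eqP//]; apply/mem_set.
apply: measurable_indic; rewrite -[X in measurable X]setTI.
by apply: measurable_shear => //.
Qed.

Lemma integrable_mul_bool (F : P -> R) (B : P -> bool) :
  (leb2 R).-integrable setT (EFin \o F) ->
  measurable_fun setT (fun x => (B x)%:R : R) ->
  (leb2 R).-integrable setT (EFin \o (fun x => F x * (B x)%:R)).
Proof.
move=> iF mB; have /integrableP[/measurable_EFinP mF _] := iF.
apply: le_integrable iF => //.
  by apply/measurable_EFinP; exact: measurable_funM.
move=> x _ /=; rewrite lee_fin normrM; case: (B x) => /=; rewrite ?normr1 ?normr0 ?mulr1//.
by rewrite mulr0.
Qed.

(** On each line in direction [i] the boolean factor singles out one point, so Fubini gives zero.
    The plane may thus be cut into two open half planes. *)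
Lemma int_shear0 i k M s (F : P -> R) : 0 < s ->
  (leb2 R).-integrable setT (EFin \o F) ->
  \int[leb2 R]_x (F x * (shear i k M s x == 0)%R%:R) = 0.
Proof.
move=> s0 iF; rewrite /Rintegral (@int_plane _ i _ (fun=> 0)).
- by rewrite integral0.
- exact: integrable_mul_bool iF (measurable_shear_eq i k M s).
move=> y; pose c := co i M + k * (y - co' i M).
rewrite -[RHS](integral_set1 (fun t => (F (pt i t y))%:E) c).
rewrite [RHS]integral_mkcond; apply: eq_integral => t _.
rewrite patchE shear_pt -/c mulf_eq0 invr_eq0 (gt_eqF s0) orbF subr_eq0.
case: (eqVneq t c) => [->|tc] /=; first by rewrite mem_set// mulr1.
by rewrite memNset ?mulr0//; exact/eqP.
Qed.

Lemma int_shear_split i k M s (F : P -> R) : 0 < s ->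
  (leb2 R).-integrable setT (EFin \o F) ->
  \int[leb2 R]_x (F x * (0 < shear i k M s x)%R%:R) =
  \int[leb2 R]_x F x - \int[leb2 R]_x (F x * (shear i k M s x < 0)%R%:R).
Proof.
move=> s0 iF.
rewrite -[X in X - _]subr0 -{2}(int_shear0 i k M s0 iF).
have i1 := integrable_mul_bool iF (measurable_shear_eq i k M s).
have i2 := integrable_mul_bool iF (measurable_shear_lt i k M s).
rewrite -RintegralB// -RintegralB//; last first.
  by have := integrableB measurableT iF i1.
apply: eq_Rintegral => x _; case: ltgtP => _;
  by rewrite ?mulr1 ?mulr0 ?subr0 ?subrr.
Qed.

End BubbleIntegrals.

Section BubbleMoments.
Context {R : realType}.
Notation mu := (@lebesgue_measure R).
Notation P := (measurableTypeR R * measurableTypeR R)%type.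
Implicit Types (x M : R * R) (i j : 'I_2) (k s q : R).
Variables (a a' b b' : R -> R).
Hypotheses (ba : cutoff a a') (bb : cutoff b b').
Local Notation phi := (bub a b).
Local Notation dphi := (dbub a a' b b').

Lemma bub_integrable i k M s : 0 < s -> `|k| <= 1 ->
  (leb2 R).-integrable setT (EFin \o (phi i k M s : P -> R)).
Proof.
move=> s0 k1; have [N sN] := square_cbox M (2 * s).
apply: (@continuous_cbox_integrable _ _ N).
  exact: (Cn_continuous (Cn_bub ba bb 0 i k M s)).
move=> x nx; have nsx : ~ square M (2 * s) x by move=> /sN.
by have [-> _] := bub_out ba bb i s0 k1 nsx.
Qed.

Lemma dbub_integrable i k M s j : 0 < s -> `|k| <= 1 ->
  (leb2 R).-integrable setT (EFin \o (dphi i k M s j : P -> R)).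
Proof.
move=> s0 k1; have [N sN] := square_cbox M (2 * s).
apply: (@continuous_cbox_integrable _ _ N).
  exact: continuous_dbub ba bb _ _ _ _ _.
move=> x nx; have nsx : ~ square M (2 * s) x by move=> /sN.
by have [_ h] := bub_out ba bb i s0 k1 nsx; rewrite h.
Qed.

Lemma int_bub i M s : 0 < s ->
  \int[leb2 R]_x phi i 0 M s x = mass a s (co i M) * mass b s (co' i M).
Proof.
move=> s0; have k1 : `|0 : R| <= 1 by rewrite normr0.
rewrite /Rintegral (@int_plane _ i _
  (fun y => mass a s (co i M) * b ((y - co' i M) / s))).
- under eq_integral do rewrite EFinM.
  rewrite integralZl//; last exact: cutoff_scale_integrable bb s0.
  by rewrite (massE _ bb s0) -EFinM.
- exact: bub_integrable.
move=> y; under eq_integral do rewrite /bub shear_pt across_pt mul0r addr0 mulrC EFinM.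
rewrite integralZl//; last exact: cutoff_scale_integrable ba s0.
by rewrite (massE _ ba s0) -EFinM mulrC.
Qed.

Lemma int_bub_co (c c' : R -> R) (r : R) i M s : cutoff c c' ->
  (forall v, v * a v = r * c' v) -> 0 < s ->
  \int[leb2 R]_x (phi i 0 M s x * (co i x - co i M)) = 0.
Proof.
move=> bc ac s0; have k1 : `|0 : R| <= 1 by rewrite normr0.
rewrite /Rintegral (@int_plane _ i _ (fun=> 0)).
- by rewrite integral0.
- have [N sN] := square_cbox M (2 * s).
  apply: (@continuous_cbox_integrable _ (fun x => phi i 0 M s x * (co i x - co i M)) N).
    move=> x; apply: cvgM; first exact: (Cn_continuous (Cn_bub ba bb 0 i 0 M s)).
    apply: cvgB; last exact: cvg_cst.
    by rewrite /co; case: (i == 0); [exact: cvg_fst|exact: cvg_snd].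
  move=> x nx; have nsx : ~ square M (2 * s) x by move=> /sN.
  by have [-> _] := bub_out ba bb i s0 k1 nsx; rewrite mul0r.
move=> y; rewrite -[RHS](int_cutoff_deriv (co i M) (b ((y - co' i M) / s) * s * r) bc s0).
apply: eq_integral => t _; rewrite /bub shear_pt across_pt co_pt mul0r addr0.
congr (_%:E); rewrite -[RHS]mulrA -ac.
by have sn := lt0r_neq0 s0; field.
Qed.

(* As [a] is itself the derivative of a cutoff function, the contribution of the
   tangential derivative integrates to zero; what remains is a multiple of the
   normal [nu]. *)
Lemma int_dbub_half (A : R -> R) i k M s j : cutoff A a -> 0 < s -> `|k| <= 1 ->
  \int[leb2 R]_x (dphi i k M s j x * (shear i k M s x < 0)%R%:R) =
  nu i k j * (a 0 * mass b s (co' i M)).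
Proof.
move=> bA s0 k1.
rewrite /Rintegral (@int_plane _ i _ (fun y => nu i k j * a 0 * b ((y - co' i M) / s)
   + (j != i)%:R * A 0 * b' ((y - co' i M) / s))).
- under eq_integral do rewrite EFinD.
  have ib' : mu.-integrable setT (EFin \o (fun t => b' ((t - co' i M) / s))).
    apply: (@continuous_line_integrable _ _ (co' i M - s) (co' i M + s)).
    + by apply: (continuous_scale (c:=b')); case: bb.
    + move=> t tq; have [] := cutoff_scale_out (q:=co' i M) (t:=t) bb s0 => //.
      by rewrite ler0_norm; lra.
    + move=> t tq; have [] := cutoff_scale_out (q:=co' i M) (t:=t) bb s0 => //.
      by rewrite ger0_norm; lra.
  have ib := cutoff_scale_integrable (co' i M) bb s0.
  rewrite integralD//; last 2 first.
  + by have := integrableZl measurableT (nu i k j * a 0) ib.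
  + by have := integrableZl measurableT ((j != i)%:R * A 0) ib'.
  rewrite (int_cutoff_deriv _ _ bb s0) adde0.
  under eq_integral do rewrite EFinM.
  by rewrite integralZl// (massE _ bb s0) -EFinM /= mulrA.
- exact: integrable_mul_bool (dbub_integrable _ _ _ s0 k1) (measurable_shear_lt _ _ _ _).
move=> y; pose c := co i M + k * (y - co' i M).
(* An antiderivative of the bubble's derivative along the line: [a] serves for the term in [a'], and
   [A] for the term in [a]. Both vanish far to the left, as integration over a half line
   requires. *)
pose F (t : R) := nu i k j * b ((y - co' i M) / s) * a ((t - c) / s)
   + (j != i)%:R * b' ((y - co' i M) / s) * A ((t - c) / s).
pose f (t : R) := dphi i k M s j (pt i t y).
have fE t : f t = nu i k j * b ((y - co' i M) / s) * (a' ((t - c) / s) / s)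
   + (j != i)%:R * b' ((y - co' i M) / s) * (a ((t - c) / s) / s).
  by rewrite /f /dbub shear_pt across_pt -/c; ring.
have -> : (nu i k j * a 0 * b ((y - co' i M) / s) +
    (j != i)%:R * A 0 * b' ((y - co' i M) / s)) = F c.
  rewrite /F subrr mul0r; ring.
have F0 t : t <= c - s -> F t = 0 /\ f t = 0.
  move=> tc; have st : s <= `|t - c| by rewrite ler0_norm; lra.
  have [a0 a'0] := cutoff_scale_out ba s0 st.
  have [A0 _] := cutoff_scale_out bA s0 st.
  by rewrite /F fE a0 a'0 A0 !mul0r !mulr0 addr0.
have df (t : R) : is_derive t 1 F (f t).
  have d1 := is_deriveZ (nu i k j * b ((y - co' i M) / s)) (is_derive_cutoff_scale s c t ba).
  have d2 := is_deriveZ ((j != i)%:R * b' ((y - co' i M) / s)) (is_derive_cutoff_scale s c t bA).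
  have := is_deriveD d1 d2; move/is_derive_ext; apply => //; exact: esym (fE t).
have cf : continuous f.
  move=> t; apply: (@continuous_comp _ _ _ (fun t => pt i t y) (dphi i k M s j)).
    exact: continuous_pt.
  by apply: (continuous_dbub ba bb).
have cs : c - s < c by lra.
rewrite -(int_derive_half cs df cf F0); apply: eq_integral => t _.
by rewrite /f shear_pt -/c pmulr_llt0 ?invr_gt0// subr_lt0.
Qed.

End BubbleMoments.

(** * Scalar residual estimates *)

Section ScalarResiduals.
Context {R : realType}.
Notation P := (measurableTypeR R * measurableTypeR R)%type.
Implicit Types (x M : R * R) (i j : 'I_2) (k s : R) (Omega D : set (R * R)).
Implicit Types (V : 'I_2 -> R * R -> R) (G : R * R -> R).

(** Here [4 * s] is the side of the square, that is, the square root of its measure. *)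
Lemma square_test (h : R * R -> R) M s B : 0 < s -> continuous h ->
  (forall x, `|h x| <= B) -> (forall x, ~ square M (2 * s) x -> h x = 0) ->
  forall D (g : R * R -> R), L2 D g ->
  (leb2 R).-integrable setT (EFin \o (fun x : P => (g \_ D) x * h x)) /\
  `|\int[leb2 R]_x ((g \_ D) x * h x)| <= norm0 D g * (B * (4 * s)).
Proof.
move=> s0 ch hB h0 D g lg; have s40 : 0 <= 4 * s by rewrite mulr_ge0// ltW.
have mS := measurable_square M (2 * s).
have Sm : (leb2 R (square M (2 * s)) <= ((4 * s) ^+ 2)%:E)%E.
  rewrite leb2_square; last by rewrite mulr_ge0// ltW.
  by rewrite lee_fin mulrA -natrM.
have mh := continuous_measurable_plane ch.
have [lh _] := Lfun2_bounded mS s40 Sm mh hB h0.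
split; first exact: L2_mul_integrable.
exact: norm0_int_le mS s40 Sm mh hB h0 lg.
Qed.

(** The distributional form of [- div V = G]. *)
Definition weak_residual Omega V G := forall phi, test_fun Omega phi ->
  \sum_j \int[leb2 R]_(x in Omega) (V j x * 'D_(basis2 j) phi x) =
  \int[leb2 R]_(x in Omega) (G x * phi x).

Local Notation zeta := (@bumpP R 2 2).
Local Notation dzeta := (@dbumpP R 2 2).

(** Since both factors are [zeta], either coordinate may play the role of the first one, and one
    moment computation serves for both. *)
Lemma bub_zeta_sym i j M s : bub zeta zeta i 0 M s = bub zeta zeta j 0 M s.
Proof.
have E i' : bub zeta zeta i' 0 M s = bub zeta zeta 0 0 M s.
  apply/funext => x; rewrite /bub /shear /across /co /co' !mul0r !subr0 eqxx.
  by case: (i' == 0); rewrite // mulrC.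
by rewrite E [RHS]E.
Qed.

Lemma zeta_cutoff : cutoff zeta dzeta.
Proof. exact: cutoff_bumpP. Qed.

Let kappa : R := (4 / 9 * expR (- 2)) ^+ 2.

Let kappa0 : 0 < kappa.
Proof. by rewrite exprn_gt0// mulr_gt0// expR_gt0. Qed.

Lemma mass_zeta_ge s q : 0 < s -> kappa * s <= mass zeta s q.
Proof.
move=> s0; apply: (mass_ge q zeta_cutoff s0).
- by move=> v; exact: bumpP_ge0.
- exact: ltW.
- exact: bumpP22_ge.
Qed.

Lemma int_bub_zeta_affn c p q M s : 0 < s ->
  \int[leb2 R]_x (affn c p q x * bub zeta zeta 0 0 M s x) =
  affn c p q M * \int[leb2 R]_x bub zeta zeta 0 0 M s x.
Proof.
move=> s0; have k1 : `|0 : R| <= 1 by rewrite normr0.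
set phi := bub zeta zeta 0 0 M s.
have [N sN] := square_cbox M (2 * s).
have cphi : continuous phi by exact: (Cn_continuous (Cn_bub zeta_cutoff zeta_cutoff 0 0 0 M s)).
have phi0 x : ~ (cbox N : set (R * R)) x -> phi x = 0.
  move=> nx; have nsx : ~ square M (2 * s) x by move=> /sN.
  by have [h _] := bub_out zeta_cutoff zeta_cutoff 0 s0 k1 nsx.
have cco i : continuous (co i : R * R -> R).
  by move=> x; rewrite /co; case: (i == 0); [exact: cvg_fst|exact: cvg_snd].
have iphi := continuous_cbox_integrable cphi phi0.
have ico i : (leb2 R).-integrable setT (EFin \o (fun x : P => phi x * (co i x - co i M))).
  apply: (@continuous_cbox_integrable _ (fun x => phi x * (co i x - co i M)) N).
    move=> x; apply: cvgM; first exact: cphi.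
    by apply: cvgB; [exact: cco|exact: cvg_cst].
  by move=> x /phi0 ->; rewrite mul0r.
have mco i : \int[leb2 R]_x (phi x * (co i x - co i M)) = 0.
  rewrite /phi (bub_zeta_sym 0 i).
  (* By [derive_bumpP00], [v * zeta v] is [- 1/4] times the derivative of [bumpP 0 0]. *)
  apply: (@int_bub_co _ _ _ _ _ zeta_cutoff zeta_cutoff _ _ (- 4^-1) _ _ _ (cutoff_bumpP 0 0)) => // v.
  by rewrite derive_bumpP00; field.
rewrite (@eq_Rintegral _ _ _ _ _ (fun x : P => affn c p q M * phi x +
   (p * (phi x * (co 0 x - co 0 M)) + q * (phi x * (co 1 x - co 1 M))))); last first.
  move=> x _; rewrite /affn /co/=; ring.
have i1 := integrableZl measurableT p (ico 0).
have i2 := integrableZl measurableT q (ico 1).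
have i3 := integrableZl measurableT (affn c p q M) iphi.
rewrite RintegralD//; last by have := integrableD measurableT i1 i2.
rewrite [X in _ + X]RintegralD//.
by rewrite !RintegralZl// !mco !mulr0 !addr0.
Qed.

(** The value at [M] is multiplied by a mass of at least [(kappa * s)^2]. On a square of side [4 s]
    the bubble is bounded by [B] and its gradient by [B / s], so their L2 norms are at most [4 B s]
    and [4 B]: hence the powers of [s] and the constant [4 B / kappa^2]. *)
Lemma interior_residual : exists2 C : R, 0 < C &
  forall Omega D V (v : 'I_2 -> R) G c p q M s,
  D `<=` Omega -> 0 < s -> square M (2 * s) `<=` D -> weak_residual Omega V G ->
  (forall j, L2 D (fun x => V j x - v j)) -> L2 D (fun x => G x - affn c p q x) ->
  s ^+ 2 * `|affn c p q M| <= C * (\sum_j norm0 D (fun x => V j x - v j) +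
    s * norm0 D (fun x => G x - affn c p q x)).
Proof.
have [B B0 hB] := bub_bounded zeta_cutoff zeta_cutoff.
exists (4 * B / kappa ^+ 2); first by rewrite divr_gt0 ?mulr_gt0// exprn_gt0.
move=> Omega D V v G c p q M s DO s0 sD VG lV lG.
have k1 : `|0 : R| <= 1 by rewrite normr0.
set phi := bub zeta zeta 0 0 M s.
set dphi := dbub zeta dzeta zeta dzeta 0 0 M s.
have cphi : continuous phi by exact: (Cn_continuous (Cn_bub zeta_cutoff zeta_cutoff 0 0 0 M s)).
have cdphi j : continuous (dphi j) by exact: continuous_dbub zeta_cutoff zeta_cutoff _ _ _ _ _.
have phi0 x : ~ square M (2 * s) x -> phi x = 0.
  by move=> nx; have [] := bub_out zeta_cutoff zeta_cutoff 0 s0 k1 nx.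
have dphi0 j x : ~ square M (2 * s) x -> dphi j x = 0.
  by move=> nx; have [_] := bub_out zeta_cutoff zeta_cutoff 0 s0 k1 nx; apply.
have tphi : test_fun Omega phi.
  by apply: test_fun_bub s0 k1 (subset_trans sD DO); exact: zeta_cutoff.
have dV j : \int[leb2 R]_(x in Omega) (V j x * 'D_(basis2 j) phi x) =
   \int[leb2 R]_x (((fun x => V j x - v j) \_ D) x * dphi j x).
  have [ij _] := square_test s0 (cdphi j) (fun x => (hB 0 0 M s x s0 k1).2 j) (dphi0 j) (lV j).
  rewrite (_ : (fun x => V j x * 'D_(basis2 j) phi x) = (fun x => V j x * dphi j x)); last first.
    apply/funext => x; congr (_ * _).
    by case: (is_derive_bub zeta_cutoff zeta_cutoff 0 0 M s j x).
  rewrite (@Rintegral_supp _ Omega); last first.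
    by move=> x nx; rewrite dphi0 ?mulr0// => sx; exact: nx (DO _ (sD _ sx)).
  rewrite (@eq_Rintegral _ _ _ _ _ (fun x : P =>
    ((fun x => V j x - v j) \_ D) x * dphi j x + v j * dphi j x)).
    have idp := dbub_integrable zeta_cutoff zeta_cutoff 0 M j s0 k1.
    rewrite RintegralD//; last by have := integrableZl measurableT (v j) idp.
    by rewrite RintegralZl// (int_dbub zeta_cutoff zeta_cutoff)// mulr0 addr0.
  move=> x _; rewrite patchE; case: ifPn => [_|/negP]; first ring.
  by rewrite inE => nD; rewrite dphi0 ?mulr0 ?addr0// => sx; exact: nD (sD _ sx).
have dG : \int[leb2 R]_(x in Omega) (G x * phi x) =
   \int[leb2 R]_x (((fun x => G x - affn c p q x) \_ D) x * phi x) +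
   affn c p q M * \int[leb2 R]_x phi x.
  have [ig _] := square_test s0 cphi (fun x => (hB 0 0 M s x s0 k1).1) phi0 lG.
  rewrite -int_bub_zeta_affn// -/phi -RintegralD//; last first.
    have [N sN] := square_cbox M (2 * s).
    apply: (@continuous_cbox_integrable _ (fun x => affn c p q x * phi x) N).
      by move=> x; apply: cvgM; [exact: continuous_affn|exact: cphi].
    by move=> x nx; rewrite phi0 ?mulr0// => sx; exact: nx (sN _ sx).
  rewrite (@Rintegral_supp _ Omega); last first.
    by move=> x nx; rewrite phi0 ?mulr0// => sx; exact: nx (DO _ (sD _ sx)).
  apply: eq_Rintegral => x _; rewrite patchE; case: ifPn => [_|/negP]; first by ring.
  by rewrite inE => nD; rewrite phi0 ?mulr0 ?addr0// => sx; exact: nD (sD _ sx).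
have := VG _ tphi; rewrite dG; under eq_bigr do rewrite dV.
move=> E.
have [_ eG] := square_test s0 cphi (fun x => (hB 0 0 M s x s0 k1).1) phi0 lG.
have eV : `|\sum_j \int[leb2 R]_x (((fun x => V j x - v j) \_ D) x * dphi j x)| <=
    \sum_j norm0 D (fun x => V j x - v j) * (4 * B).
  apply: le_trans (ler_norm_sum _ _ _) _; apply: ler_sum => j _.
  have [_] := square_test s0 (cdphi j) (fun x => (hB 0 0 M s x s0 k1).2 j) (dphi0 j) (lV j).
  by rewrite [B / s * _]mulrC -mulrA [_ * (B / s)]mulrC divfK ?gt_eqF.
have bge : kappa ^+ 2 * s ^+ 2 <= \int[leb2 R]_x phi x.
  rewrite (int_bub zeta_cutoff zeta_cutoff)// -exprMn expr2.
  by rewrite ler_pM ?mulr_ge0 ?mass_zeta_ge ?(ltW kappa0) ?ltW.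
rewrite [leRHS]mulrAC ler_pdivlMr ?exprn_gt0//.
have : `|affn c p q M * \int[leb2 R]_x phi x| <=
   \sum_j norm0 D (fun x => V j x - v j) * (4 * B)
   + norm0 D (fun x => G x - affn c p q x) * (B * (4 * s)).
  have -> : affn c p q M * \int[leb2 R]_x phi x =
    \sum_j \int[leb2 R]_x (((fun x => V j x - v j) \_ D) x * dphi j x) -
    \int[leb2 R]_x (((fun x => G x - affn c p q x) \_ D) x * phi x).
    by rewrite E addrC addKr.
  by apply: le_trans (ler_normB _ _) _; exact: lerD.
rewrite -mulr_suml normrM => h.
have {}bge : `|affn c p q M| * (kappa ^+ 2 * s ^+ 2) <=
   `|affn c p q M| * `|\int[leb2 R]_x phi x|.
  by apply: ler_wpM2l => //; exact: le_trans bge (ler_norm _).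
rewrite -mulrA [leLHS]mulrC -mulrA.
apply: (le_trans bge); apply: (le_trans h).
rewrite le_eqVlt; apply/orP; left; apply/eqP; ring.
Qed.

End ScalarResiduals.

(** * Scalar residual across an edge *)

Section EdgeResidual.
Context {R : realType}.
Notation P := (measurableTypeR R * measurableTypeR R)%type.
Implicit Types (x M : R * R) (i j : 'I_2) (k s : R) (Omega D : set (R * R)).
Implicit Types (V : 'I_2 -> R * R -> R) (G : R * R -> R).

Lemma eq_cutoff (f g f' : R -> R) : cutoff f f' -> f =1 g -> cutoff g f'.
Proof. by move=> h /funext <-. Qed.

(** A derivative of a bump is a combination of bumps, hence again a cutoff function; its own
    derivative may stay implicit. *)
Lemma cutoff_dbumpP (j k : nat) : exists a', cutoff (@dbumpP R j k) a'.
Proof.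
have c1 := cutoffZ (- j%:R : R) (cutoff_bumpP j.+1 k).
have c2 := cutoff_bumpP j.+2 k : cutoff (@bumpP R _ _) _.
have c3 := cutoffZ (k%:R : R) (cutoff_bumpP j k.+1).
have c4 := cutoffZ (- 1 : R) (cutoff_bumpP j k.+2).
have c := cutoffD (cutoffD (cutoffD c1 c2) c3) c4.
by eexists; apply: (eq_cutoff c) => v; rewrite /dbumpP mulN1r.
Qed.

Local Notation zeta := (@bumpP R 2 2).

(** The jump is multiplied by [a 0] times a mass of [zeta], of order [s], while the gradient of the
    bubble has L2 norm at most [4 B]: hence the factor [s] on the left. The source keeps its full
    norm here and is left to the element estimate. *)
Lemma edge_residual : exists2 C : R, 0 < C &
  forall Omega D1 D2 V (v1 v2 : 'I_2 -> R) G i k M s,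
  D1 `<=` Omega -> D2 `<=` Omega -> square M (2 * s) `<=` Omega ->
  0 < s -> `|k| <= 1 ->
  (forall x, square M (2 * s) x -> D1 x <-> shear i k M s x < 0) ->
  (forall x, square M (2 * s) x -> D2 x <-> 0 < shear i k M s x) ->
  weak_residual Omega V G -> (forall j, L2 Omega (V j)) -> L2 Omega G ->
  (forall j, L2 D1 (fun x => V j x - v1 j)) ->
  (forall j, L2 D2 (fun x => V j x - v2 j)) -> L2 D1 G -> L2 D2 G ->
  s * `|\sum_j nu i k j * (v1 j - v2 j)| <=
  C * (\sum_j norm0 D1 (fun x => V j x - v1 j) + s * norm0 D1 G
    + (\sum_j norm0 D2 (fun x => V j x - v2 j) + s * norm0 D2 G)).
Proof.
have [a' ca] := cutoff_dbumpP 0 1; set a := @dbumpP R 0 1 in ca.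
have cA : cutoff (@bumpP R 0 1) a := cutoff_bumpP 0 1.
have cz := @zeta_cutoff R.
have [B B0 hB] := bub_bounded ca cz.
set kappa : R := (4 / 9 * expR (- 2)) ^+ 2.
have kappa0 : 0 < kappa by rewrite exprn_gt0// mulr_gt0// expR_gt0.
have a0 : 0 < a 0 by rewrite /a dbumpP01_0 exprn_gt0// expR_gt0.
exists (4 * B / (a 0 * kappa)); first by rewrite divr_gt0 ?mulr_gt0.
move=> Omega D1 D2 V v1 v2 G i k M s DO1 DO2 SO s0 k1 DL1 DL2 VG lV lG lV1 lV2 lG1 lG2.
set phi := bub a zeta i k M s.
set dphi := dbub a a' zeta (@dbumpP R 2 2) i k M s.
have cphi : continuous phi by exact: (Cn_continuous (Cn_bub ca cz 0 i k M s)).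
have cdphi j : continuous (dphi j) by exact: continuous_dbub ca cz _ _ _ _ _.
have phi0 x : ~ square M (2 * s) x -> phi x = 0.
  by move=> nx; have [] := bub_out ca cz i s0 k1 nx.
have dphi0 j x : ~ square M (2 * s) x -> dphi j x = 0.
  by move=> nx; have [_] := bub_out ca cz i s0 k1 nx; apply.
have tphi : test_fun Omega phi by apply: (test_fun_bub ca cz).
have bphi x := (hB i k M s x s0 k1).1.
have bdphi j x := (hB i k M s x s0 k1).2 j.
set gamma := a 0 * mass zeta s (co' i M).
(* Inside the square, [D1] and [D2] are the two half planes, so a test against [h] splits into two
   integrals, each with its own constant subtracted; the separating line is null. *)
have half (g h : R * R -> R) (c1 c2 : R) : L2 Omega g -> continuous h ->
    (leb2 R).-integrable setT (EFin \o (h : P -> R)) ->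
    (exists B, forall x, `|h x| <= B) ->
    (forall x, ~ square M (2 * s) x -> h x = 0) ->
    L2 D1 (fun x => g x - c1) -> L2 D2 (fun x => g x - c2) ->
    \int[leb2 R]_(x in Omega) (g x * h x) =
      \int[leb2 R]_x (((fun x => g x - c1) \_ D1) x * h x) +
      c1 * \int[leb2 R]_x (h x * (shear i k M s x < 0)%R%:R) +
      (\int[leb2 R]_x (((fun x => g x - c2) \_ D2) x * h x) +
      c2 * \int[leb2 R]_x (h x * (0 < shear i k M s x)%R%:R)).
  move=> lg ch ih [Bh hh] h0 l1 l2.
  have [ig _] := square_test s0 ch hh h0 lg.
  have [ig1 _] := square_test s0 ch hh h0 l1.
  have [ig2 _] := square_test s0 ch hh h0 l2.
  rewrite (@Rintegral_supp _ Omega); last first.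
    by move=> x nx; rewrite h0 ?mulr0// => sx; exact: nx (SO _ sx).
  transitivity (\int[leb2 R]_x ((g \_ Omega) x * h x)).
    apply: eq_Rintegral => x _; rewrite patchE; case: ifPn => // /negP.
    by rewrite inE => nO; rewrite h0 ?mulr0// => sx; exact: nO (SO _ sx).
  have mlt := measurable_shear_lt i k M s.
  have ilt := integrable_mul_bool ih mlt.
  have igt : (leb2 R).-integrable setT
      (EFin \o (fun x : P => h x * (0 < shear i k M s x)%R%:R)).
    apply: integrable_mul_bool ih _.
    (* Changing the sign of [s] exchanges the two half planes. *)
    have := measurable_shear_lt i k M (- s).
    congr (measurable_fun _ _); apply/funext => x; congr ((nat_of_bool _)%:R).
    by rewrite /shear invrN mulrN oppr_lt0.
  have := int_shear_split i k M s0 ig => /(congr1 (fun t => t +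
    \int[leb2 R]_x ((g \_ Omega) x * h x * (shear i k M s x < 0)%R%:R))).
  rewrite subrK => <-; rewrite addrC; congr (_ + _).
  - rewrite -RintegralZl// -RintegralD//; last by have := integrableZl measurableT c1 ilt.
    apply: eq_Rintegral => x _.
    have [sx|nsx] := pselect (square M (2 * s) x); last by rewrite h0// !(mulr0, mul0r) addr0.
    rewrite !patchE; case: (ltP (shear i k M s x) 0) => l0.
      have D1x := (DL1 _ sx).2 l0.
      by rewrite !mem_set//; [rewrite !mulr1; ring|exact: DO1].
    rewrite (memNset (A := D1)); last by move/(DL1 _ sx).1; rewrite ltNge l0.
    (* Off [D1] the restriction takes the default value [point], which is 0 in [R]. *)
    by rewrite !mulr0 addr0 (_ : point = 0 :> R)// mul0r.
  - rewrite -RintegralZl// -RintegralD//; last by have := integrableZl measurableT c2 igt.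
    apply: eq_Rintegral => x _.
    have [sx|nsx] := pselect (square M (2 * s) x); last by rewrite h0// !(mulr0, mul0r) addr0.
    rewrite !patchE; case: (ltP 0 (shear i k M s x)) => l0.
      have D2x := (DL2 _ sx).2 l0.
      by rewrite !mem_set//; [rewrite !mulr1; ring|exact: DO2].
    rewrite (memNset (A := D2)); last by move/(DL2 _ sx).1; rewrite ltNge l0.
    by rewrite !mulr0 addr0 (_ : point = 0 :> R)// mul0r.
have idphi j := dbub_integrable ca cz i M j s0 k1.
have iphi := bub_integrable ca cz i M s0 k1.
have hlt j : \int[leb2 R]_x (dphi j x * (shear i k M s x < 0)%R%:R) = nu i k j * gamma.
  apply: (int_dbub_half ca cz); [exact: cA|by []|by []].
have hgt j : \int[leb2 R]_x (dphi j x * (0 < shear i k M s x)%R%:R) = - (nu i k j * gamma).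
  by rewrite (int_shear_split i k M s0 (idphi j)) hlt (int_dbub ca cz)// sub0r.
have dV j : \int[leb2 R]_(x in Omega) (V j x * 'D_(basis2 j) phi x) =
   \int[leb2 R]_x (((fun x => V j x - v1 j) \_ D1) x * dphi j x) +
   \int[leb2 R]_x (((fun x => V j x - v2 j) \_ D2) x * dphi j x) +
   gamma * (nu i k j * (v1 j - v2 j)).
  rewrite (_ : (fun x => V j x * 'D_(basis2 j) phi x) = (fun x => V j x * dphi j x)); last first.
    apply/funext => x; congr (_ * _).
    by case: (is_derive_bub ca cz i k M s j x).
  rewrite (half _ _ (v1 j) (v2 j) (lV j) (cdphi j) (idphi j) _ (dphi0 j) (lV1 j) (lV2 j)).
    by rewrite hlt hgt; ring.
  by exists (B / s).
have dG : \int[leb2 R]_(x in Omega) (G x * phi x) =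
   \int[leb2 R]_x ((G \_ D1) x * phi x) + \int[leb2 R]_x ((G \_ D2) x * phi x).
  have e0 D : (fun x => G x - 0) \_ D = G \_ D by congr (_ \_ _); apply/funext => x; rewrite subr0.
  rewrite (half _ _ 0 0 lG cphi iphi _ phi0) ?e0 ?mul0r ?addr0//.
  - by exists B.
  - by apply: eq_L2 lG1 => x _; rewrite subr0.
  - by apply: eq_L2 lG2 => x _; rewrite subr0.
have := VG _ tphi; rewrite dG; under eq_bigr do rewrite dV.
rewrite !big_split/= -mulr_sumr => E.
have [_ eG1] := square_test s0 cphi bphi phi0 lG1.
have [_ eG2] := square_test s0 cphi bphi phi0 lG2.
have eV D (v : 'I_2 -> R) : (forall j, L2 D (fun x => V j x - v j)) ->
    `|\sum_j \int[leb2 R]_x (((fun x => V j x - v j) \_ D) x * dphi j x)| <=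
    (\sum_j norm0 D (fun x => V j x - v j)) * (4 * B).
  move=> lVD; rewrite mulr_suml.
  apply: le_trans (ler_norm_sum _ _ _) _; apply: ler_sum => j _.
  have [_] := square_test s0 (cdphi j) (bdphi j) (dphi0 j) (lVD j).
  by rewrite [B / s * _]mulrC -mulrA [_ * (B / s)]mulrC divfK ?gt_eqF.
have eV1 := eV _ _ lV1; have eV2 := eV _ _ lV2.
have gge : a 0 * kappa * s <= gamma.
  by rewrite -mulrA; apply: ler_wpM2l; [exact: ltW|exact: mass_zeta_ge].
set J := \sum_j nu i k j * (v1 j - v2 j) in E *.
have : gamma * `|J| <= (\sum_j norm0 D1 (fun x => V j x - v1 j)) * (4 * B)
   + (\sum_j norm0 D2 (fun x => V j x - v2 j)) * (4 * B)
   + norm0 D1 G * (B * (4 * s)) + norm0 D2 G * (B * (4 * s)).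
  have g0 : 0 <= gamma by apply: le_trans gge; rewrite !mulr_ge0// ltW.
  rewrite -(ger0_norm g0) -normrM.
  move: E eG1 eG2 eV1 eV2.
  move: (\int[leb2 R]_x _) (\int[leb2 R]_x _) (\sum_j _) (\sum_j _) => x1 x2 x3 x4.
  move=> E; have -> : gamma * J = x1 + x2 - x3 - x4 by lra.
  move=> e1 e2 e3 e4.
  have := ler_normB (x1 + x2 - x3) x4; have := ler_normB (x1 + x2) x3.
  have := ler_normD x1 x2; lra.
move=> h; rewrite [leRHS]mulrAC ler_pdivlMr ?mulr_gt0//.
have g1 : s * `|J| * (a 0 * kappa) <= gamma * `|J|.
  by rewrite mulrC mulrA ler_wpM2r.
apply: (le_trans g1); apply: (le_trans h).
rewrite le_eqVlt; apply/orP; left; apply/eqP; ring.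
Qed.

End EdgeResidual.

(** * Geometry of triangles and meshes *)

Section EuclideanNorm.
Context {R : realType}.
Implicit Types (a b x y : R * R).

Lemma addpE : (forall a b, (a + b).1 = a.1 + b.1) * (forall a b, (a + b).2 = a.2 + b.2).
Proof. by []. Qed.

Lemma scalepE : (forall (r : R) a, (r *: a).1 = r * a.1) *
  (forall (r : R) a, (r *: a).2 = r * a.2).
Proof. by []. Qed.

Lemma enorm_ge0 x : 0 <= enorm x.
Proof. exact: sqrtr_ge0. Qed.

Lemma sqr_enorm x : enorm x ^+ 2 = x.1 ^+ 2 + x.2 ^+ 2.
Proof. by rewrite sqr_sqrtr// addr_ge0// sqr_ge0. Qed.

Lemma enorm_le x (r : R) : 0 <= r -> x.1 ^+ 2 + x.2 ^+ 2 <= r ^+ 2 -> enorm x <= r.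
Proof. by move=> r0 xr; rewrite -[leRHS](ger0_norm r0) -sqrtr_sqr ler_wsqrtr. Qed.

Lemma enorm_le_sum x : enorm x <= `|x.1| + `|x.2|.
Proof.
apply: enorm_le; first by rewrite addr_ge0.
rewrite sqrrD !real_normK ?num_real// lerD2r lerDl.
by rewrite mulrn_wge0// mulr_ge0.
Qed.

Lemma ler_abs_enorm x : `|x.1| <= enorm x /\ `|x.2| <= enorm x.
Proof.
by split; rewrite -sqrtr_sqr ler_wsqrtr// ?lerDl ?lerDr sqr_ge0.
Qed.

Lemma enorm_eq0 x : enorm x = 0 -> x = 0.
Proof.
move=> x0; have [] := ler_abs_enorm x; rewrite x0 !normr_le0 => /eqP x1 /eqP x2.
by rewrite [LHS]surjective_pairing x1 x2.
Qed.

Lemma cross_le a b : `|cross a b| <= enorm a * enorm b.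
Proof.
rewrite -[leRHS]ger0_norm ?mulr_ge0 ?enorm_ge0//.
rewrite -(ler_sqr (normr_ge0 _)) ?nnegrE//.
rewrite !real_normK ?num_real// exprMn !sqr_enorm /cross -subr_ge0.
rewrite (_ : _ - _ = (a.1 * b.1 + a.2 * b.2) ^+ 2) ?sqr_ge0//; ring.
Qed.

End EuclideanNorm.

Section Barycentric.
Context {R : realType}.
Implicit Types (K : 'I_3 -> R * R) (x y : R * R) (i j k : 'I_3).

Definition area2 K : R := cross (K 1 - K 0) (K 2 - K 0).

(** A ratio of signed areas: the triangle joining [x] to the edge opposite [K k], against the whole
    triangle. *)
Definition bary K k x : R := cross (K (k + 2) - K (k + 1)) (x - K (k + 1)) / area2 K.

Lemma ord3P (Q : 'I_3 -> Prop) : Q 0 -> Q 1 -> Q 2 -> forall k, Q k.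
Proof.
move=> Q0 Q1 Q2 [[|[|[|//]]] k3].
- by rewrite (_ : Ordinal k3 = 0)//; apply: val_inj.
- by rewrite (_ : Ordinal k3 = 1)//; apply: val_inj.
- by rewrite (_ : Ordinal k3 = 2)//; apply: val_inj.
Qed.

Lemma ord3_add : [/\ (0 + 1 = 1 :> 'I_3), (0 + 2 = 2 :> 'I_3), (1 + 1 = 2 :> 'I_3),
  (1 + 2 = 0 :> 'I_3) & (2 + 1 = 0 :> 'I_3) /\ (2 + 2 = 1 :> 'I_3)].
Proof. by split; (try split); apply: val_inj. Qed.

Definition o3 := let: And5 a b c d (conj e f) := ord3_add in (a, b, c, d, e, f).

Lemma sum3 (V : nmodType) (F : 'I_3 -> V) : \sum_k F k = F 0 + F 1 + F 2.
Proof.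
rewrite !big_ord_recl big_ord0 addr0 addrA; congr (F _ + F _ + F _); exact: val_inj.
Qed.

Lemma cross_area2 K k : cross (K (k + 2) - K (k + 1)) (K k - K (k + 1)) = area2 K.
Proof.
by move: k; apply: ord3P; rewrite !o3 /area2 /cross /=; ring.
Qed.

Variable K : 'I_3 -> R * R.
Hypothesis K0 : area2 K != 0.

Lemma bary_sum x : \sum_k bary K k x = 1.
Proof.
rewrite sum3 /bary !o3 -!mulrDl -[RHS](divff K0); congr (_ / _).
rewrite /area2 /cross /=; ring.
Qed.

Lemma bary_comb x : x = \sum_k bary K k x *: K k.
Proof.
rewrite sum3 [LHS]surjective_pairing [RHS]surjective_pairing.
move: K0; rewrite /bary !o3 /area2 /cross !addpE !scalepE /= => ?.
by congr pair; field.
Qed.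

Lemma bary_bary (l : 'I_3 -> R) k : \sum_i l i = 1 ->
  bary K k (\sum_i l i *: K i) = l k.
Proof.
rewrite !sum3 => l1; have l2 : l 2 = 1 - l 0 - l 1 by rewrite -l1; ring.
move: K0; rewrite /bary /area2 /cross !addpE !scalepE /= => ?.
by move: k; apply: ord3P; rewrite !o3 /= ?l2; field.
Qed.

Lemma triangleP x : triangle K x <-> forall k, 0 <= bary K k x.
Proof.
split=> [[l [l0 l1 ->]] k|xk]; first by rewrite bary_bary.
by exists (fun k => bary K k x); split => //; [exact: bary_sum|exact: bary_comb].
Qed.

Lemma bary_le1 x k : (forall k, 0 <= bary K k x) -> bary K k x <= 1.
Proof.
move=> xk; rewrite -(bary_sum x) (bigD1 k)//= lerDl.
by apply: sumr_ge0.
Qed.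

Lemma baryB x y k :
  bary K k x - bary K k y = cross (K (k + 2) - K (k + 1)) (x - y) / area2 K.
Proof. by rewrite /bary -mulrBl; congr (_ / _); rewrite /cross/=; ring. Qed.

Lemma bary_vertex i k : bary K k (K i) = (i == k)%:R.
Proof.
have := @bary_bary (fun j => (i == j)%:R) k; rewrite (bigD1 i)//= eqxx big1; last first.
  by move=> j; rewrite eq_sym => /negbTE ->.
rewrite addr0 => /(_ erefl) <-; congr bary.
rewrite (bigD1 i)//= eqxx scale1r big1 ?addr0// => j.
by rewrite eq_sym => /negbTE ->; rewrite scale0r.
Qed.

Lemma bary_edge i x : edge K i x -> bary K i x = 0.
Proof.
move=> [t _ <-]; rewrite /bary (_ : cross _ _ = 0) ?mul0r//.
rewrite /cross /=  /GRing.scale/=; ring.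
Qed.

Lemma bary_edge_mid i k : bary K k (edge_mid K i) = (k != i)%:R / 2.
Proof.
have := @bary_bary (fun k => (k != i)%:R / 2) k; rewrite !sum3.
have -> : edge_mid K i = ((0 != i)%:R / 2) *: K 0 + ((1 != i)%:R / 2) *: K 1 +
    ((2 != i)%:R / 2) *: K 2.
  move: i; apply: ord3P;
    rewrite /edge_mid /midpoint !o3 /= scalerDr !mul0r !mul1r scale0r ?add0r ?addr0 //.
  by rewrite addrC.
apply; move: i; apply: ord3P => /=; lra.
Qed.

Lemma edge_nz k : 0 < enorm (K (k + 2) - K (k + 1)).
Proof.
rewrite lt_neqAle enorm_ge0 andbT eq_sym; apply: contra_neq K0 => /enorm_eq0 e0.
by rewrite -(cross_area2 K k) e0 /cross /= !mul0r subrr.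
Qed.

(** Along the diameter of the ball perpendicular to the edge, the barycentric coordinate [k] changes
    by [2 * r] times the edge length over [area2 K], yet it stays in [[0, 1]]. *)
Lemma inball_edge x (r : R) k : 0 <= r ->
  [set y | enorm (y - x) <= r] `<=` triangle K ->
  2 * r * enorm (K (k + 2) - K (k + 1)) <= `|area2 K|.
Proof.
move=> r0 xr; have [e eE] : {e | e = K (k + 2) - K (k + 1)} by exists (K (k + 2) - K (k + 1)).
have e0 : 0 < enorm e by rewrite eE; exact: edge_nz.
rewrite -eE.
pose n : R * R := (- (r / enorm e * e.2), r / enorm e * e.1).
have nr : enorm n <= r.
  apply: enorm_le => //=.
  rewrite (_ : _ + _ = (r / enorm e) ^+ 2 * enorm e ^+ 2); last by rewrite sqr_enorm; ring.
  by rewrite -exprMn divfK ?gt_eqF.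
have xn1 : triangle K (x + n) by apply: xr => /=; rewrite addrC addKr.
have xn2 : triangle K (x - n).
  apply: xr => /=; rewrite addrC addKr; apply: le_trans nr.
  by rewrite /enorm /= !sqrrN.
move/triangleP: xn1 => p1; move/triangleP: xn2 => p2.
have := bary_le1 k p1; have := bary_le1 k p2; have := p1 k; have := p2 k.
have : bary K k (x + n) - bary K k (x - n) = 2 * r * enorm e / area2 K.
  rewrite baryB -eE; congr (_ / _).
  have E : enorm e ^+ 2 = e.1 ^+ 2 + e.2 ^+ 2 := sqr_enorm e.
  have -> : 2 * r * enorm e = 2 * (r / enorm e) * enorm e ^+ 2.
    by have ? := lt0r_neq0 e0; field.
  rewrite E /cross /= /n /=; ring.
move=> h h1 h2 h3 h4.
have : `|2 * r * enorm e / area2 K| <= 1 by rewrite -h ler_norml; lra.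
rewrite normrM normfV ler_pdivrMr ?normr_gt0// mul1r.
by apply: le_trans; exact: ler_norm.
Qed.

Let S := [set d : R | exists x (r : R), [/\ 0 <= r,
    [set y | enorm (y - x) <= r] `<=` triangle K & d = 2 * r]].

Let S0 : S 0.
Proof.
exists (K 0), 0; split=> //; last by rewrite mulr0.
move=> y /= y0; have /enorm_eq0/eqP : enorm (y - K 0) = 0.
  by apply/eqP; rewrite eq_le y0 enorm_ge0.
rewrite subr_eq0 => /eqP ->; apply/triangleP => k; rewrite bary_vertex.
exact: ler0n.
Qed.

Let Sub k : ubound S (`|area2 K| / enorm (K (k + 2) - K (k + 1))).
Proof.
by move=> _ [x [r [r0 xr ->]]]; rewrite ler_pdivlMr ?edge_nz//; exact: inball_edge xr.
Qed.

Lemma inball_diam_ge0 : 0 <= inball_diam (triangle K).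
Proof.
apply: (@ub_le_sup _ S) S0.
by exists (`|area2 K| / enorm (K (0 + 2) - K (0 + 1))); exact: Sub.
Qed.

Lemma inball_diam_edge k :
  inball_diam (triangle K) * enorm (K (k + 2) - K (k + 1)) <= `|area2 K|.
Proof.
rewrite -ler_pdivlMr ?edge_nz//; apply: (@ge_sup _ S); first by exists 0.
exact: Sub.
Qed.

(** The gradient of the coordinate has length edge over [|area2 K|], which inscribed balls bound.
    The inscribed diameter stays on the left, since only its nonnegativity is known at this
    point. *)
Lemma bary_lipschitz k x y :
  inball_diam (triangle K) * `|bary K k x - bary K k y| <= `|x.1 - y.1| + `|x.2 - y.2|.
Proof.
apply: le_trans (enorm_le_sum (x - y)).
rewrite baryB normrM normfV mulrA ler_pdivrMr ?normr_gt0//.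
have h1 := cross_le (K (k + 2) - K (k + 1)) (x - y).
have h2 := inball_diam_edge k.
apply: (le_trans (ler_wpM2l inball_diam_ge0 h1)).
by rewrite mulrA mulrC ler_wpM2l ?enorm_ge0.
Qed.

(** A crude bound, which makes the supremum in [diam] one over a bounded set. *)
Lemma triangle_bounded x y : triangle K x -> triangle K y ->
  enorm (x - y) <= 2 * \sum_i (`|(K i).1| + `|(K i).2|).
Proof.
have h z : triangle K z -> `|z.1| + `|z.2| <= \sum_i (`|(K i).1| + `|(K i).2|).
  move=> [l [l0 l1 ->]].
  have l01 i : l i <= 1.
    by rewrite -l1 (bigD1 i)//= lerDl sumr_ge0.
  have e1 : (\sum_i l i *: K i).1 = \sum_i l i * (K i).1 by rewrite !sum3.
  have e2 : (\sum_i l i *: K i).2 = \sum_i l i * (K i).2 by rewrite !sum3.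
  rewrite e1 e2 big_split/=; apply: lerD; apply: le_trans (ler_norm_sum _ _ _) _;
    apply: ler_sum => i _; rewrite normrM ger0_norm//; exact: ler_piMl.
move=> /h hx /h hy; apply: le_trans (enorm_le_sum _) _ => /=.
have := ler_normB x.1 y.1; have := ler_normB x.2 y.2; lra.
Qed.

Lemma diam_ge x y : triangle K x -> triangle K y -> enorm (x - y) <= diam (triangle K).
Proof.
move=> Kx Ky; apply: (@ub_le_sup _ [set d | exists x y,
  [/\ triangle K x, triangle K y & d = enorm (x - y)]]); last by exists x, y.
by exists (2 * \sum_i (`|(K i).1| + `|(K i).2|)) => _ [z [t [Kz Kt ->]]]; exact: triangle_bounded.
Qed.

Lemma vertex_triangle i : triangle K (K i).
Proof. by apply/triangleP => k; rewrite bary_vertex ler0n. Qed.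

Lemma edge_diam k : enorm (K (k + 2) - K (k + 1)) <= diam (triangle K).
Proof. by apply: diam_ge; exact: vertex_triangle. Qed.

Lemma diam_le (B : R) : (forall x y, triangle K x -> triangle K y -> enorm (x - y) <= B) ->
  diam (triangle K) <= B.
Proof.
move=> h; apply: ge_sup.
  by exists (enorm (K 0 - K 0)), (K 0), (K 0); split => //; exact: vertex_triangle.
by move=> _ [x [y [Kx Ky ->]]]; exact: h.
Qed.

Lemma continuous_bary k : continuous (bary K k).
Proof.
pose e := K (k + 2) - K (k + 1); pose c := K (k + 1).
rewrite (_ : bary K k = affn ((e.2 * c.1 - e.1 * c.2) / area2 K) (- e.2 / area2 K) (e.1 / area2 K)).
  exact: continuous_affn.
by apply/funext => x; rewrite /bary /cross /affn/= -/e -/c /e /=; ring.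
Qed.

Lemma interior_triangleP x : (triangle K)° x <-> forall k, 0 < bary K k x.
Proof.
split=> [Kx k|xk].
  have xk : forall k, 0 <= bary K k x by apply/triangleP; exact: interior_subset Kx.
  rewrite lt_neqAle xk andbT; apply/negP => /eqP bk0.
  have /nbhs_ballP[e /= e0 eK] := Kx.
  (* A step away from the vertex [K k], short enough to stay in the ball, takes coordinate [k] from
     0 to [- t]. *)
  pose d := K k - x; pose t := e / (2 * (1 + `|d.1| + `|d.2|)).
  have d0 : 0 < 1 + `|d.1| + `|d.2| by have := normr_ge0 d.1; have := normr_ge0 d.2; lra.
  have t0 : 0 < t by rewrite divr_gt0// mulr_gt0.
  have td : t * (1 + `|d.1| + `|d.2|) = e / 2.
    by rewrite /t; have ? := lt0r_neq0 d0; field.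
  have /triangleP/(_ k) : triangle K (x - t *: d).
    apply: eK; split; rewrite /ball/= opprB addrC subrK normrM (gtr0_norm t0);
      move: td; rewrite !mulrDr mulr1;
      have := mulr_ge0 (ltW t0) (normr_ge0 d.1);
      have := mulr_ge0 (ltW t0) (normr_ge0 d.2); lra.
  have E : bary K k (x - t *: d) - bary K k x = - t * (bary K k (K k) - bary K k x).
    rewrite !baryB /cross /= /d /GRing.scale /=; ring.
  have : bary K k (x - t *: d) = - t.
    by move: E; rewrite -bk0 bary_vertex eqxx !subr0 mulr1.
  by move=> ->; rewrite oppr_ge0 leNgt t0.
have : ([set x | forall k, 0 < bary K k x] `<=` triangle K).
  by move=> y yk; apply/triangleP => k; exact: ltW.
rewrite open_subsetE; first by apply.
pose A k := bary K k @^-1` [set r | 0 < r].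
have oA k : open (A k).
  by apply: open_comp => [y _|]; [exact: continuous_bary|exact: open_gt].
rewrite (_ : [set _ | _] = A 0 `&` A 1 `&` A 2); first by apply: openI => //; exact: openI.
by apply/seteqP; split => [y yk|y [[y0 y1] y2]]; [repeat split; exact: yk|exact: ord3P].
Qed.

End Barycentric.

(** * Two triangles sharing an edge *)

Section EdgePatch.
Context {R : realType}.
Implicit Types (K : 'I_3 -> R * R) (a b x y : R * R) (i j k : 'I_3).

Definition edge_vec K i : R * R := K (i + 2) - K (i + 1).
(** An unnormalized barycentric coordinate. Up to sign it is the same for the two triangles sharing
    the edge, which makes it a common reference for their sides and normals. *)
Definition edge_lin K i x : R := cross (edge_vec K i) (x - K (i + 1)).

Lemma pair_ext x y : x.1 = y.1 -> x.2 = y.2 -> x = y.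
Proof. by case: x y => [? ?] [? ?] /= -> ->. Qed.

(** Endpoints are extreme points: [s] and [t] locate [a'] and [b'] on the first segment, and their
    combinations with weights [p] and [q] are 0 and 1. As all numbers lie in [[0, 1]], each weighted
    term must be extremal. *)
Lemma segment_inj a b a' b' : a != b -> segment a b = segment a' b' ->
  (a' = a /\ b' = b) \/ (a' = b /\ b' = a).
Proof.
move=> ab E; have d0 : b - a != 0 by rewrite subr_eq0 eq_sym.
have end1 (u v : R * R) : segment u v u.
  by exists 0; [rewrite /= in_itv/= lexx ler01|rewrite subr0 scale1r scale0r addr0].
have end2 (u v : R * R) : segment u v v.
  by exists 1; [rewrite /= in_itv/= lexx ler01|rewrite subrr scale1r scale0r add0r].
have := end1 a' b'; rewrite -E => -[s]; rewrite /= in_itv/= => /andP[s0 s1] a'E.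
have := end2 a' b'; rewrite -E => -[t]; rewrite /= in_itv/= => /andP[t0 t1] b'E.
have := end1 a b; rewrite E => -[p]; rewrite /= in_itv/= => /andP[p0 p1] aE.
have := end2 a b; rewrite E => -[q]; rewrite /= in_itv/= => /andP[q0 q1] bE.
have hp : (1 - p) * s + p * t = 0.
  have : ((1 - p) * s + p * t) *: (b - a) == 0.
    rewrite (_ : _ *: _ = (1 - p) *: a' + p *: b' - a); first by rewrite aE subrr.
    by rewrite -a'E -b'E; apply: pair_ext; rewrite !(addpE, scalepE)/=; ring.
  by rewrite scaler_eq0 (negbTE d0) orbF => /eqP.
have hq : (1 - q) * s + q * t = 1.
  have : ((1 - q) * s + q * t - 1) *: (b - a) == 0.
    rewrite (_ : _ *: _ = (1 - q) *: a' + q *: b' - b); first by rewrite bE subrr.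
    by rewrite -a'E -b'E; apply: pair_ext; rewrite !(addpE, scalepE)/=; ring.
  by rewrite scaler_eq0 (negbTE d0) orbF subr_eq0 => /eqP.
have ps : (1 - p) * s = 0.
  have h1 : 0 <= (1 - p) * s by rewrite mulr_ge0// subr_ge0.
  have h2 : 0 <= p * t by rewrite mulr_ge0.
  lra.
have pt0 : p * t = 0 by lra.
have qs : (1 - q) * (1 - s) = 0.
  have h1 : 0 <= (1 - q) * (1 - s) by rewrite mulr_ge0// subr_ge0.
  have h2 : 0 <= q * (1 - t) by rewrite mulr_ge0// subr_ge0.
  lra.
have qt : q * (1 - t) = 0 by lra.
case: (eqVneq s 0) => [sE|sn].
  have q1' : q = 1 by move: qs; rewrite sE subr0 mulr1; lra.
  have tE : t = 1 by move: qt; rewrite q1' mul1r; lra.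
  left; rewrite -a'E -b'E sE tE subr0 subrr !scale1r !scale0r addr0 add0r; by [].
have p1' : p = 1.
  by move/eqP: ps; rewrite mulf_eq0 (negbTE sn) orbF subr_eq0 eq_sym => /eqP.
have tE : t = 0 by move: pt0; rewrite p1' mul1r.
have qE : q = 0 by move: qt; rewrite tE subr0 mulr1.
have sE : s = 1 by move: qs; rewrite qE subr0 mul1r; lra.
by right; rewrite -a'E -b'E sE tE subr0 subrr !scale1r !scale0r addr0 add0r.
Qed.

(** The coordinate is 1/2 at the midpoint and changes by at most [2 r / inball_diam <= 1/4] in the
    square. The same factor 8 serves around the centroid, where the coordinates are 1/3. *)
Lemma near_edge K i k x (r : R) : area2 K != 0 ->
  0 < inball_diam (triangle K) -> 8 * r <= inball_diam (triangle K) ->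
  square (edge_mid K i) r x -> k != i -> 0 < bary K k x.
Proof.
move=> K0 d0 rd /squareP[x1 x2] ki.
have := bary_lipschitz K0 k x (edge_mid K i); rewrite bary_edge_mid// ki/=.
set d := inball_diam _ in d0 rd *; set c := bary K k x => h.
have h2 : d * `|c - 1 / 2| <= d * (1 / 4) by lra.
have : `|c - 1 / 2| <= 1 / 4 by rewrite -(ler_pM2l d0).
rewrite ler_norml; lra.
Qed.

Lemma near_centroid K k c x (r : R) : area2 K != 0 ->
  0 < inball_diam (triangle K) -> 8 * r <= inball_diam (triangle K) ->
  (forall k, bary K k c = 3^-1) -> square c r x -> 0 < bary K k x.
Proof.
move=> K0 d0 rd cE /squareP[x1 x2].
have := bary_lipschitz K0 k x c; rewrite cE.
set d := inball_diam _ in d0 rd *; set u := bary K k x => h.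
have h2 : d * `|u - 3^-1| <= d * (1 / 4) by lra.
have : `|u - 3^-1| <= 1 / 4 by rewrite -(ler_pM2l d0).
rewrite ler_norml; lra.
Qed.

Lemma centroid_exists K : area2 K != 0 -> exists c, forall k, bary K k c = 3^-1.
Proof.
move=> K0; exists (\sum_i 3^-1 *: K i) => k.
by apply: (bary_bary K0 (l := fun=> 3^-1)); rewrite sum3; lra.
Qed.

Variables (K K' : 'I_3 -> R * R) (i j : 'I_3).
Hypotheses (K0 : area2 K != 0) (K'0 : area2 K' != 0).
Hypothesis eE : edge K i = edge K' j.

Local Notation e := (edge_vec K i).
Local Notation L := (edge_lin K i).

Lemma edge_endpoints :
  (K' (j + 1) = K (i + 1) /\ K' (j + 2) = K (i + 2)) \/
  (K' (j + 1) = K (i + 2) /\ K' (j + 2) = K (i + 1)).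
Proof.
apply: segment_inj => //; apply/negP => /eqP ab.
have := edge_nz K0 i; rewrite ab subrr /enorm /= expr0n /= addr0 sqrtr0.
by rewrite ltxx.
Qed.

Lemma edge_mid_eq : edge_mid K' j = edge_mid K i.
Proof.
by rewrite /edge_mid /midpoint; case: edge_endpoints => -[-> ->] //; rewrite addrC.
Qed.

Lemma edge_len_eq : edge_len K' j = edge_len K i.
Proof.
rewrite /edge_len; case: edge_endpoints => -[-> ->] //.
by rewrite -opprB /enorm /= !sqrrN.
Qed.

Lemma L_apex : L (K i) = area2 K.
Proof. exact: cross_area2. Qed.

Lemma edge_cross : exists2 s : R, s ^+ 2 = 1 &
  K' (j + 2) - K' (j + 1) = s *: e /\
  forall x, cross (K' (j + 2) - K' (j + 1)) (x - K' (j + 1)) = s * L x.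
Proof.
case: edge_endpoints => -[-> ->].
  by exists 1; rewrite ?expr1n//; split=> [|x]; rewrite ?scale1r// mul1r.
exists (- 1); rewrite ?sqrrN ?expr1n//; split=> [|x].
  by rewrite scaleN1r opprB.
by rewrite /edge_lin /cross /edge_vec /=; ring.
Qed.

Lemma bary_L x : bary K i x = L x / L (K i).
Proof. by rewrite L_apex. Qed.

Lemma bary'_L x : bary K' j x = L x / L (K' j).
Proof.
rewrite /bary -(cross_area2 K' j); have [s s1 [_ sE]] := edge_cross.
rewrite !sE -mulf_div divff ?mul1r//.
by apply/eqP => s0; move: s1; rewrite s0 expr0n /= => /eqP; rewrite eq_sym oner_eq0.
Qed.

Lemma L'_nz : L (K' j) != 0.
Proof.
have [s s1 [_ sE]] := edge_cross.
by apply: contra_neq K'0 => L0; rewrite -(cross_area2 K' j) sE L0 mulr0.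
Qed.

Lemma outer_normalE :
  outer_normal K i = (Num.sg (L (K i)) / enorm e) *: vec2 (e.2, - e.1) /\
  outer_normal K' j = (Num.sg (L (K' j)) / enorm e) *: vec2 (e.2, - e.1).
Proof.
split=> //; have [s s1 [dE sE]] := edge_cross.
have el : enorm (K' (j + 2) - K' (j + 1)) = enorm e by exact: edge_len_eq.
rewrite /outer_normal sE el dE /=.
have -> : vec2 ((s *: e).2, - (s *: e).1) = s *: vec2 (e.2, - e.1).
  by apply/matrixP => p q; rewrite !mxE; case: ifP => _; rewrite scalepE//= mulrN.
rewrite scalerA; congr (_ *: _); rewrite sgrM mulrAC; congr (_ / _).
have [->|->] : s = 1 \/ s = -1.
- by move/eqP: s1; rewrite sqrf_eq1 => /orP[]/eqP ->; [left|right].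
- by rewrite sgr1 mul1r mulr1.
- by rewrite sgrN sgr1 mulN1r mulrN1 opprK.
Qed.

Lemma L_mid x : L x = e.1 * (x.2 - (edge_mid K i).2) - e.2 * (x.1 - (edge_mid K i).1).
Proof.
by rewrite /edge_lin /cross /edge_vec /edge_mid /midpoint !scalepE !addpE /=; field.
Qed.

(* In the direction of the larger component of the normal, the line supporting
   the edge is the graph of an affine function with slope at most one. *)
Lemma edge_graph (s : R) : 0 < s -> exists (i0 : 'I_2) (k mu : R),
  [/\ `|k| <= 1, mu != 0, `|mu| <= enorm e,
      forall x, L x = - mu * s * shear i0 k (edge_mid K i) s x &
      forall r, vec2 (e.2, - e.1) r 0 = mu * nu i0 k r].
Proof.
move=> s0; have sn := lt0r_neq0 s0.
have [e1 e2] := ler_abs_enorm e.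
have e0 : 0 < enorm e := edge_nz K0 i.
have [le12|/ltW le21] := leP `|e.1| `|e.2|.
  have en : e.2 != 0.
    apply/eqP => e20; move: le12; rewrite e20 normr0 normr_le0 => /eqP e10.
    by move: e0; rewrite /enorm e10 e20 expr0n addr0 sqrtr0 ltxx.
  exists 0, (e.1 / e.2), e.2; split=> //.
  - by rewrite normrM normfV ler_pdivrMr ?normr_gt0// mul1r.
  - by move=> x; rewrite L_mid /shear /co /co' eqxx; field; rewrite en sn.
  - by move=> r; rewrite mxE /nu; case: ifP => _ /=; field.
have en : e.1 != 0.
  apply/eqP => e10; move: le21; rewrite e10 normr0 normr_le0 => /eqP e20.
  by move: e0; rewrite /enorm e10 e20 expr0n addr0 sqrtr0 ltxx.
exists 1, (e.2 / e.1), (- e.1); split=> //.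
- by rewrite normrM normfV ler_pdivrMr ?normr_gt0// mul1r.
- by rewrite oppr_eq0.
- by rewrite normrN.
- by move=> x; rewrite L_mid /shear /co /co' /=; field; rewrite en sn.
- move=> r; rewrite mxE /nu; case: (eqVneq r 0) => [->|r0] /=; first by field.
  rewrite ifT ?mulr1//; apply/eqP/val_inj.
  by case: r r0 => [[|[|//]] ?].
Qed.

End EdgePatch.

(** * Elements and edge patches of a mesh *)

Section MeshGeometry.
Context {R : realType}.
Variables (Omega : set (R * R)) (m : mesh R) (sigma : R).
Hypotheses (hO : polygonal_domain Omega) (hm : triangulation Omega m)
  (hs : shape_regular sigma m).
Implicit Types (T : 'I_(ntri m)) (x : R * R).

Lemma mesh_area2 T : area2 (vertex T) != 0.
Proof. by case: hm => h _ _; exact: h. Qed.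

Lemma tri_closure T : tri T `<=` closure Omega.
Proof. by case: hm => _ -> _ x Tx; exists T. Qed.

(** The exclusion of slits enters here: [Omega] is the interior of its closure, so an open set
    covered by triangles cannot meet the boundary. *)
Lemma open_sub_closure (A : set (R * R)) : open A -> A `<=` closure Omega -> A `<=` Omega.
Proof.
by move=> oA AO; have [_ _ _ _ [-> _]] := hO; rewrite -open_subsetE.
Qed.

Lemma elt_sub T : elt T `<=` Omega.
Proof.
apply: open_sub_closure; first exact: open_interior.
by apply: subset_trans (@tri_closure T); exact: interior_subset.
Qed.

Lemma eltP T x : elt T x <-> forall k, 0 < bary (vertex T) k x.
Proof. exact: interior_triangleP (mesh_area2 T) x. Qed.

Lemma measurable_elt T : measurable (elt T : set (measurableTypeR R * measurableTypeR R)).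
Proof. by apply: open_measurable_plane; exact: open_interior. Qed.

(** A common point would be a vertex or lie on an edge, where some barycentric coordinate
    vanishes. *)
Lemma elt_disjoint T T' x : T != T' -> elt T x -> ~ elt T' x.
Proof.
move=> TT' /[dup] /interior_subset Tx /eltP xk /interior_subset T'x.
have TT : (tri T `&` tri T') x by [].
have [_ _ /(_ T T' TT')[E|[i [j [_ E]]]|[i [j [_ E]]]]] := hm; rewrite E in TT.
- by [].
- have := xk (i + 1); rewrite TT bary_vertex ?mesh_area2//.
  by rewrite (_ : i == i + 1 = false) ?ltxx//; move: i {E TT}; apply: ord3P.
- by have := xk i; rewrite bary_edge// ltxx.
Qed.

Lemma pw_elt (V : nmodType) (g : 'I_(ntri m) -> R * R -> V) T x :
  elt T x -> pw g x = g T x.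
Proof.
move=> Tx; rewrite /pw (bigD1 T) ?mem_set//= big1 ?addr0// => T' /andP[/set_mem T'x TT'].
by exfalso; apply: elt_disjoint T'x Tx.
Qed.

Lemma diam_gt0 T : 0 < diam (tri T).
Proof. exact: lt_le_trans (edge_nz (mesh_area2 T) 0) (edge_diam (mesh_area2 T) 0). Qed.

Lemma inball_gt0 T : 0 < sigma /\ 0 < inball_diam (tri T).
Proof.
have d0 := diam_gt0 T; have := hs T; have i0 := inball_diam_ge0 (mesh_area2 T).
move=> h; have si : 0 < sigma * inball_diam (tri T) by exact: lt_le_trans h.
have i1 : 0 < inball_diam (tri T).
  by rewrite lt_neqAle i0 andbT eq_sym; apply: contraTneq si => ->; rewrite mulr0 ltxx.
by split=> //; rewrite -(pmulr_lgt0 _ i1).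
Qed.

(** Shape regularity gives [24 * s <= inball_diam] for both triangles, and [24 = 8 * 3] makes
    [near_edge] available up to half side [3 * s]. Bubbles occupy half side [2 * s]; the margin
    leaves room for an open neighbourhood, from which inclusion in [Omega] follows. *)
Lemma edge_patch T i T' j : interior_edge T i T' j ->
  let s := edge_len (vertex T) i / (24 * sigma) in
  let M := edge_mid (vertex T) i in
  exists (i0 : 'I_2) (k mu : R),
  [/\ 0 < s, `|k| <= 1 & `|mu| <= 1] /\
  [/\ forall r, outer_normal (vertex T) i r 0 = mu * nu i0 k r,
      outer_normal (vertex T') j = - outer_normal (vertex T) i,
      square M (2 * s) `<=` Omega &
   (forall x, square M (2 * s) x -> (elt T x <-> shear i0 k M s x < 0) /\
                                 (elt T' x <-> 0 < shear i0 k M s x)) \/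
   (forall x, square M (2 * s) x -> (elt T' x <-> shear i0 k M s x < 0) /\
                                 (elt T x <-> 0 < shear i0 k M s x))].
Proof.
move=> [TT' eE] s M.
have a := mesh_area2 T; have a' := mesh_area2 T'.
have [s0 d0] := inball_gt0 T; have [_ d0'] := inball_gt0 T'.
have l0 : 0 < edge_len (vertex T) i by exact: edge_nz.
have sp : 0 < s by rewrite divr_gt0// mulr_gt0.
have sE : 24 * s * sigma = edge_len (vertex T) i.
  by rewrite /s; have ? := lt0r_neq0 s0; field.
have sd : 24 * s <= inball_diam (tri T).
  rewrite -(ler_pM2r s0) sE [leRHS]mulrC; apply: le_trans (hs T).
  exact: edge_diam.
have sd' : 24 * s <= inball_diam (tri T').
  rewrite -(ler_pM2r s0) sE [leRHS]mulrC; apply: le_trans (hs T').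
  by rewrite -(edge_len_eq a eE); exact: edge_diam.
set L := edge_lin (vertex T) i.
have Mid' : edge_mid (vertex T') j = M by exact: edge_mid_eq.
have LK : L (vertex T i) != 0 by rewrite /L L_apex.
have LK' : L (vertex T' j) != 0 by exact: (L'_nz a a' eE).
have inT x : square M (3 * s) x -> elt T x <-> 0 < L x / L (vertex T i).
  move=> xM; rewrite eltP; split=> [|h k]; first by move/(_ i); rewrite bary_L.
  case: (eqVneq k i) => [->|ki]; first by rewrite bary_L.
  by apply: (@near_edge _ _ i _ _ (3 * s)) => //; rewrite mulrA -natrM.
have inT' x : square M (3 * s) x -> elt T' x <-> 0 < L x / L (vertex T' j).
  move=> xM; rewrite eltP; split=> [|h k]; first by move/(_ j); rewrite (bary'_L a eE).
  case: (eqVneq k j) => [->|kj]; first by rewrite (bary'_L a eE).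
  by apply: (@near_edge _ _ j _ _ (3 * s)) => //; rewrite ?Mid'// mulrA -natrM.
have inT0 x : square M (3 * s) x -> 0 <= L x / L (vertex T i) -> tri T x.
  move=> xM h; apply/(triangleP a) => k.
  case: (eqVneq k i) => [->|ki]; first by rewrite bary_L.
  by apply/ltW/(@near_edge _ _ i _ _ (3 * s)) => //; rewrite mulrA -natrM.
have [i0 [k [mu0 [k1 mu0n mule LE nE]]]] := edge_graph i a sp.
(* Were both apexes on the same side, a point slightly off the midpoint, towards the apex of [T],
   would lie in both open elements. *)
have opp : L (vertex T i) * L (vertex T' j) < 0.
  rewrite lt_neqAle mulf_neq0//= leNgt; apply/negP => same.
  pose d := vertex T i - M; pose t := s / (1 + `|d.1| + `|d.2|).
  have D0 : 0 < 1 + `|d.1| + `|d.2|.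
    by have := normr_ge0 d.1; have := normr_ge0 d.2; lra.
  have t0 : 0 < t by rewrite divr_gt0.
  have td : t * (1 + `|d.1| + `|d.2|) = s by rewrite /t; have ? := lt0r_neq0 D0; field.
  have xM : square M (3 * s) (M + t *: d).
    apply/squareP; rewrite !addpE !scalepE ![_ + _ - _]addrAC !subrr !add0r.
    rewrite (normrM t d.1) (normrM t d.2) (gtr0_norm t0); move: td; rewrite !mulrDr mulr1.
    have := mulr_ge0 (ltW t0) (normr_ge0 d.1).
    by have := mulr_ge0 (ltW t0) (normr_ge0 d.2); split; lra.
  have Lx : L (M + t *: d) = t * L (vertex T i).
    have d1 : d.1 = (vertex T i).1 - M.1 by [].
    have d2 : d.2 = (vertex T i).2 - M.2 by [].
    by rewrite /L !L_mid !addpE !scalepE d1 d2 /M /edge_mid /midpoint !scalepE !addpE /=; ring.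
  have h1 : elt T (M + t *: d) by apply/inT => //; rewrite Lx mulfK.
  have h2 : elt T' (M + t *: d).
    apply/inT' => //; rewrite Lx -mulrA pmulr_rgt0// -(pmulr_lgt0 _ (_ : 0 < L (vertex T' j) ^+ 2)).
      by rewrite expr2 mulrA divfK.
    by rewrite exprn_even_gt0.
  exact: elt_disjoint TT' h1 h2.
have [n1 n2] := outer_normalE a eE.
have e0 : 0 < enorm (edge_vec (vertex T) i) by exact: edge_nz.
have sgo : Num.sg (L (vertex T' j)) = - Num.sg (L (vertex T i)).
  move: opp; rewrite mulrC; case: (ltgtP (L (vertex T i)) 0) LK => // h _.
    by rewrite nmulr_llt0// => h'; rewrite gtr0_sg// ltr0_sg// opprK.
  by rewrite pmulr_llt0// => h'; rewrite ltr0_sg// gtr0_sg.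
exists i0, k, (Num.sg (L (vertex T i)) / enorm (edge_vec (vertex T) i) * mu0).
have L0 : enorm (edge_vec (vertex T) i) != 0 by rewrite gt_eqF.
split.
  split=> //; rewrite !normrM normfV normr_sg LK (gtr0_norm e0) mul1r mulrC.
  by rewrite ler_pdivrMr// mul1r.
split.
- by move=> r; rewrite n1 mxE nE mulrA.
- by rewrite n1 n2 -/L sgo mulNr scaleNr.
(* A point of [A] on the side of [T] or on the line of the edge is in [tri T], any other one in
   [tri T']; so the open set [A] lies in the closure of [Omega]. *)
- pose A : set (R * R) := [set x | `|x.1 - M.1| < 3 * s] `&` [set x | `|x.2 - M.2| < 3 * s].
  have oA : open A.
    have cfst : continuous (fun x : R * R => `|x.1 - M.1|).
      move=> x; apply: (@cvg_norm _ R); apply: cvgB; [exact: cvg_fst|exact: cvg_cst].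
    have csnd : continuous (fun x : R * R => `|x.2 - M.2|).
      move=> x; apply: (@cvg_norm _ R); apply: cvgB; [exact: cvg_snd|exact: cvg_cst].
    have o1 : open ((fun x : R * R => `|x.1 - M.1|) @^-1` [set r | r < 3 * s]).
      by apply: open_comp => [x _|]; [exact: cfst|exact: open_lt].
    have o2 : open ((fun x : R * R => `|x.2 - M.2|) @^-1` [set r | r < 3 * s]).
      by apply: open_comp => [x _|]; [exact: csnd|exact: open_lt].
    exact: openI o1 o2.
  apply: (@subset_trans _ A).
    by move=> x /squareP[x1 x2]; split=> /=; lra.
  apply: open_sub_closure oA _ => x [/= /ltW x1 /ltW x2].
  have xM : square M (3 * s) x by apply/squareP.
  have [h|h] := leP 0 (L x / L (vertex T i)).
    by apply: (@tri_closure T); exact: inT0.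
  apply: (@tri_closure T'); apply: interior_subset; apply/inT' => //.
  rewrite -(nmulr_rlt0 _ opp) mulrACA [_ * L x]mulrC.
  move: h; rewrite -[X in X < 0](_ : L x * L (vertex T i) / L (vertex T i) ^+ 2 = _); last first.
    by field.
  rewrite pmulr_llt0 ?invr_gt0 ?exprn_even_gt0// => h.
  by rewrite divff// mulr1.
- have sub x : square M (2 * s) x -> square M (3 * s) x.
    by move=> /squareP[x1 x2]; apply/squareP; split; lra.
  have key x : square M (2 * s) x ->
      (elt T x <-> 0 < - mu0 * L (vertex T i) * shear i0 k M s x) /\
      (elt T' x <-> 0 < - mu0 * L (vertex T' j) * shear i0 k M s x).
    move=> /sub xM; rewrite (inT _ xM) (inT' _ xM) [L x]LE -/M.
    have E (u c v : R) : c != 0 -> (0 < - u * s * v / c) = (0 < - u * c * v).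
      move=> c0; rewrite -(pmulr_rgt0 _ (_ : 0 < c ^+ 2 / s)); last first.
        by rewrite divr_gt0// exprn_even_gt0.
      by congr (_ < _); have ? := lt0r_neq0 sp; field; rewrite c0.
    by rewrite !E.
  have muL : - mu0 * L (vertex T i) != 0 by rewrite mulf_neq0 ?oppr_eq0.
  have opp2 : (- mu0 * L (vertex T i)) * (- mu0 * L (vertex T' j)) < 0.
    rewrite (_ : _ * _ = mu0 ^+ 2 * (L (vertex T i) * L (vertex T' j))); last by ring.
    by rewrite pmulr_rlt0// exprn_even_gt0.
  move: muL opp2 key; move: (- mu0 * L (vertex T i)) (- mu0 * L (vertex T' j)) => u v u0 uv key.
  (* The sign of [u] tells which triangle lies where [shear] is negative. *)
  case: (ltgtP u 0) u0 => // hu _; [left|right] => x xM; have [k1' k2'] := key x xM.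
    have hv : 0 < v by move: uv; rewrite nmulr_rlt0.
    by rewrite k1' k2' (nmulr_rgt0 _ hu) (pmulr_rgt0 _ hv).
  have hv : v < 0 by move: uv; rewrite pmulr_rlt0.
  by rewrite k1' k2' (nmulr_rgt0 _ hv) (pmulr_rgt0 _ hu).
Qed.

(* The bubbles centered at c and at its translates by 2 s along the axes are all
   supported in the square of half side 4 s. *)
Lemma interior_squares T : let s := inball_diam (tri T) / 32 in
  exists c, [/\ square c (4 * s) `<=` elt T & tri T c].
Proof.
have [_ d0] := inball_gt0 T => s; have a := mesh_area2 T.
have [c cE] := centroid_exists a; exists c; split.
  move=> x xc; apply/eltP => k; apply: (@near_centroid _ _ k c x (4 * s)) => //.
  (* The denominator 32 is [8 * 4], as [near_centroid] requires for the half side [4 * s]. *)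
  by rewrite /s /tri; lra.
by apply/(triangleP a) => k; rewrite cE; lra.
Qed.

(** Bounds every element diameter independently of the mesh; the final constant depends on [Omega]
    through this bound. *)
Lemma diam_bounded : exists2 B : R, 0 < B & forall x y, closure Omega x -> closure Omega y ->
  enorm (x - y) <= B.
Proof.
have [_ _ _ [M0 [_ HM]] _] := hO; pose M := `|M0| + 1.
have M1 : 0 < M by rewrite ltr_wpDl.
have OM : closure Omega `<=` (cbox M : set (R * R)).
  have cM : closed (cbox M : set (R * R)).
    by apply: (compact_closed (@norm_hausdorff R (R * R)%type)); exact: compact_cbox.
  move/closure_id: cM => ->; apply: closureS => x Ox.
  have : `|x| <= M by apply: HM => //; rewrite (le_lt_trans (ler_norm M0))// ltrDl.
  rewrite prod_normE/= num_ge_max => /andP[x1 x2].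
  by split; rewrite /= in_itv/= -ler_norml.
exists (4 * M); first by rewrite mulr_gt0.
move=> x y /OM[] /=; rewrite !in_itv/= -!ler_norml => x1 x2.
move=> /OM[] /=; rewrite !in_itv/= -!ler_norml => y1 y2.
apply: le_trans (enorm_le_sum _) _ => /=.
have := ler_normB x.1 y.1; have := ler_normB x.2 y.2; lra.
Qed.

Lemma elt_square T c : tri T c -> elt T `<=` square c (diam (tri T)).
Proof.
move=> Tc x /interior_subset Tx; have := diam_ge Tx Tc.
have [h1 h2] := ler_abs_enorm (x - c) => h.
by apply/squareP; split; [exact: le_trans h1 h|exact: le_trans h2 h].
Qed.

End MeshGeometry.

(** * Matrix valued functions *)

Section MatrixNorms.
Context {R : realType}.
Notation P := (measurableTypeR R * measurableTypeR R)%type.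
Implicit Types (D : set (R * R)).

Lemma frob_ge0 k l (A : 'M[R]_(k, l)) : 0 <= frob A.
Proof. exact: sqrtr_ge0. Qed.

Lemma ler_abs_frob k l (A : 'M[R]_(k, l)) i j : `|A i j| <= frob A.
Proof.
rewrite /frob -sqrtr_sqr ler_wsqrtr// /mdot (bigD1 i)//= (bigD1 j)//= -expr2.
rewrite -addrA lerDl addr_ge0//; apply: sumr_ge0 => a _; first exact: sqr_ge0.
by apply: sumr_ge0 => b _; exact: sqr_ge0.
Qed.

Lemma sum_sqr_le (I : finType) (F : I -> R) : (forall i, 0 <= F i) ->
  \sum_i F i ^+ 2 <= (\sum_i F i) ^+ 2.
Proof.
move=> F0; rewrite expr2 mulr_suml; apply: ler_sum => i _.
rewrite expr2 ler_wpM2l// (bigD1 i)//= lerDl; exact: sumr_ge0.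
Qed.

Lemma frob_le_sum k l (A : 'M[R]_(k, l)) : frob A <= \sum_i \sum_j `|A i j|.
Proof.
have s0 i : 0 <= \sum_j `|A i j| by exact: sumr_ge0.
rewrite -[leRHS]ger0_norm ?sumr_ge0// -sqrtr_sqr ler_wsqrtr//.
apply: le_trans (sum_sqr_le s0); apply: ler_sum => i _.
apply: le_trans (sum_sqr_le _) => //; apply: ler_sum => j _.
by rewrite real_normK ?num_real// expr2.
Qed.

Lemma frobZ k l (c : R) (A : 'M[R]_(k, l)) : frob (c *: A) = `|c| * frob A.
Proof.
rewrite /frob (_ : mdot _ _ = c ^+ 2 * mdot A A); last first.
  rewrite /mdot mulr_sumr; apply: eq_bigr => i _; rewrite mulr_sumr.
  by apply: eq_bigr => j _; rewrite !mxE; ring.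
by rewrite sqrtrM ?sqr_ge0// sqrtr_sqr.
Qed.

Lemma frobN k l (A : 'M[R]_(k, l)) : frob (- A) = frob A.
Proof. by rewrite -scaleN1r frobZ normrN normr1 mul1r. Qed.

Definition L2m D k l (g : R * R -> 'M[R]_(k, l)) := forall i j, L2 D (fun x => g x i j).

Lemma norm0_sum D (I : finType) (F : I -> R * R -> R) : (forall i, L2 D (F i)) ->
  L2 D (fun x => \sum_i F i x) /\
  norm0 D (fun x => \sum_i F i x) <= \sum_i norm0 D (F i).
Proof.
move=> lF; elim: (index_enum I) => [|i s [l ih]].
  have [h _] := Lfun_addr_closed (leb2 R) (lee1n 2 : (1 <= 2%:E)%E).
  have E : (fun x => \sum_(i <- [::]) F i x) \_ D = (0 : P -> R).
    by apply/funext => x; rewrite patchE big_nil; case: ifP.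
  rewrite /L2 /norm0 E big_nil; split => //.
  rewrite (_ : EFin \o _ = cst 0%E)// Lnorm0 ?lexx//.
have E : (fun x => \sum_(i <- i :: s) F i x) = (fun x => F i x + \sum_(i <- s) F i x).
  by apply/funext => x; rewrite big_cons.
rewrite E big_cons; split; first exact: L2D.
by apply: le_trans (norm0D (lF i) l) _; rewrite lerD2l.
Qed.

Lemma L2_norm D g : L2 D g -> L2 D (fun x => `|g x|) /\ norm0 D (fun x => `|g x|) <= norm0 D g.
Proof.
move=> lg; have mg : measurable_fun setT ((fun x => `|g x|) \_ D : P -> R).
  rewrite (_ : _ \_ _ = (fun x => `|(g \_ D) x|)); last first.
    by apply/funext => x; rewrite !patchE; case: ifP; rewrite ?normr0.
  by apply: measurableT_comp => //; exact: L2_measurable lg.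
by split; [apply: L2_le lg _|apply: norm0_le lg _] => // x _; rewrite normr_id.
Qed.

Lemma L2_frob D k l (g : R * R -> 'M[R]_(k, l)) : L2m D g -> L2 D (fun x => frob (g x)).
Proof.
move=> lg; have l2s : L2 D (fun x => \sum_i \sum_j `|g x i j|).
  apply: (norm0_sum _).1 => i; apply: (norm0_sum _).1 => j.
  exact: (L2_norm (lg i j)).1.
apply: L2_le l2s _ => [|x _]; last first.
  rewrite !ger0_norm ?frob_ge0 ?sumr_ge0//; first exact: frob_le_sum.
  by move=> i _; exact: sumr_ge0.
rewrite (_ : _ \_ _ = (fun x => Num.sqrt (\sum_i \sum_j (((fun x => g x i j) \_ D) x) ^+ 2))).
  apply: (@measurableT_comp _ _ _ _ _ _ (Num.sqrt : R -> R)).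
    exact: continuous_measurable_fun (@sqrt_continuous R).
  apply: measurable_sum => i; apply: measurable_sum => j.
  by apply: measurable_funX; exact: L2_measurable (lg i j).
apply/funext => x; rewrite patchE; case: ifPn => xD.
  congr Num.sqrt; apply: eq_bigr => i _; apply: eq_bigr => j _.
  by rewrite patchE xD expr2.
rewrite big1 ?sqrtr0// => i _; rewrite big1// => j _.
by rewrite patchE (negbTE xD) expr0n.
Qed.

Lemma le_norm0m D k l (g : R * R -> 'M[R]_(k, l)) i j : L2m D g ->
  norm0 D (fun x => g x i j) <= norm0m D g.
Proof.
move=> lg; apply: norm0_le; first exact: L2_measurable (lg i j).
  exact: L2_frob.
by move=> x _; rewrite [leRHS]ger0_norm ?frob_ge0// ler_abs_frob.
Qed.

Lemma norm0m_le_sum D k l (g : R * R -> 'M[R]_(k, l)) : L2m D g ->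
  norm0m D g <= \sum_i \sum_j norm0 D (fun x => g x i j).
Proof.
move=> lg.
have h1 i : L2 D (fun x => \sum_j `|g x i j|) /\
    norm0 D (fun x => \sum_j `|g x i j|) <= \sum_j norm0 D (fun x => g x i j).
  have [l1 l2] := norm0_sum (fun j => (L2_norm (lg i j)).1).
  by split => //; apply: le_trans l2 _; apply: ler_sum => j _; exact: (L2_norm (lg i j)).2.
have [l1 l2] := norm0_sum (fun i => (h1 i).1).
apply: (@le_trans _ _ (norm0 D (fun x => \sum_i \sum_j `|g x i j|))).
  apply: norm0_le l1 _; first exact: L2_measurable (L2_frob lg).
  move=> x _; rewrite !ger0_norm ?frob_ge0 ?sumr_ge0//; first exact: frob_le_sum.
  by move=> i _; exact: sumr_ge0.
by apply: le_trans l2 _; apply: ler_sum => i _; exact: (h1 i).2.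
Qed.

Lemma norm0m_le_entries D k l (g : R * R -> 'M[R]_(k, l)) (B : R) : L2m D g ->
  (forall i j, norm0 D (fun x => g x i j) <= B) -> norm0m D g <= (k * l)%:R * B.
Proof.
move=> lg gB; apply: le_trans (norm0m_le_sum lg) _.
apply: (@le_trans _ _ (\sum_(i < k) \sum_(j < l) B)).
  by apply: ler_sum => i _; apply: ler_sum => j _.
by rewrite !sumr_const !card_ord -mulrnA mulr_natl mulnC.
Qed.

Lemma eq_norm0m D k l (f g : R * R -> 'M[R]_(k, l)) : (forall x, D x -> f x = g x) ->
  norm0m D f = norm0m D g.
Proof. by move=> fg; apply: eq_norm0 => x Dx; rewrite fg. Qed.

Lemma L2mD D k l (f g : R * R -> 'M[R]_(k, l)) : L2m D f -> L2m D g ->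
  L2m D (fun x => f x + g x).
Proof. by move=> lf lg i j; apply: eq_L2 (L2D (lf i j) (lg i j)) => x _; rewrite mxE. Qed.

Lemma L2mN D k l (f : R * R -> 'M[R]_(k, l)) : L2m D f -> L2m D (fun x => - f x).
Proof. by move=> lf i j; apply: eq_L2 (L2N (lf i j)) => x _; rewrite mxE. Qed.

Lemma L2mB D k l (f g : R * R -> 'M[R]_(k, l)) : L2m D f -> L2m D g ->
  L2m D (fun x => f x - g x).
Proof. by move=> lf /L2mN; exact: L2mD. Qed.

Lemma norm0mN D k l (f : R * R -> 'M[R]_(k, l)) : norm0m D (fun x => - f x) = norm0m D f.
Proof. by apply: eq_norm0 => x _; rewrite frobN. Qed.

(** Proved entry by entry, at the price of the factor [k * l], which is 2 for vector fields. *)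
Lemma norm0mD D k l (f g : R * R -> 'M[R]_(k, l)) : L2m D f -> L2m D g ->
  norm0m D (fun x => f x + g x) <= (k * l)%:R * (norm0m D f + norm0m D g).
Proof.
move=> lf lg; apply: norm0m_le_entries; first exact: L2mD.
move=> i j; rewrite (@eq_norm0 _ _ _ (fun x => f x i j + g x i j)); last first.
  by move=> x _; rewrite mxE.
apply: le_trans (norm0D (lf i j) (lg i j)) _.
by rewrite lerD// le_norm0m.
Qed.

Lemma norm0mB D k l (f g : R * R -> 'M[R]_(k, l)) : L2m D f -> L2m D g ->
  norm0m D (fun x => f x - g x) <= (k * l)%:R * (norm0m D f + norm0m D g).
Proof. by move=> lf lg; rewrite -(norm0mN D g); exact: norm0mD lf (L2mN lg). Qed.

Lemma norm0m_ge0 D k l (f : R * R -> 'M[R]_(k, l)) : 0 <= norm0m D f.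
Proof. exact: norm0_ge0. Qed.

End MatrixNorms.

(** * Stokes residuals *)

Section TestFields.
Context {R : realType}.
Notation P := (measurableTypeR R * measurableTypeR R)%type.
Implicit Types (Omega : set (R * R)) (phi g h : R * R -> R) (r : 'I_2).

Lemma continuous_cbox_L2 Omega h N : open Omega -> continuous h ->
  (forall x, ~ (cbox N : set (R * R)) x -> h x = 0) -> L2 Omega h.
Proof.
move=> oO ch h0; have [B B0 hB] := continuous_cbox_bounded ch h0.
have h0m : measurable_fun setT (h \_ Omega : P -> R).
  apply/(measurable_restrictT _ (open_measurable_plane oO)).
  by apply: measurable_funTS; exact: continuous_measurable_plane.
pose m := 2 * `|N|; have m0 : 0 <= m by rewrite mulr_ge0.
have Sm : (leb2 R (cbox N) <= (m ^+ 2)%:E)%E.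
  have [N0|N0] := leP 0 N.
    by rewrite leb2_itvX ?lee_fin /m ?ger0_norm//; lra.
  rewrite (_ : cbox N = set0) ?measure0 ?lee_fin ?sqr_ge0// -subset0 => x [].
  by rewrite /= in_itv/= => /andP[? ?]; lra.
have [] := @Lfun2_bounded R (cbox N) B m (h \_ Omega) (measurable_cbox N) m0 Sm h0m => //.
  by move=> x; rewrite patchE; case: ifP => // _; rewrite normr0.
by move=> x nx; rewrite patchE h0// if_same.
Qed.

Lemma H10_test Omega phi : open Omega -> test_fun Omega phi ->
  H10 Omega phi (fun j => 'D_(basis2 j) phi).
Proof.
move=> oO tp; have [N hN] := test_fun_cbox_out tp; split.
- apply: (continuous_cbox_L2 oO (test_fun_continuous tp) (N := N)) => x nx.
  by have [] := hN x nx.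
- move=> i; apply: (continuous_cbox_L2 oO (test_fun_derive_continuous tp) (N := N)) => x nx.
  by have [_] := hN x nx; apply.
- by move=> i; exact: test_fun_weak_partial.
- have n0 (g : R * R -> R) : norm0 Omega (fun x => g x - g x) = 0.
    rewrite /norm0 (_ : EFin \o _ = cst 0%E) ?Lnorm0//.
    by apply/funext => x /=; rewrite patchE subrr if_same.
  exists (fun _ => phi); split=> //.
    by rewrite n0; exact: cvg_cst.
  by move=> i; rewrite n0; exact: cvg_cst.
Qed.

Lemma test_fun0 Omega : test_fun Omega (fun=> 0).
Proof.
have E : [set x : R * R | (0 : R) != 0] = set0 by rewrite -subset0 => x /=; rewrite eqxx.
by split; rewrite ?E ?closure0//; [move=> n; exact: Cn_cst|exact: compact0].
Qed.

Definition test_field phi r : wfield R :=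
  WField (fun x => \col_a ((a == r)%:R * phi x))
         (fun x => \matrix_(a, b) ((a == r)%:R * 'D_(basis2 b) phi x)).

Lemma spaceX_test_field Omega phi r : open Omega -> test_fun Omega phi ->
  spaceX Omega (test_field phi r).
Proof.
move=> oO tp a.
rewrite (_ : (fun x => _) = (fun x => (a == r)%:R * phi x)); last first.
  by apply/funext => x; rewrite mxE.
rewrite (_ : (fun j x => _) = (fun j x => (a == r)%:R * 'D_(basis2 j) phi x)); last first.
  by apply/funext => j; apply/funext => x; rewrite mxE.
have [_|_] := eqVneq a r.
  rewrite (_ : (fun x => _) = phi); last by apply/funext => x; rewrite mul1r.
  rewrite (_ : (fun j x => _) = (fun j => 'D_(basis2 j) phi)); first exact: H10_test.
  by apply/funext => j; apply/funext => x; rewrite mul1r.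
rewrite (_ : (fun x => _) = fun=> 0); last by apply/funext => x; rewrite mul0r.
have := H10_test oO (test_fun0 Omega); congr H10.
by apply/funext => j; apply/funext => x; rewrite mul0r; exact: derive_cst.
Qed.

Lemma L2_mul_test_integrable Omega g h N : open Omega -> L2 Omega g -> continuous h ->
  (forall x, ~ (cbox N : set (R * R)) x -> h x = 0) ->
  (leb2 R).-integrable Omega (EFin \o (fun x => g x * h x)).
Proof.
move=> oO lg ch h0.
have lh : (h : P -> R) \in Lfun (leb2 R) 2%:E.
  have := continuous_cbox_L2 openT ch h0; rewrite /L2 (_ : _ \_ _ = h)//.
  by apply/funext => x; rewrite patchE mem_set.
have ig := L2_mul_integrable lg lh.
apply: (integrable_mkcond _ (open_measurable_plane oO)).2.
rewrite (_ : _ \_ _ = (EFin \o (fun x => (g \_ Omega) x * h x)))//.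
by apply/funext => x /=; rewrite !patchE; case: ifP => //=; rewrite mul0r.
Qed.

Lemma ord2P r : r = 0 \/ r = 1.
Proof. by case: r => [[|[|//]] ?]; [left|right]; exact: val_inj. Qed.

Lemma sum2 (V : nmodType) (F : 'I_2 -> V) : \sum_j F j = F 0 + F 1.
Proof. by rewrite !big_ord_recl big_ord0 addr0; congr (F _ + F _); exact: val_inj. Qed.

(* Testing with phi in the r-th component reduces a Stokes system to scalar
   equations; eps is the sign of the pressure term. *)
Lemma weak_residual_component Omega (U : R * R -> 'M[R]_2) (p : R * R -> R)
    (F : R * R -> 'cV[R]_2) (eps : R) r :
  open Omega -> L2m Omega U -> L2 Omega p ->
  (forall z, spaceX Omega z ->
    ip Omega U (wgrad z) + eps * \int[leb2 R]_(x in Omega) (p x * \tr (wgrad z x)) =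
    ip Omega F z) ->
  weak_residual Omega (fun b x => U x r b + (r == b)%:R * eps * p x) (fun x => F x r 0).
Proof.
move=> oO lU lp h phi tp.
have mO := open_measurable_plane oO.
have [N hN] := test_fun_cbox_out tp.
have := h _ (spaceX_test_field r oO tp).
have -> : ip Omega F (test_field phi r) = \int[leb2 R]_(x in Omega) (F x r 0 * phi x).
  apply: eq_Rintegral => x _; rewrite /mdot (bigD1 r)//= big_ord1 mxE eqxx mul1r.
  by rewrite big1 ?addr0// => i /negbTE ir; rewrite big_ord1 mxE ir mul0r mulr0.
move=> <-.
have ct b := test_fun_derive_continuous (i := b) tp.
have z0 b x : ~ (cbox N : set (R * R)) x -> 'D_(basis2 b) phi x = 0.
  by move=> nx; have [_] := hN x nx; apply.
have iU b := L2_mul_test_integrable oO (lU r b) (ct b) (z0 b).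
have ip' b := L2_mul_test_integrable oO lp (ct b) (z0 b).
have -> : ip Omega U (wgrad (test_field phi r)) =
    \sum_b \int[leb2 R]_(x in Omega) (U x r b * 'D_(basis2 b) phi x).
  rewrite sum2 -RintegralD//; apply: eq_Rintegral => x _.
  by rewrite /mdot !sum2 !mxE; case: (ord2P r) => ->; rewrite !eqxx /=; ring.
have -> : \int[leb2 R]_(x in Omega) (p x * \tr (wgrad (test_field phi r) x)) =
    \int[leb2 R]_(x in Omega) (p x * 'D_(basis2 r) phi x).
  apply: eq_Rintegral => x _; rewrite /mxtrace (bigD1 r)//= mxE eqxx mul1r big1 ?addr0//.
  by move=> i /negbTE ir; rewrite mxE ir mul0r.
have -> : eps * \int[leb2 R]_(x in Omega) (p x * 'D_(basis2 r) phi x) =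
    \sum_b (r == b)%:R * eps * \int[leb2 R]_(x in Omega) (p x * 'D_(basis2 b) phi x).
  rewrite (bigD1 r)//= eqxx mul1r big1 ?addr0// => i /negbTE ir.
  by rewrite eq_sym ir !mul0r.
rewrite -big_split/=; apply: eq_bigr => b _.
rewrite -RintegralZl// -RintegralD//; last first.
  by have := integrableZl mO ((r == b)%:R * eps) (ip' b).
apply: eq_Rintegral => x _; ring.
Qed.

End TestFields.

(** * Affine residuals on an element *)

Section ElementBounds.
Context {R : realType}.
Notation P := (measurableTypeR R * measurableTypeR R)%type.
Implicit Types (Omega : set (R * R)).

Section OnElements.
Variables (Omega : set (R * R)) (m : mesh R) (sigma : R).
Hypotheses (hO : polygonal_domain Omega) (hm : triangulation Omega m)
  (hs : shape_regular sigma m).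
Implicit Types (T : 'I_(ntri m)) (x : R * R).

Lemma leb2_elt_le T : (leb2 R (elt T : set P) <= ((2 * diam (tri T)) ^+ 2)%:E)%E.
Proof.
have [c [_ Tc]] := interior_squares hm hs T.
have h0 := ltW (diam_gt0 hm T).
rewrite -(leb2_square c h0); apply: le_measure; rewrite ?inE.
- exact: measurable_elt.
- exact: measurable_square.
- exact: elt_square.
Qed.

Lemma elt_bounded T (g : R * R -> R) (B : R) : continuous g -> 0 <= B ->
  (forall x, elt T x -> `|g x| <= B) ->
  L2 (elt T) g /\ norm0 (elt T) g <= B * (2 * diam (tri T)).
Proof.
move=> cg B0 gB; apply: norm0_bounded => //.
- exact: measurable_elt.
- by rewrite mulr_ge0// ltW// (diam_gt0 hm).
- exact: leb2_elt_le.
- apply/(measurable_restrictT _ (measurable_elt T)).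
  by apply: measurable_funTS; exact: continuous_measurable_plane.
Qed.

Lemma affn_square (a b d : R) c x (h : R) : square c h x ->
  `|affn a b d x| <= `|affn a b d c| + (`|b| + `|d|) * h.
Proof.
move=> /squareP[x1 x2].
have -> : affn a b d x = affn a b d c + (b * (x.1 - c.1) + d * (x.2 - c.2)).
  by rewrite /affn; ring.
apply: le_trans (ler_normD _ _) _; rewrite lerD2l mulrDl.
by apply: le_trans (ler_normD _ _) _; rewrite !normrM lerD// ler_wpM2l.
Qed.

Lemma L2_affn T (a b d : R) : L2 (elt T) (affn a b d).
Proof.
have [c [_ Tc]] := interior_squares hm hs T.
have h0 := ltW (diam_gt0 hm T).
have [] // := @elt_bounded T (affn a b d) (`|affn a b d c| + (`|b| + `|d|) * diam (tri T)).
- exact: continuous_affn.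
- by rewrite addr_ge0// mulr_ge0// addr_ge0.
- by move=> x /(elt_square Tc); exact: affn_square.
Qed.

Lemma L2_elt T g : L2 Omega g -> L2 (elt T) g.
Proof. by apply: L2S; [exact: measurable_elt|exact: elt_sub]. Qed.

Lemma inball_le_diam T : inball_diam (tri T) <= diam (tri T).
Proof.
have a := mesh_area2 hm T; have e0 := edge_nz a 0.
rewrite -(ler_pM2r e0); apply: le_trans (inball_diam_edge a 0) _.
rewrite -(cross_area2 (vertex T) 0); apply: le_trans (cross_le _ _) _.
rewrite mulrC ler_wpM2r ?enorm_ge0//.
by apply: diam_ge; exact: (vertex_triangle a).
Qed.

End OnElements.

Lemma element_bound Omega (sigma : R) : polygonal_domain Omega ->
  exists2 C : R, 0 < C & forall m, triangulation Omega m -> shape_regular sigma m ->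
  forall (T : 'I_(ntri m)) V (v : 'I_2 -> R) G a b d,
  weak_residual Omega V G -> (forall j, L2 Omega (V j)) -> L2 Omega G ->
  diam (tri T) * norm0 (elt T) (affn a b d) <=
  C * (\sum_j norm0 (elt T) (fun x => V j x - v j) +
       diam (tri T) * norm0 (elt T) (fun x => G x - affn a b d x)).
Proof.
move=> hO; have [C0 C00 hC0] := @interior_residual R.
(* With [h <= 32 * sigma * s], the L2 norm of a bounded function and the factor [h] give
   [2 * (32 * sigma)^2], and each of the two slopes adds [32 * sigma] to the bound. The absolute
   value is there because the sign of [sigma] is only known once there is an element; [+ 1] gives
   positivity. *)
exists (C0 * (2 * (32 * `|sigma|) ^+ 2 * (1 + 64 * `|sigma|)) + 1).
  by rewrite ltr_wpDl// !mulr_ge0 ?addr_ge0 ?mulr_ge0 ?sqr_ge0// ltW.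
move=> m hm hs T V v G a b d VG lV lG.
have [s0 d0] := inball_gt0 hm hs T; rewrite (gtr0_norm s0).
have hp := diam_gt0 hm T; have hsr := hs T; have hdi := inball_le_diam hm T.
set h := diam (tri T) in hp hsr hdi *.
have [s sdef] : {s : R | s = inball_diam (tri T) / 32}.
  by exists (inball_diam (tri T) / 32).
have [c [sqc Tc]] := interior_squares hm hs T; rewrite /= -sdef in sqc.
have sp : 0 < s by rewrite sdef divr_gt0.
have dE : inball_diam (tri T) = 32 * s by rewrite sdef; field.
have sh : s <= h by move: hdi; rewrite dE; lra.
have hss : h <= 32 * sigma * s by move: hsr; rewrite dE; lra.
have lV' j : L2 (elt T) (fun x => V j x - v j).
  apply: L2B; first exact: (L2_elt hO hm).
  by apply: eq_L2 (L2_affn hm hs T (v j) 0 0) => x _; rewrite /affn !mul0r !addr0.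
have lG' : L2 (elt T) (fun x => G x - affn a b d x).
  by apply: L2B; [exact: (L2_elt hO hm)|exact: L2_affn hm hs _ _ _ _].
set E := \sum_j _ + _.
have Ege : \sum_j norm0 (elt T) (fun x => V j x - v j) +
    s * norm0 (elt T) (fun x => G x - affn a b d x) <= E.
  by rewrite lerD2l ler_wpM2r ?norm0_ge0.
have E0 : 0 <= E.
  apply: le_trans Ege; apply: addr_ge0; first by apply: sumr_ge0 => j _; exact: norm0_ge0.
  by apply: mulr_ge0; [exact: ltW|exact: norm0_ge0].
have W M : square M (2 * s) `<=` square c (4 * s) -> s ^+ 2 * `|affn a b d M| <= C0 * E.
  move=> sM; apply: (@le_trans _ _ (C0 * (\sum_j norm0 (elt T) (fun x => V j x - v j) +
    s * norm0 (elt T) (fun x => G x - affn a b d x)))); last by rewrite ler_wpM2l// ltW.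
  apply: (hC0 Omega (elt T)) => //; first exact: (elt_sub hO hm).
  exact: subset_trans sM sqc.
set Y := C0 * E in W; have Y0 : 0 <= Y by rewrite mulr_ge0// ltW.
have W0 : s ^+ 2 * `|affn a b d c| <= Y.
  by apply: W => x /squareP[x1 x2]; apply/squareP; split; lra.
have W1 : s ^+ 2 * `|affn a b d (c.1 + 2 * s, c.2)| <= Y.
  apply: W => x /squareP[/=]; rewrite !ler_norml => /andP[? ?] /andP[? ?].
  by apply/squareP; rewrite !ler_norml; split; apply/andP; split; lra.
have W2 : s ^+ 2 * `|affn a b d (c.1, c.2 + 2 * s)| <= Y.
  apply: W => x /squareP[/=]; rewrite !ler_norml => /andP[? ?] /andP[? ?].
  by apply/squareP; rewrite !ler_norml; split; apply/andP; split; lra.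
(* A slope is a difference of two values over [2 * s], hence one more power of [s] than for the
   values. *)
have slope (u w e : R) : s ^+ 2 * `|u| <= Y -> s ^+ 2 * `|w| <= Y -> w = u + 2 * s * e ->
    s ^+ 3 * `|e| <= Y.
  move=> hu hw wE; have : s ^+ 2 * `|2 * s * e| <= 2 * Y.
    have -> : 2 * s * e = w - u by rewrite wE; ring.
    apply: (@le_trans _ _ (s ^+ 2 * (`|w| + `|u|))).
      by rewrite ler_wpM2l ?sqr_ge0// ler_normB.
    by rewrite mulrDr; lra.
  rewrite !normrM (gtr0_norm sp) ger0_norm// => h2.
  have -> : s ^+ 3 * `|e| = (s ^+ 2 * (2 * s * `|e|)) / 2 by field.
  lra.
have Sb : s ^+ 3 * `|b| <= Y by apply: slope W0 W1 _; rewrite /affn /=; ring.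
have Sd : s ^+ 3 * `|d| <= Y by apply: slope W0 W2 _; rewrite /affn /=; ring.
set X := Y * (1 + 64 * sigma) / s ^+ 2.
have X0 : 0 <= X by rewrite divr_ge0 ?sqr_ge0// mulr_ge0// addr_ge0// mulr_ge0// ltW.
have bX x : elt T x -> `|affn a b d x| <= X.
  move=> /(elt_square Tc) /(affn_square a b d) hx; apply: (le_trans hx).
  rewrite /X ler_pdivlMr ?exprn_gt0// mulrC mulrDr [leRHS]mulrDr mulr1 lerD//.
  apply: (@le_trans _ _ (s ^+ 2 * ((`|b| + `|d|) * (32 * sigma * s)))).
    by rewrite ler_wpM2l ?sqr_ge0// ler_wpM2l// addr_ge0.
  have -> : s ^+ 2 * ((`|b| + `|d|) * (32 * sigma * s)) =
     32 * sigma * (s ^+ 3 * `|b| + s ^+ 3 * `|d|) by ring.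
  have -> : Y * (64 * sigma) = 32 * sigma * (Y + Y) by ring.
  by rewrite ler_wpM2l ?lerD// mulr_ge0// ltW.
have [_ nX] := elt_bounded hm hs (@continuous_affn _ a b d) X0 bX.
apply: (@le_trans _ _ (h * (X * (2 * h)))).
  by rewrite ler_wpM2l// ?(ltW hp)//; exact: nX.
have -> : h * (X * (2 * h)) = 2 * h ^+ 2 * X by ring.
apply: (@le_trans _ _ (2 * (32 * sigma * s) ^+ 2 * X)).
  rewrite ler_wpM2r// ler_wpM2l// lerXn2r ?nnegrE ?(ltW hp)//.
  by rewrite !mulr_ge0// ltW.
have -> : 2 * (32 * sigma * s) ^+ 2 * X = C0 * (2 * (32 * sigma) ^+ 2 * (1 + 64 * sigma)) * E.
  by rewrite /X /Y; have ? := lt0r_neq0 sp; field.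
by rewrite ler_wpM2r// lerDl.
Qed.

End ElementBounds.

(** * Residuals of a Stokes system *)

Section VectorResiduals.
Context {R : realType}.
Implicit Types (Omega : set (R * R)).

(* Both Stokes systems have this form: eps = -1 for the state equation and
   eps = 1 for the adjoint one. *)
Definition stokes_residual Omega (U : R * R -> 'M[R]_2) (p : R * R -> R) (eps : R)
    (F : R * R -> 'cV[R]_2) :=
  [/\ L2m Omega U, L2 Omega p, L2m Omega F, `|eps| <= 1 &
    forall z, spaceX Omega z ->
      ip Omega U (wgrad z) + eps * \int[leb2 R]_(x in Omega) (p x * \tr (wgrad z x)) =
      ip Omega F z].

Definition stokes_flux (U : R * R -> 'M[R]_2) (p : R * R -> R) (eps : R) (r b : 'I_2)
    (x : R * R) : R := U x r b + (r == b)%:R * eps * p x.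

(** The affine function [w] is left free: it will be the discrete source with the data replaced by a
    constant, over which the infimum is taken at the very end. *)
Definition element_error (m : mesh R) (T : 'I_(ntri m)) (U : R * R -> 'M[R]_2)
    (p : R * R -> R) (F : R * R -> 'cV[R]_2) (A : 'M[R]_2) (ph : R) (w : affine R) : R :=
  norm0m (elt T) (fun x => U x - A) + norm0 (elt T) (fun x => p x - ph) +
  diam (tri T) * norm0m (elt T) (fun x => F x - aval w x).

Lemma avalE (w : affine R) r : (fun x => aval w x r 0) = affn (w.2 r 0) (w.1 r 0) (w.1 r 1).
Proof.
apply/funext => x; rewrite /aval /affn !mxE sum2 !mxE /=; ring.
Qed.

Section Elements.
Variables (Omega : set (R * R)) (m : mesh R) (sigma : R).
Hypotheses (hO : polygonal_domain Omega) (hm : triangulation Omega m)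
  (hs : shape_regular sigma m).
Variables (U : R * R -> 'M[R]_2) (p : R * R -> R) (eps : R) (F : R * R -> 'cV[R]_2).
Hypothesis (hr : stokes_residual Omega U p eps F).
Implicit Types (T : 'I_(ntri m)).

Local Notation V := (stokes_flux U p eps).

Lemma stokes_component r : weak_residual Omega (V r) (fun x => F x r 0).
Proof.
have [lU lp lF _ h] := hr; have [oO _ _ _ _] := hO.
exact: weak_residual_component oO lU lp h.
Qed.

Lemma L2_component r b : L2 Omega (V r b).
Proof. by have [lU lp lF _ h] := hr; apply: L2D => //; exact: L2Z. Qed.

Lemma L2_elt_cst T (c : R) : L2 (elt T) (fun=> c).
Proof. by apply: eq_L2 (L2_affn hm hs T c 0 0) => x _; rewrite /affn !mul0r !addr0. Qed.

Lemma L2m_elt T k l (g : R * R -> 'M[R]_(k, l)) : L2m Omega g -> L2m (elt T) g.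
Proof. by move=> lg i j; exact: (L2_elt hO hm _ (lg i j)). Qed.

Lemma L2m_aval T (w : affine R) : L2m (elt T) (aval w).
Proof. by move=> i j; rewrite (ord1 j) avalE; exact: L2_affn hm hs _ _ _ _. Qed.

Lemma L2m_cst T k l (A : 'M[R]_(k, l)) : L2m (elt T) (fun=> A).
Proof. by move=> i j; exact: L2_elt_cst. Qed.

Lemma component_error T (A : 'M[R]_2) (ph : R) r b :
  L2 (elt T) (fun x => V r b x - (A r b + (r == b)%:R * eps * ph)) /\
  norm0 (elt T) (fun x => V r b x - (A r b + (r == b)%:R * eps * ph)) <=
  norm0m (elt T) (fun x => U x - A) + norm0 (elt T) (fun x => p x - ph).
Proof.
have [lU lp lF e1 h] := hr.
have lUA : L2m (elt T) (fun x => U x - A) by apply: L2mB; [exact: L2m_elt|exact: L2m_cst].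
have lpp : L2 (elt T) (fun x => p x - ph).
  by apply: L2B; [exact: (L2_elt hO hm)|exact: L2_elt_cst].
have c1 : `|(r == b)%:R * eps| <= 1.
  by rewrite normrM; case: (r == b); rewrite ?normr0 ?normr1 ?mul0r ?mul1r.
have E : (fun x => V r b x - (A r b + (r == b)%:R * eps * ph)) =
  (fun x => (U x - A) r b + ((r == b)%:R * eps) * (p x - ph)).
  by apply/funext => x; rewrite !mxE /stokes_flux; ring.
have lc := L2Z ((r == b)%:R * eps) lpp.
rewrite E; split; first exact: L2D (lUA r b) lc.
apply: le_trans (norm0D (lUA r b) lc) _; apply: lerD; first exact: le_norm0m.
apply: norm0_le lpp _; first exact: L2_measurable lc.
by move=> x _; rewrite normrM ler_piMl.
Qed.

Lemma component_data_error T (w : affine R) r :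
  norm0 (elt T) (fun x => F x r 0 - affn (w.2 r 0) (w.1 r 0) (w.1 r 1) x) <=
  norm0m (elt T) (fun x => F x - aval w x).
Proof.
have [lU lp lF e1 h] := hr.
have lFw : L2m (elt T) (fun x => F x - aval w x) by apply: L2mB; [exact: L2m_elt|exact: L2m_aval].
rewrite -avalE; apply: le_trans (le_norm0m r 0 lFw).
by rewrite (@eq_norm0 _ _ _ (fun x => (F x - aval w x) r 0))// => x _; rewrite !mxE.
Qed.

Lemma element_error_ge0 T (A : 'M[R]_2) (ph : R) (w : affine R) : 0 <= element_error T U p F A ph w.
Proof.
have h0 := ltW (diam_gt0 hm T).
apply: addr_ge0; last by apply: mulr_ge0 => //; exact: norm0m_ge0.
by apply: addr_ge0; [exact: norm0m_ge0|exact: norm0_ge0].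
Qed.

Lemma sum_component_error T (A : 'M[R]_2) (ph : R) (w : affine R) r :
  \sum_b norm0 (elt T) (fun x => V r b x - (A r b + (r == b)%:R * eps * ph)) +
  diam (tri T) * norm0 (elt T) (fun x => F x r 0 - affn (w.2 r 0) (w.1 r 0) (w.1 r 1) x) <=
  2 * element_error T U p F A ph w.
Proof.
have h0 := ltW (diam_gt0 hm T).
have := ler_wpM2l h0 (component_data_error T w r).
have := (component_error T A ph r 0).2; have := (component_error T A ph r 1).2.
have := norm0m_ge0 (elt T) (fun x => F x - aval w x) => n0.
have := mulr_ge0 h0 n0; rewrite /element_error sum2; lra.
Qed.

End Elements.

(** The edge estimate rests on the element estimate: the source enters it with its full norm, split
    into [F - w] and [w], and [w] is what the element estimate controls. *)
Lemma stokes_efficiency Omega (sigma : R) : polygonal_domain Omega ->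
  exists2 C : R, 0 < C & forall m, triangulation Omega m -> shape_regular sigma m ->
  forall U p eps F (A : 'I_(ntri m) -> 'M[R]_2) (ph : 'I_(ntri m) -> R),
  stokes_residual Omega U p eps F ->
  (forall T (w : affine R), diam (tri T) * norm0m (elt T) (aval w) <=
    C * element_error T U p F (A T) (ph T) w) /\
  (forall T i T' j (w w' : affine R), interior_edge T i T' j ->
    edge_len (vertex T) i * frob ((A T + (eps * ph T)%:M) *m outer_normal (vertex T) i +
       (A T' + (eps * ph T')%:M) *m outer_normal (vertex T') j) <=
    C * (element_error T U p F (A T) (ph T) w + element_error T' U p F (A T') (ph T') w')).
Proof.
move=> hO; have [C1 C10 hC1] := element_bound sigma hO.
have [C2 C20 hC2] := @edge_residual R.
(* A scalar error is at most twice [element_error], and two components are summed: hence the factors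
   4. The edge length is [24 * sigma] times the bubble size; [1 + C1] pays for [F - w] and [w]. *)
exists (4 * C1 + 4 * C2 * (24 * `|sigma| + 1 + C1)).
  have := normr_ge0 sigma => sg0.
  by rewrite addr_gt0// ?mulr_gt0// addr_gt0// ltr_wpDl// mulr_ge0.
move=> m hm hs U p eps F A ph hr.
have [lU lp lF e1 _] := hr.
have comp T (w : affine R) r := hC1 m hm hs T _
  (fun b => A T r b + (r == b)%:R * eps * ph T) _ (w.2 r 0) (w.1 r 0) (w.1 r 1)
  (stokes_component hO hr r) (L2_component hr r) (lF r 0).
have err0 T (w : affine R) := element_error_ge0 hm U p F T (A T) (ph T) w.
have compw T (w : affine R) r : diam (tri T) * norm0 (elt T) (affn (w.2 r 0) (w.1 r 0) (w.1 r 1))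
    <= 2 * C1 * element_error T U p F (A T) (ph T) w.
  apply: le_trans (comp T w r) _; rewrite [2 * C1]mulrC -mulrA ler_wpM2l ?(ltW C10)//.
  exact: (sum_component_error hO hm hs hr).
have R0 : 0 <= 4 * C2 * (24 * `|sigma| + 1 + C1).
  by rewrite !mulr_ge0 ?addr_ge0 ?mulr_ge0// ltW.
split=> [T w|T i T' j w w' hTT'].
  have h0 := ltW (diam_gt0 hm T).
  apply: (@le_trans _ _ (4 * C1 * element_error T U p F (A T) (ph T) w)); last first.
    by rewrite ler_wpM2r// lerDl.
  apply: (@le_trans _ _ (diam (tri T) * \sum_r norm0 (elt T) (affn (w.2 r 0) (w.1 r 0) (w.1 r 1)))).
    rewrite ler_wpM2l//; apply: le_trans (norm0m_le_sum (L2m_aval hm hs T w)) _.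
    by apply: ler_sum => r _; rewrite big_ord1 avalE.
  rewrite sum2 mulrDr; have := compw T w 0; have := compw T w 1; lra.
have [s0 _] := inball_gt0 hm hs T; rewrite (gtr0_norm s0).
have [i0 [k [mu [[sp k1 mu1] [nE n'E sqO sides]]]]] := edge_patch hO hm hs hTT'.
set he := edge_len (vertex T) i in sp sides sqO *.
set s := he / (24 * sigma) in sp sides sqO.
have heE : he = 24 * sigma * s.
  by rewrite /s mulrCA mulfV ?mulr1// mulf_neq0// gt_eqF.
have hT : he <= diam (tri T) by exact: edge_diam (mesh_area2 hm T) i.
have hT' : he <= diam (tri T').
  rewrite /he -(edge_len_eq (mesh_area2 hm T) hTT'.2).
  exact: edge_diam (mesh_area2 hm T') j.
set J := _ + _ : 'cV[R]_2.
set Delta := fun r => \sum_b nu i0 k b * ((A T r b + (r == b)%:R * eps * ph T) -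
   (A T' r b + (r == b)%:R * eps * ph T')).
have JE r : `|J r 0| <= `|Delta r|.
  have -> : J r 0 = mu * Delta r.
    rewrite /J n'E mulmxN -mulmxBl mxE /Delta mulr_sumr; apply: eq_bigr => b _.
    by rewrite nE !mxE; case: (r == b); rewrite /= ?mulr1n ?mulr0n; ring.
  by rewrite normrM ler_piMl.
set ET := element_error T U p F (A T) (ph T) w.
set ET' := element_error T' U p F (A T') (ph T') w'.
have ET0 : 0 <= ET := err0 T w; have ET'0 : 0 <= ET' := err0 T' w'.
have key r : he * `|Delta r| <= 2 * C2 * (24 * sigma + 1 + C1) * (ET + ET').
  have rhs (S : 'I_(ntri m)) (z : affine R) : he <= diam (tri S) ->
      24 * sigma * (\sum_b norm0 (elt S) (fun x => stokes_flux U p eps r b x -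
          (A S r b + (r == b)%:R * eps * ph S)) +
        s * norm0 (elt S) (fun x => F x r 0)) <=
      2 * (24 * sigma + 1 + C1) * element_error S U p F (A S) (ph S) z.
    move=> hS; have := sum_component_error hO hm hs hr S (A S) (ph S) z r.
    have hS0 := ltW (diam_gt0 hm S).
    set W := affn (z.2 r 0) (z.1 r 0) (z.1 r 1); set SV := \sum_b _.
    have lW : L2 (elt S) W by exact: L2_affn hm hs _ _ _ _.
    have lFr : L2 (elt S) (fun x => F x r 0) by exact: (L2_elt hO hm _ (lF r 0)).
    have nF : norm0 (elt S) (fun x => F x r 0) <=
        norm0 (elt S) (fun x => F x r 0 - W x) + norm0 (elt S) W.
      rewrite (@eq_norm0 _ _ _ (fun x => (F x r 0 - W x) + W x)); last by move=> x _; rewrite subrK.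
      exact: norm0D (L2B lFr lW) lW.
    have nFh : he * norm0 (elt S) (fun x => F x r 0) <=
        diam (tri S) * norm0 (elt S) (fun x => F x r 0 - W x) + diam (tri S) * norm0 (elt S) W.
      rewrite -mulrDr; apply: ler_pM => //; [exact: ltW (edge_nz (mesh_area2 hm T) i)|exact: norm0_ge0].
    have SV0 : 0 <= SV by apply: sumr_ge0 => b _; exact: norm0_ge0.
    have d0 : 0 <= diam (tri S) * norm0 (elt S) (fun x => F x r 0 - W x).
      by rewrite mulr_ge0// norm0_ge0.
    have := compw S z r; rewrite -/W.
    move: nFh d0 SV0; rewrite heE.
    move: (norm0 _ (fun x => F x r 0)) (diam _ * norm0 _ (fun x => F x r 0 - W x))
      (diam _ * norm0 _ W) (element_error _ _ _ _ _ _ _) SV => a1 a2 a3 a4 a5 h1 h2 h3 h4 h5.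
    rewrite [leLHS](_ : _ = 24 * sigma * a5 + 24 * sigma * s * a1); last by ring.
    rewrite [leRHS](_ : _ = 24 * sigma * (2 * a4) + 2 * a4 + 2 * C1 * a4); last by ring.
    have : 24 * sigma * a5 <= 24 * sigma * (2 * a4).
      by rewrite ler_wpM2l ?mulr_ge0 ?(ltW s0)//; lra.
    lra.
  have l1 (S : 'I_(ntri m)) b := (component_error hO hm hs hr S (A S) (ph S) r b).1.
  have bound : s * `|Delta r| <= C2 *
     ((\sum_b norm0 (elt T) (fun x => stokes_flux U p eps r b x -
         (A T r b + (r == b)%:R * eps * ph T)) + s * norm0 (elt T) (fun x => F x r 0)) +
      (\sum_b norm0 (elt T') (fun x => stokes_flux U p eps r b x -
         (A T' r b + (r == b)%:R * eps * ph T')) + s * norm0 (elt T') (fun x => F x r 0))).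
    have sub (S : 'I_(ntri m)) := elt_sub hO hm (T:=S).
    have lFr (S : 'I_(ntri m)) : L2 (elt S) (fun x => F x r 0) by exact: (L2_elt hO hm _ (lF r 0)).
    case: sides => sides.
      apply: (hC2 Omega (elt T) (elt T') (stokes_flux U p eps r)
        (fun b => A T r b + (r == b)%:R * eps * ph T)
        (fun b => A T' r b + (r == b)%:R * eps * ph T')
        (fun x => F x r 0) i0 k (edge_mid (vertex T) i) s) => //.
      - by move=> x /sides[].
      - by move=> x /sides[].
      - exact: (stokes_component hO hr).
      - exact: (L2_component hr).
    (* With [T'] on the negative side the roles are exchanged, which only changes the sign of the
       jump. *)
    rewrite [X in C2 * X]addrC.
    have -> : `|Delta r| = `|\sum_b nu i0 k b * ((A T' r b + (r == b)%:R * eps * ph T') -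
         (A T r b + (r == b)%:R * eps * ph T))|.
      by rewrite -normrN /Delta -sumrN; congr `|_|; apply: eq_bigr => b _; ring.
    apply: (hC2 Omega (elt T') (elt T) (stokes_flux U p eps r)
        (fun b => A T' r b + (r == b)%:R * eps * ph T')
        (fun b => A T r b + (r == b)%:R * eps * ph T)
        (fun x => F x r 0) i0 k (edge_mid (vertex T) i) s) => //.
    - by move=> x /sides[].
    - by move=> x /sides[].
    - exact: (stokes_component hO hr).
    - exact: (L2_component hr).
  have c24 : 0 <= 24 * sigma by rewrite mulr_ge0// ltW.
  have := ler_wpM2l c24 bound; rewrite mulrA -heE => h; apply: (le_trans h).
  rewrite mulrCA mulrDr [leRHS](_ : _ = C2 * (2 * (24 * sigma + 1 + C1) * ET +
     2 * (24 * sigma + 1 + C1) * ET')); last by ring.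
  by rewrite ler_wpM2l ?(ltW C20)// lerD// rhs.
apply: (@le_trans _ _ (4 * C2 * (24 * sigma + 1 + C1) * (ET + ET'))); last first.
  by apply: ler_wpM2r; [exact: addr_ge0|rewrite lerDr mulr_ge0// ltW].
have he0 : 0 <= he by exact: ltW (edge_nz (mesh_area2 hm T) i).
apply: (@le_trans _ _ (he * (`|Delta 0| + `|Delta 1|))).
  rewrite ler_wpM2l//; apply: le_trans (frob_le_sum _) _.
  by rewrite sum2 !big_ord1 lerD.
rewrite mulrDr; have := key 0; have := key 1; lra.
Qed.

End VectorResiduals.

(** * Efficiency *)

Section Efficiency.
Context {R : realType}.
Implicit Types (Omega : set (R * R)).

(** Discrete gradients and pressures are constant on elements, so a jump is constant on the edge,
    and its L2 norm there contributes a second square root of the edge length. *)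
Lemma edge_norm0_cst (K : 'I_3 -> R * R) i (v : 'cV[R]_2) :
  edge_norm0 K i (fun=> Num.sqrt (edge_len K i) *: v) = edge_len K i * frob v.
Proof.
have l0 : 0 <= edge_len K i by exact: enorm_ge0.
rewrite /edge_norm0 Rintegral_cst; last exact: measurable_itv.
have -> : fine (@lebesgue_measure R `[0, 1]) = 1.
  by rewrite lebesgue_measure_itv /= lte_fin ltr01 sube0.
rewrite mulr1 frobZ exprMn real_normK ?num_real// sqr_sqrtr//.
rewrite (_ : _ * _ * _ = (edge_len K i * frob v) ^+ 2); last by ring.
by rewrite sqrtr_sqr ger0_norm// mulr_ge0// frob_ge0.
Qed.

(** A bound valid for every constant passes to the infimum, so no minimizer has to be exhibited. *)
Lemma osc_le (m : mesh R) (g : R * R -> 'cV[R]_2) (T : 'I_(ntri m)) (X K a b : R) :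
  0 < K -> 0 < diam (tri T) ->
  (forall c, X <= K * (a + diam (tri T) * norm0m (elt T) (fun x => g x - c) + b)) ->
  X <= K * (a + osc g T + b).
Proof.
move=> K0 h0 hX; rewrite /osc -ler_pdivrMl// -lerBlDr -lerBlDl -ler_pdivrMl//.
apply: lb_le_inf; first by exists (norm0m (elt T) (fun x => g x - 0)), 0.
move=> _ [c _ <-]; rewrite ler_pdivrMl// lerBlDl lerBlDr ler_pdivrMl//.
Qed.

Lemma L2v_L2m Omega (g : R * R -> 'cV[R]_2) : L2v Omega g -> L2m Omega g.
Proof. by move=> lg i j; rewrite (ord1 j); exact: lg. Qed.

Lemma spaceX_L2 Omega (v : wfield R) : spaceX Omega v -> L2m Omega v /\ L2m Omega (wgrad v).
Proof.
move=> Xv; split; first by apply: L2v_L2m => i; have [] := Xv i.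
by move=> i j; have [_ + _ _] := Xv i; apply.
Qed.

Lemma ipC Omega k l (g h : R * R -> 'M[R]_(k, l)) : ip Omega g h = ip Omega h g.
Proof.
apply: eq_Rintegral => x _; apply: eq_bigr => i _; apply: eq_bigr => j _.
exact: mulrC.
Qed.

Lemma diam_tri_le Omega (m : mesh R) (B : R) (T : 'I_(ntri m)) : triangulation Omega m ->
  (forall x y, closure Omega x -> closure Omega y -> enorm (x - y) <= B) ->
  diam (tri T) <= B.
Proof.
by move=> hm hB; apply: (diam_le (mesh_area2 hm T)) => x y Tx Ty; apply: hB;
  apply: (tri_closure hm (T:=T)).
Qed.

End Efficiency.

Theorem theorem4p7 (R : realType) (Omega : set (R * R)) (lambda sigma : R) :
  polygonal_domain Omega -> 0 < lambda ->
  exists C : R, 0 < C /\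
  forall (m : mesh R) (f ud : R * R -> 'cV[R]_2) (ya yb : 'I_2 -> \bar R)
    (u phi : wfield R) (p r : R * R -> R) (y : R * R -> 'cV[R]_2)
    (uh phih : 'I_(ntri m) -> affine R) (ph rh : 'I_(ntri m) -> R)
    (yh Piphih : 'I_(ntri m) -> 'cV[R]_2),
  triangulation Omega m -> shape_regular sigma m ->
  L2v Omega f -> L2v Omega ud -> (forall i, (ya i < yb i)%E) ->
  continuous_solution Omega lambda f ud ya yb u p phi r y ->
  discrete_solution Omega lambda f ud ya yb uh ph phih rh yh ->
  L2_projection Omega (pw1 phih) Piphih ->
  let state_error T :=
    norm0m (elt T) (wgrad u \- gradh uh) + norm0 (elt T) (p \- pw0 ph)
    + osc f T + norm0m (elt T) (y \- pw0 yh) in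
  let adjoint_error T :=
    norm0m (elt T) (u \- pw1 uh) + norm0m (elt T) (wgrad phi \- gradh phih)
    + norm0 (elt T) (r \- pw0 rh) + osc ud T in
  (forall T : 'I_(ntri m),
    [/\ diam (tri T) * norm0m (elt T) (f \+ pw0 yh) <= C * state_error T,
        diam (tri T) * norm0m (elt T) (pw1 uh \- ud) <= C * adjoint_error T &
        norm0m (elt T) (pw1 phih \- pw0 Piphih) <=
          C * (norm0m (elt T) (pw1 phih \- phi)
               + norm0m (elt T) (phi \- pw0 Piphih))]) /\
  (forall (T T' : 'I_(ntri m)) (i j : 'I_3), interior_edge T i T' j ->
    let he := edge_len (vertex T) i in
    edge_norm0 (vertex T) i (fun x => Num.sqrt he *:
        jump T i T' j (fun K _ => (ph K)%:M - agrad (uh K)) x)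
      <= C * (state_error T + state_error T') /\
    edge_norm0 (vertex T) i (fun x => Num.sqrt he *:
        jump T i T' j (fun K _ => (rh K)%:M + agrad (phih K)) x)
      <= C * (adjoint_error T + adjoint_error T')).
Proof.
move=> hO _; have [C0 C00 hC] := stokes_efficiency sigma hO.
have [B B0 hB] := diam_bounded hO.
(* The source error splits in two with the factor 2 of [norm0mD]. The diameter in front of [y - y_h]
   or [u - u_h] is absorbed by [B]; the one in front of the data is kept for the oscillation. *)
pose K := 2 + 2 * B; have K2 : 2 <= K by rewrite lerDl mulr_ge0// ltW.
have K0 : 0 < K by lra.
have CK0 : 0 < C0 * K by exact: mulr_gt0.
(* The residual is recovered from [w] and the data minus a constant, again with the factor 2:
   [2 * (C0 * K)] is for [w] and 2 for the data. This last 2 also suffices for the projection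
   estimate. *)
pose C := 2 * (C0 * K) + 2; have C_gt0 : 0 < C by rewrite /C; lra.
have C2 : 2 <= C by rewrite /C; lra.
exists C; split=> //.
move=> m f ud ya yb u phi p r y uh phih ph rh yh Piphih hm hs lf lud _ sol _ _.
have [[Xu [lp _] Xphi [lr _] [ly _]] [eqs _ eqa _ _]] := sol.
have [lu lgu] := spaceX_L2 Xu; have [lphi lgphi] := spaceX_L2 Xphi.
have lfm := L2v_L2m lf; have ludm := L2v_L2m lud; have lym := L2v_L2m ly.
move=> state_error adjoint_error.
have res_s : stokes_residual Omega (wgrad u) p (- 1) (y \+ f).
  split=> //; [exact: L2mD|by rewrite normrN normr1|].
  by move=> z Xz; rewrite mulN1r; exact: eqs.
have res_a : stokes_residual Omega (wgrad phi) r 1 (u \- ud).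
  split=> //; [exact: L2mB|by rewrite normr1|].
  by move=> z Xz; rewrite mul1r ipC -eqa// /form_b opprK.
have [els eds] := hC m hm hs _ _ _ _ (fun T => agrad (uh T)) ph res_s.
have [ela eda] := hC m hm hs _ _ _ _ (fun T => agrad (phih T)) rh res_a.
have L2e (T : 'I_(ntri m)) k l (g : R * R -> 'M[R]_(k, l)) : L2m Omega g -> L2m (elt T) g.
  exact: (L2m_elt hO hm).
have L2c (T : 'I_(ntri m)) k l (A : 'M[R]_(k, l)) : L2m (elt T) (fun=> A) by exact: (L2m_cst hm hs).
have L2a (T : 'I_(ntri m)) (w : affine R) : L2m (elt T) (aval w) by exact: (L2m_aval hm hs).
have hB' (T : 'I_(ntri m)) : diam (tri T) <= B by exact: diam_tri_le hm hB.
have h0 (T : 'I_(ntri m)) := diam_gt0 hm T.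
have hbound (T : 'I_(ntri m)) (X : R) : 0 <= X -> diam (tri T) * X <= B * X.
  by move=> X0; rewrite ler_wpM2r.
have E_gu (T : 'I_(ntri m)) : norm0m (elt T) (wgrad u \- gradh uh) =
    norm0m (elt T) (fun x => wgrad u x - agrad (uh T)).
  by apply: eq_norm0m => x Tx; rewrite /= /gradh (pw_elt hm _ Tx).
have E_gphi (T : 'I_(ntri m)) : norm0m (elt T) (wgrad phi \- gradh phih) =
    norm0m (elt T) (fun x => wgrad phi x - agrad (phih T)).
  by apply: eq_norm0m => x Tx; rewrite /= /gradh (pw_elt hm _ Tx).
have E_p (T : 'I_(ntri m)) : norm0 (elt T) (p \- pw0 ph) = norm0 (elt T) (fun x => p x - ph T).
  by apply: eq_norm0 => x Tx; rewrite /= /pw0 (pw_elt hm _ Tx).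
have E_r (T : 'I_(ntri m)) : norm0 (elt T) (r \- pw0 rh) = norm0 (elt T) (fun x => r x - rh T).
  by apply: eq_norm0 => x Tx; rewrite /= /pw0 (pw_elt hm _ Tx).
have E_y (T : 'I_(ntri m)) : norm0m (elt T) (y \- pw0 yh) = norm0m (elt T) (fun x => y x - yh T).
  by apply: eq_norm0m => x Tx; rewrite /= /pw0 (pw_elt hm _ Tx).
have E_u (T : 'I_(ntri m)) : norm0m (elt T) (u \- pw1 uh) = norm0m (elt T) (fun x => u x - aval (uh T) x).
  by apply: eq_norm0m => x Tx; rewrite /= /pw1 (pw_elt hm _ Tx).
have l_y (T : 'I_(ntri m)) : L2m (elt T) (fun x => y x - yh T).
  by apply: L2mB; [exact: L2e|exact: L2c].
have l_f (T : 'I_(ntri m)) c : L2m (elt T) (fun x => f x - c).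
  by apply: L2mB; [exact: L2e|exact: L2c].
have l_ud (T : 'I_(ntri m)) c : L2m (elt T) (fun x => ud x - c).
  by apply: L2mB; [exact: L2e|exact: L2c].
have l_u (T : 'I_(ntri m)) : L2m (elt T) (fun x => u x - aval (uh T) x).
  by apply: L2mB; [exact: L2e|exact: L2a].
have l_p1 (T : 'I_(ntri m)) : L2m (elt T) (fun x => aval (phih T) x - phi x).
  by apply: L2mB; [exact: L2a|exact: L2e].
have l_p2 (T : 'I_(ntri m)) : L2m (elt T) (fun x => phi x - Piphih T).
  by apply: L2mB; [exact: L2e|exact: L2c].
(* The state residual is constant on [T], but [wa] is genuinely affine because the discrete velocity
   is; this dictates the generality of the element estimate. *)
pose ws (T : 'I_(ntri m)) c : affine R := (0, c + yh T).
pose wa (T : 'I_(ntri m)) c : affine R := ((uh T).1, (uh T).2 - c).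
have wsE (T : 'I_(ntri m)) c x : aval (ws T c) x = c + yh T by rewrite /aval mul0mx add0r.
have waE (T : 'I_(ntri m)) c x : aval (wa T c) x = aval (uh T) x - c by rewrite /aval addrA.
(* The errors with the oscillation evaluated at an arbitrary constant. *)
pose serr (T : 'I_(ntri m)) c := norm0m (elt T) (wgrad u \- gradh uh) + norm0 (elt T) (p \- pw0 ph)
    + diam (tri T) * norm0m (elt T) (fun x => f x - c) + norm0m (elt T) (y \- pw0 yh).
pose aerr (T : 'I_(ntri m)) c := norm0m (elt T) (u \- pw1 uh) + norm0m (elt T) (wgrad phi \- gradh phih)
    + norm0 (elt T) (r \- pw0 rh) + diam (tri T) * norm0m (elt T) (fun x => ud x - c).
have n0 (T : 'I_(ntri m)) k l (g : R * R -> 'M[R]_(k, l)) : 0 <= norm0m (elt T) g by exact: norm0m_ge0.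
have hn0 (T : 'I_(ntri m)) k l (g : R * R -> 'M[R]_(k, l)) : 0 <= diam (tri T) * norm0m (elt T) g.
  by rewrite mulr_ge0// ltW.
have Kbig (x1 x2 x3 x4 : R) : 0 <= x1 -> 0 <= x2 -> 0 <= x3 -> 0 <= x4 ->
    x1 + x2 + 2 * (B * x3 + x4) <= K * (x1 + x2 + x4 + x3).
  move=> p1 p2 p3 p4; rewrite /K.
  have := mulr_ge0 (ltW B0) p1; have := mulr_ge0 (ltW B0) p2.
  have := mulr_ge0 (ltW B0) p4; have := mulr_ge0 (ltW B0) p3.
  rewrite mulrDl !mulrDr; lra.
have es (T : 'I_(ntri m)) c : element_error T (wgrad u) p (y \+ f) (agrad (uh T)) (ph T)
    (ws T c) <= K * serr T c.
  rewrite /serr E_gu E_p E_y; apply: le_trans (Kbig _ _ _ _ _ _ _ _) => //; last exact: norm0_ge0.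
  rewrite /element_error lerD2l.
  have := @norm0mD R (elt T) 2 1 (fun x => y x - yh T) (fun x => f x - c).
  rewrite (@eq_norm0m _ _ _ _ (fun x => _ - _ + _) (fun x => (y \+ f) x - aval (ws T c) x)); last first.
    by move=> x _; rewrite wsE /=; apply/matrixP => a b; rewrite !mxE; ring.
  move=> /(_ (l_y T) (l_f T c)) h.
  have := ler_wpM2l (ltW (h0 T)) h; have := hbound T _ (n0 T _ _ (fun x => y x - yh T)).
  rewrite mulrCA mulrDr; lra.
have ea (T : 'I_(ntri m)) c : element_error T (wgrad phi) r (u \- ud) (agrad (phih T)) (rh T)
    (wa T c) <= K * aerr T c.
  rewrite /aerr E_gphi E_r E_u.
  rewrite [X in K * X](_ : _ = norm0m (elt T) (fun x => wgrad phi x - agrad (phih T)) +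
    norm0 (elt T) (fun x => r x - rh T) + diam (tri T) * norm0m (elt T) (fun x => ud x - c) +
    norm0m (elt T) (fun x => u x - aval (uh T) x)); last by ring.
  apply: le_trans (Kbig _ _ _ _ _ _ _ _) => //; last exact: norm0_ge0.
  rewrite /element_error lerD2l.
  have := @norm0mB R (elt T) 2 1 (fun x => u x - aval (uh T) x) (fun x => ud x - c).
  rewrite (@eq_norm0m _ _ _ _ (fun x => _ - _ - _) (fun x => (u \- ud) x - aval (wa T c) x)); last first.
    by move=> x _; rewrite waE /=; apply/matrixP => a b; rewrite !mxE; ring.
  move=> /(_ (l_u T) (l_ud T c)) h.
  have := ler_wpM2l (ltW (h0 T)) h; have := hbound T _ (n0 T _ _ (fun x => u x - aval (uh T) x)).
  rewrite mulrCA mulrDr; lra.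
have serr_ge (T : 'I_(ntri m)) c : diam (tri T) * norm0m (elt T) (fun x => f x - c) <= serr T c.
  have := norm0_ge0 (elt T) (p \- pw0 ph); have := n0 T _ _ (wgrad u \- gradh uh).
  have := n0 T _ _ (y \- pw0 yh); rewrite /serr; lra.
have aerr_ge (T : 'I_(ntri m)) c : diam (tri T) * norm0m (elt T) (fun x => ud x - c) <= aerr T c.
  have := norm0_ge0 (elt T) (r \- pw0 rh); have := n0 T _ _ (wgrad phi \- gradh phih).
  have := n0 T _ _ (u \- pw1 uh); rewrite /aerr; lra.
have serr0 (T : 'I_(ntri m)) c : 0 <= serr T c := le_trans (hn0 T _ _ _) (serr_ge T c).
have aerr0 (T : 'I_(ntri m)) c : 0 <= aerr T c := le_trans (hn0 T _ _ _) (aerr_ge T c).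
have CK (X Y X' Y' : R) : 0 <= X -> 0 <= X' -> Y <= K * X -> Y' <= K * X' ->
    C0 * (Y + Y') <= C * (X + X').
  move=> X0 X'0 YX Y'X; apply: (@le_trans _ _ (C0 * K * (X + X'))).
    by rewrite -mulrA ler_wpM2l ?(ltW C00)// mulrDr lerD.
  by rewrite ler_wpM2r ?addr_ge0// /C; lra.
have osc_s (T : 'I_(ntri m)) (X a : R) : (forall c, X <= C * (serr T c + a)) ->
    X <= C * (state_error T + a).
  move=> h; rewrite /state_error -!addrA addrA.
  rewrite [X in _ <= C * X](_ : _ = norm0m (elt T) (wgrad u \- gradh uh) + norm0 (elt T) (p \- pw0 ph) +
     osc f T + (norm0m (elt T) (y \- pw0 yh) + a)); last by ring.
  by apply: osc_le => // c; apply: le_trans (h c) _; rewrite /serr addrA.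
have osc_a (T : 'I_(ntri m)) (X a : R) : (forall c, X <= C * (aerr T c + a)) ->
    X <= C * (adjoint_error T + a).
  move=> h; rewrite /adjoint_error.
  by apply: osc_le => // c; apply: le_trans (h c) _.
split=> [T|T T' i j hTT' he].
- split.
  + rewrite -[state_error T]addr0; apply: (osc_s) => c; rewrite addr0.
    have -> : norm0m (elt T) (f \+ pw0 yh) =
        norm0m (elt T) (fun x => aval (ws T c) x + (f x - c)).
      apply: eq_norm0m => x Tx; rewrite /= /pw0 (pw_elt hm _ Tx) wsE.
      by apply/matrixP => a b; rewrite !mxE; ring.
    have := norm0mD (L2a T (ws T c)) (l_f T c).
    move/(ler_wpM2l (ltW (h0 T))) => h; apply: (le_trans h).
    have h1 := le_trans (els T (ws T c)) (ler_wpM2l (ltW C00) (es T c)).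
    rewrite mulrCA mulrDr /C; have := serr_ge T c; lra.
  + rewrite -[adjoint_error T]addr0; apply: (osc_a) => c; rewrite addr0.
    have -> : norm0m (elt T) (pw1 uh \- ud) =
        norm0m (elt T) (fun x => aval (wa T c) x - (ud x - c)).
      apply: eq_norm0m => x Tx; rewrite /= /pw1 (pw_elt hm _ Tx) waE.
      by apply/matrixP => a b; rewrite !mxE; ring.
    have := norm0mB (L2a T (wa T c)) (l_ud T c).
    move/(ler_wpM2l (ltW (h0 T))) => h; apply: (le_trans h).
    have h1 := le_trans (ela T (wa T c)) (ler_wpM2l (ltW C00) (ea T c)).
    rewrite mulrCA mulrDr /C; have := aerr_ge T c; lra.
  + have E1 : norm0m (elt T) (pw1 phih \- pw0 Piphih) = norm0m (elt T)
        (fun x => (aval (phih T) x - phi x) + (phi x - Piphih T)).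
      apply: eq_norm0m => x Tx; rewrite /= /pw1 /pw0 !(pw_elt hm _ Tx).
      by rewrite addrA subrK.
    have E2 : norm0m (elt T) (pw1 phih \- phi) = norm0m (elt T) (fun x => aval (phih T) x - phi x).
      by apply: eq_norm0m => x Tx; rewrite /= /pw1 (pw_elt hm _ Tx).
    have E3 : norm0m (elt T) (phi \- pw0 Piphih) = norm0m (elt T) (fun x => phi x - Piphih T).
      by apply: eq_norm0m => x Tx; rewrite /= /pw0 (pw_elt hm _ Tx).
    rewrite E1 E2 E3.
    apply: le_trans (norm0mD (l_p1 T) (l_p2 T)) _.
    by rewrite ler_wpM2r ?addr_ge0.
- split.
  + rewrite edge_norm0_cst.
    have -> : frob (((ph T)%:M - agrad (uh T)) *m outer_normal (vertex T) i +
        ((ph T')%:M - agrad (uh T')) *m outer_normal (vertex T') j) =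
      frob ((agrad (uh T) + (- 1 * ph T)%:M) *m outer_normal (vertex T) i +
        (agrad (uh T') + (- 1 * ph T')%:M) *m outer_normal (vertex T') j).
      have neg (A : 'M[R]_2) (a : R) : a%:M - A = - (A + (- 1 * a)%:M).
        by rewrite mulN1r raddfN/= opprD opprK addrC.
      by rewrite !neg !mulNmx -opprD frobN.
    (* The two oscillations are treated in turn, with independent constants: the slot [a] of [osc_s]
       carries the error of the other triangle. *)
    apply: (osc_s) => c; rewrite [serr T c + _]addrC; apply: (osc_s) => c'.
    rewrite [serr T' c' + _]addrC.
    apply: le_trans (eds T i T' j (ws T c) (ws T' c') hTT') _.
    exact: CK.
  + rewrite edge_norm0_cst.
    have -> : frob (((rh T)%:M + agrad (phih T)) *m outer_normal (vertex T) i +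
        ((rh T')%:M + agrad (phih T')) *m outer_normal (vertex T') j) =
      frob ((agrad (phih T) + (1 * rh T)%:M) *m outer_normal (vertex T) i +
        (agrad (phih T') + (1 * rh T')%:M) *m outer_normal (vertex T') j).
      by rewrite !mul1r ![_%:M + _]addrC.
    apply: (osc_a) => c; rewrite [aerr T c + _]addrC; apply: (osc_a) => c'.
    rewrite [aerr T' c' + _]addrC.
    apply: le_trans (eda T i T' j (wa T c) (wa T' c') hTT') _.
    exact: CK.
Qed.
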